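(* Let $G$ be a finite group scheme over a field $k$ of characteristic $p>0$, let $M$ be a finite dimensional $kG$-module, and let $\alpha_K:K[t]/t^p\to KG$ be a $\pi$-point of $G$. Assume that $\alpha_K$ has maximal Jordan type on $M$. Then there are isomorphisms of $K[t]/t^p$-modules $$\alpha_K^*(M_K^\#)\simeq\alpha_K^*(M_K)\simeq(\alpha_K^*(M_K))^\#.$$ Moreover, a $\pi$-point $\alpha_K$ has maximal Jordan type on $M$ if and only if it has maximal Jordan type on $M^\#$.
   Context: $k$ is a field of characteristic $p>0$. A finite group scheme $G$ over $k$ is a group scheme whose coordinate algebra $k[G]$ is finite dimensional; its group algebra $kG$ (a Hopf algebra) is the linear dual of $k[G]$. For a field extension $K/k$, $KG=K\otimes_k kG$ is the group algebra of $G_K=G\times_{\mathrm{Spec}\,k}\mathrm{Spec}\,K$, and $M_K=K\otimes_k M$. A $\pi$-point of $G$ is a left flat map of $K$-algebras $\alpha_K:K[t]/t^p\to KG$, for some field extension $K/k$, which factors through the group algebra $KC_K\subset KG$ of some unipotent abelian subgroup scheme $C_K\subset G_K$; $\alpha_K^*$ denotes restriction of modules along $\alpha_K$. Every finite dimensional $K[t]/t^p$-module is a direct sum of $a_i$ copies of the indecomposables $[i]=K[t]/t^i$, $1\le i\le p$; its Jordan type is $a_p[p]+\cdots+a_1[1]$, regarded as a partition of the dimension. Jordan types of the same dimension are compared by the dominance order on partitions: $\underline a\ge\underline b$ if and only if, $A$ and $B$ being nilpotent matrices of Jordan types $\underline a$ and $\underline b$, $\mathrm{rank}(A^j)\ge\mathrm{rank}(B^j)$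 for all $1\le j<p$; $\underline a>\underline b$ if moreover some inequality is strict. The $\pi$-point $\alpha_K$ has maximal Jordan type on $M$ if there is no $\pi$-point $\beta_L$ of $G$ such that the Jordan type of $\beta_L^*(M_L)$ is strictly greater than that of $\alpha_K^*(M_K)$. $M^\#=\mathrm{Hom}_k(M,k)$ is the dual $kG$-module (action through the antipode of $kG$). For a $K[t]/t^p$-module $N$, $N^\#=\mathrm{Hom}_K(N,K)$ is the dual with respect to the Hopf structure on $K[t]/t^p$ in which $t$ is primitive ($t\mapsto t\otimes1+1\otimes t$). *)

(* Defs.v *)
From HB Require Import structures.
From mathcomp Require Import all_boot all_order all_algebra ring.

Set Implicit Arguments.
Unset Strict Implicit.
Unset Printing Implicit Defensive.

Import GRing.Theory.
Local Open Scope ring_scope.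

(* A finite group scheme G over k is given by its coordinate algebra k[G], a  *)
(* finite dimensional commutative Hopf algebra, presented by its structure    *)
(* constants in a basis e_0, ..., e_(n-1), n = gs_dim G:                      *)
(*   e_i e_j   = \sum_l gs_mul i j l e_l       1       = \sum_i gs_one i e_i  *)
(*   Delta e_l = \sum_(i, j) gs_comul l i j (e_i (x) e_j)                     *)
(*   eps e_i   = gs_counit i                   S e_i = \sum_j gs_antip i j e_j*)
Record finGroupScheme (k : fieldType) := FinGroupScheme {
  gs_dim : nat;
  gs_mul : 'I_gs_dim -> 'I_gs_dim -> 'I_gs_dim -> k;
  gs_one : 'I_gs_dim -> k;
  gs_comul : 'I_gs_dim -> 'I_gs_dim -> 'I_gs_dim -> k;
  gs_counit : 'I_gs_dim -> k;
  gs_antip : 'I_gs_dim -> 'I_gs_dim -> k;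
  gs_mulA : forall i j l q,
    \sum_a gs_mul i j a * gs_mul a l q = \sum_a gs_mul j l a * gs_mul i a q;
  gs_mulC : forall i j l, gs_mul i j l = gs_mul j i l;
  gs_mul1 : forall i j, \sum_a gs_one a * gs_mul a i j = (i == j)%:R;
  gs_comulA : forall l i j q,
    \sum_a gs_comul l a q * gs_comul a i j
      = \sum_a gs_comul l i a * gs_comul a j q;
  gs_counitl : forall l i, \sum_a gs_comul l a i * gs_counit a = (l == i)%:R;
  gs_counitr : forall l i, \sum_a gs_comul l i a * gs_counit a = (l == i)%:R;
  gs_comulM : forall i j u v,
    \sum_a gs_mul i j a * gs_comul a u v
      = \sum_a \sum_b \sum_c \sum_d
          gs_comul i a b * gs_comul j c d * (gs_mul a c u * gs_mul b d v);
  gs_comul1 : forall u v, \sum_a gs_one a * gs_comul a u v = gs_one u * gs_one v;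
  gs_counitM : forall i j,
    \sum_a gs_mul i j a * gs_counit a = gs_counit i * gs_counit j;
  gs_counit1 : \sum_a gs_one a * gs_counit a = 1;
  gs_antipl : forall l q,
    \sum_i \sum_j \sum_a gs_comul l i j * (gs_antip i a * gs_mul a j q)
      = gs_counit l * gs_one q;
  gs_antipr : forall l q,
    \sum_i \sum_j \sum_a gs_comul l i j * (gs_antip j a * gs_mul i a q)
      = gs_counit l * gs_one q
}.

Section BaseChange.

Variables (k K : fieldType) (iota : {rmorphism k -> K}) (G : finGroupScheme k).

Let mulK i j l := iota (@gs_mul k G i j l).
Let oneK i := iota (@gs_one k G i).
Let comulK l i j := iota (@gs_comul k G l i j).
Let counitK i := iota (@gs_counit k G i).
Let antipK i j := iota (@gs_antip k G i j).

Let mulKA i j l q :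
  \sum_a mulK i j a * mulK a l q = \sum_a mulK j l a * mulK i a q.
Proof.
have := congr1 iota (gs_mulA i j l q); rewrite !rmorph_sum /=.
by under eq_bigr do rewrite rmorphM; under [RHS]eq_bigr do rewrite rmorphM.
Qed.

Let mulKC i j l : mulK i j l = mulK j i l.
Proof. by rewrite /mulK gs_mulC. Qed.

Let mulK1 i j : \sum_a oneK a * mulK a i j = (i == j)%:R.
Proof.
have := congr1 iota (gs_mul1 i j); rewrite rmorph_sum rmorph_nat /= => <-.
by apply: eq_bigr => a _; rewrite rmorphM.
Qed.

Let comulKA l i j q :
  \sum_a comulK l a q * comulK a i j = \sum_a comulK l i a * comulK a j q.
Proof.
have := congr1 iota (gs_comulA l i j q); rewrite !rmorph_sum /=.
by under eq_bigr do rewrite rmorphM; under [RHS]eq_bigr do rewrite rmorphM.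
Qed.

Let counitKl l i : \sum_a comulK l a i * counitK a = (l == i)%:R.
Proof.
have := congr1 iota (gs_counitl l i); rewrite rmorph_sum rmorph_nat /= => <-.
by apply: eq_bigr => a _; rewrite rmorphM.
Qed.

Let counitKr l i : \sum_a comulK l i a * counitK a = (l == i)%:R.
Proof.
have := congr1 iota (gs_counitr l i); rewrite rmorph_sum rmorph_nat /= => <-.
by apply: eq_bigr => a _; rewrite rmorphM.
Qed.

Let comulKM i j u v :
  \sum_a mulK i j a * comulK a u v
    = \sum_a \sum_b \sum_c \sum_d
        comulK i a b * comulK j c d * (mulK a c u * mulK b d v).
Proof.
transitivity (iota (\sum_a gs_mul i j a * gs_comul a u v)).
  by rewrite rmorph_sum; apply: eq_bigr => a _; rewrite rmorphM.
rewrite gs_comulM; do 4![rewrite rmorph_sum; apply: eq_bigr => ? _].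
by rewrite !rmorphM.
Qed.

Let comulK1 u v : \sum_a oneK a * comulK a u v = oneK u * oneK v.
Proof.
rewrite /oneK -rmorphM -gs_comul1 rmorph_sum.
by apply: eq_bigr => a _; rewrite rmorphM.
Qed.

Let counitKM i j : \sum_a mulK i j a * counitK a = counitK i * counitK j.
Proof.
rewrite /counitK -rmorphM -gs_counitM rmorph_sum.
by apply: eq_bigr => a _; rewrite rmorphM.
Qed.

Let counitK1 : \sum_a oneK a * counitK a = 1.
Proof.
rewrite -(rmorph1 iota) -(gs_counit1 G) rmorph_sum.
by apply: eq_bigr => a _; rewrite rmorphM.
Qed.

Let antipKl l q :
  \sum_i \sum_j \sum_a comulK l i j * (antipK i a * mulK a j q)
    = counitK l * oneK q.
Proof.
rewrite /counitK /oneK -rmorphM -gs_antipl.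
do 3![rewrite rmorph_sum; apply: eq_bigr => ? _].
by rewrite !rmorphM.
Qed.

Let antipKr l q :
  \sum_i \sum_j \sum_a comulK l i j * (antipK j a * mulK i a q)
    = counitK l * oneK q.
Proof.
rewrite /counitK /oneK -rmorphM -gs_antipr.
do 3![rewrite rmorph_sum; apply: eq_bigr => ? _].
by rewrite !rmorphM.
Qed.

Definition base_change : finGroupScheme K :=
  FinGroupScheme mulKA mulKC mulK1 comulKA counitKl counitKr comulKM comulK1
    counitKM counitK1 antipKl antipKr.

End BaseChange.

(* The group algebra kG is the linear dual of k[G]: the row x stands for the  *)
(* functional e_i |-> x 0 i, and the operations are the transposes of those   *)
(* of k[G].                                                                   *)
Definition grpalg (k : fieldType) (G : finGroupScheme k) := 'rV[k]_(gs_dim G).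

Section GroupAlgebra.

Variables (k : fieldType) (G : finGroupScheme k).

HB.instance Definition _ := GRing.Lmodule.on (grpalg G).
HB.instance Definition _ := Vector.on (grpalg G).

Local Notation n := (gs_dim G).
Local Notation kG := (grpalg G).
Implicit Types x y z : kG.

Definition grpalg_one : kG := \row_l gs_counit l.
Definition grpalg_mul x y : kG :=
  \row_l \sum_i \sum_j gs_comul l i j * (x 0 i * y 0 j).

Definition grpalg_counit x : k := \sum_i x 0 i * gs_one i.
Definition grpalg_antip x : kG := \row_i \sum_j gs_antip i j * x 0 j.

(* the coefficient of the comultiplication of kG on e_a^* (x) e_b^*,          *)
(* namely x (e_a e_b)                                                         *)
Definition grpalg_comul x (a b : 'I_n) : k := \sum_l gs_mul a b l * x 0 l.

Fact grpalg_mulA : associative grpalg_mul.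
Proof.
move=> x y z; apply/rowP => l; rewrite !mxE.
transitivity (\sum_i \sum_j \sum_q
    (\sum_a gs_comul l i a * gs_comul a j q) * (x 0 i * y 0 j * z 0 q)).
  apply: eq_bigr => i _.
  under [RHS]eq_bigr do under eq_bigr do rewrite mulr_suml.
  under [RHS]eq_bigr do rewrite exchange_big.
  rewrite exchange_big; apply: eq_bigr => a _; rewrite mxE.
  rewrite mulr_sumr mulr_sumr; apply: eq_bigr => j _.
  rewrite mulr_sumr mulr_sumr; apply: eq_bigr => q _.
  by rewrite -!mulrA; congr (_ * _); rewrite mulrCA; congr (_ * _).
transitivity (\sum_i \sum_j \sum_q
    (\sum_a gs_comul l a q * gs_comul a i j) * (x 0 i * y 0 j * z 0 q)).
  do 3![apply: eq_bigr => ? _]; by rewrite gs_comulA.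
under eq_bigr do under eq_bigr do under eq_bigr do rewrite mulr_suml.
under eq_bigr do under eq_bigr do rewrite exchange_big.
under eq_bigr do rewrite exchange_big.
rewrite exchange_big; apply: eq_bigr => a _.
under [RHS]eq_bigr do rewrite mxE mulr_suml mulr_sumr.
rewrite [RHS]exchange_big; apply: eq_bigr => i _.
under [RHS]eq_bigr do rewrite mulr_suml mulr_sumr.
rewrite [RHS]exchange_big; apply: eq_bigr => j _.
by apply: eq_bigr => q _; rewrite !mulrA.
Qed.

Fact grpalg_mul1l : left_id grpalg_one grpalg_mul.
Proof.
move=> x; apply/rowP => l; rewrite mxE exchange_big /=.
transitivity (\sum_j (l == j)%:R * x 0 j).
  apply: eq_bigr => j _; rewrite -gs_counitl mulr_suml.
  by apply: eq_bigr => i _; rewrite mxE mulrA.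
rewrite (bigD1 l) //= eqxx mul1r big1 ?addr0 // => j /negPf.
by rewrite eq_sym => ->; rewrite mul0r.
Qed.

Fact grpalg_mul1r : right_id grpalg_one grpalg_mul.
Proof.
move=> x; apply/rowP => l; rewrite mxE.
transitivity (\sum_i (l == i)%:R * x 0 i).
  apply: eq_bigr => i _; rewrite -gs_counitr mulr_suml.
  by apply: eq_bigr => j _; rewrite mxE [x 0 i * _]mulrC mulrA.
rewrite (bigD1 l) //= eqxx mul1r big1 ?addr0 // => j /negPf.
by rewrite eq_sym => ->; rewrite mul0r.
Qed.

Fact grpalg_mulDl : left_distributive grpalg_mul +%R.
Proof.
move=> x y z; apply/rowP => l; rewrite !mxE -big_split; apply: eq_bigr => i _.
rewrite -big_split; apply: eq_bigr => j _ /=.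
by rewrite mxE mulrDl mulrDr.
Qed.

Fact grpalg_mulDr : right_distributive grpalg_mul +%R.
Proof.
move=> x y z; apply/rowP => l; rewrite !mxE -big_split; apply: eq_bigr => i _.
rewrite -big_split; apply: eq_bigr => j _ /=.
by rewrite mxE !mulrDr.
Qed.

Fact grpalg_1neq0 : grpalg_one != 0.
Proof.
apply/eqP => /rowP e0; have /eqP := gs_counit1 G.
rewrite big1 ?(eq_sym 0) ?oner_eq0 // => a _.
by have := e0 a; rewrite !mxE => ->; rewrite mulr0.
Qed.

HB.instance Definition _ := GRing.Zmodule_isNzRing.Build kG
  grpalg_mulA grpalg_mul1l grpalg_mul1r grpalg_mulDl grpalg_mulDr grpalg_1neq0.

Fact grpalg_scaleAl (a : k) x y : a *: (x * y) = (a *: x) * y.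
Proof.
apply/rowP => l; rewrite !mxE mulr_sumr; apply: eq_bigr => i _.
rewrite mulr_sumr; apply: eq_bigr => j _.
by rewrite mxE mulrCA -[a * x 0 i * _]mulrA.
Qed.

HB.instance Definition _ := GRing.Lmodule_isLalgebra.Build k kG grpalg_scaleAl.

Fact grpalg_scaleAr (a : k) x y : a *: (x * y) = x * (a *: y).
Proof.
apply/rowP => l; rewrite !mxE mulr_sumr; apply: eq_bigr => i _.
rewrite mulr_sumr; apply: eq_bigr => j _.
by rewrite mxE mulrCA; congr (_ * _); rewrite mulrCA.
Qed.

HB.instance Definition _ := GRing.Lalgebra_isAlgebra.Build k kG grpalg_scaleAr.

End GroupAlgebra.

Section Antipode.

Variables (k : fieldType) (G : finGroupScheme k).
Local Notation n := (gs_dim G).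
Local Notation kG := (grpalg G).
Local Notation e i := (delta_mx 0 i : kG).
Implicit Types x y z : kG.

Lemma grpalg_mulE x y l :
  (x * y) 0 l = \sum_i \sum_j gs_comul l i j * (x 0 i * y 0 j).
Proof. by rewrite [LHS]mxE. Qed.

Lemma grpalg_oneE l : (1 : kG) 0 l = gs_counit l.
Proof. by rewrite mxE. Qed.

Lemma grpalg_scaleE c x l : (c *: x) 0 l = c * x 0 l.
Proof. exact: mxE. Qed.

Lemma grpalg_comul_delta l a b : grpalg_comul (e l) a b = gs_mul a b l.
Proof.
rewrite /grpalg_comul (bigD1 l) //= mxE !eqxx mulr1 big1 ?addr0 // => i nil.
by rewrite mxE (negPf nil) andbF mulr0.
Qed.

Lemma grpalg_rowE x : x = \sum_i x 0 i *: e i.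
Proof. exact: row_sum_delta. Qed.

Fact grpalg_antip_is_linear : linear (@grpalg_antip k G).
Proof.
move=> a x y; apply/rowP => i; rewrite !mxE mulr_sumr -big_split.
by apply: eq_bigr => j _ /=; rewrite !mxE mulrDr mulrCA.
Qed.

HB.instance Definition _ :=
  GRing.isLinear.Build k kG kG *:%R (@grpalg_antip k G) grpalg_antip_is_linear.

Fact grpalg_counit_is_linear : linear (@grpalg_counit k G : kG -> k^o).
Proof.
move=> a x y; rewrite /grpalg_counit scaler_sumr -big_split.
by apply: eq_bigr => j _ /=; rewrite !mxE mulrDl -mulrA.
Qed.

HB.instance Definition _ :=
  GRing.isLinear.Build k kG k^o _ (@grpalg_counit k G) grpalg_counit_is_linear.

Lemma grpalg_comul_sum I (r : seq I) (P : pred I) (F : I -> kG) a b :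
  grpalg_comul (\sum_(i <- r | P i) F i) a b =
  \sum_(i <- r | P i) grpalg_comul (F i) a b.
Proof.
rewrite /grpalg_comul [RHS]exchange_big /=; apply: eq_bigr => l _.
by rewrite summxE mulr_sumr.
Qed.

Lemma grpalg_comulZ c x a b :
  grpalg_comul (c *: x) a b = c * grpalg_comul x a b.
Proof.
by rewrite /grpalg_comul mulr_sumr; apply: eq_bigr => l _; rewrite mxE mulrCA.
Qed.

Lemma grpalg_comulA x a b c :
  \sum_u grpalg_comul x u c * gs_mul a b u =
  \sum_u grpalg_comul x a u * gs_mul b c u.
Proof.
rewrite /grpalg_comul.
under eq_bigr do rewrite mulr_suml.
under [RHS]eq_bigr do rewrite mulr_suml.
rewrite exchange_big [RHS]exchange_big; apply: eq_bigr => l _ /=.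
transitivity ((\sum_u gs_mul a b u * gs_mul u c l) * x 0 l).
  by rewrite mulr_suml; apply: eq_bigr => u _; rewrite mulrC mulrA.
rewrite gs_mulA mulr_suml; apply: eq_bigr => u _.
by rewrite [RHS]mulrC mulrA.
Qed.

Lemma grpalg_comul_counitr (V : lmodType k) (F : kG -> V) x :
  \sum_a \sum_b (grpalg_comul x a b * grpalg_counit (e b)) *: F (e a)
    = \sum_a x 0 a *: F (e a).
Proof.
apply: eq_bigr => a _; rewrite -scaler_suml; congr (_ *: _).
have ce b : grpalg_counit (e b) = gs_one b.
  rewrite /grpalg_counit (bigD1 b) //= mxE !eqxx mul1r big1 ?addr0 // => j nj.
  by rewrite mxE (negPf nj) andbF mul0r.
transitivity (\sum_l (a == l)%:R * x 0 l); last first.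
  rewrite (bigD1 a) //= eqxx mul1r big1 ?addr0 // => j /negPf.
  by rewrite eq_sym => ->; rewrite mul0r.
under eq_bigr do rewrite ce mulr_suml.
rewrite exchange_big; apply: eq_bigr => l _ /=.
rewrite -gs_mul1 mulr_suml; apply: eq_bigr => b _.
by rewrite (gs_mulC a) mulrC mulrA.
Qed.

Lemma grpalg_mul_delta i j l : (e i * e j) 0 l = gs_comul l i j.
Proof.
rewrite grpalg_mulE (bigD1 i) //= [X in _ + X]big1 => [|a na]; last first.
  rewrite big1 // => b _.
  by rewrite [X in _ * (X * _)]mxE (negPf na) andbF mul0r mulr0.
rewrite addr0 (bigD1 j) //= big1 => [|b nb]; last first.
  by rewrite [X in _ * (_ * X)]mxE (negPf nb) andbF !mulr0.
by rewrite !mxE !eqxx !mulr1 addr0.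
Qed.

Lemma grpalg_antip_delta i a : grpalg_antip (e i) 0 a = gs_antip a i.
Proof.
rewrite mxE (bigD1 i) //= mxE !eqxx mulr1 big1 ?addr0 // => j nj.
by rewrite mxE (negPf nj) andbF mulr0.
Qed.

Lemma grpalg_mul_deltar x j l :
  (x * e j) 0 l = \sum_i gs_comul l i j * x 0 i.
Proof.
rewrite grpalg_mulE; apply: eq_bigr => i _.
rewrite (bigD1 j) //= big1 => [|b nb]; last first.
  by rewrite [X in _ * (_ * X)]mxE (negPf nb) andbF !mulr0.
by rewrite mxE !eqxx !mulr1 addr0.
Qed.

Lemma grpalg_mul_deltal x i l :
  (e i * x) 0 l = \sum_j gs_comul l i j * x 0 j.
Proof.
rewrite grpalg_mulE (bigD1 i) //= [X in _ + X]big1 => [|a na]; last first.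
  rewrite big1 // => b _.
  by rewrite [X in _ * (X * _)]mxE (negPf na) andbF mul0r mulr0.
by rewrite addr0; apply: eq_bigr => j _; rewrite mxE !eqxx mul1r.
Qed.

Lemma grpalg_antip_lawl x :
  \sum_a \sum_b grpalg_comul x a b *: (grpalg_antip (e a) * e b)
    = (grpalg_counit x)%:A.
Proof.
apply/rowP => l; rewrite summxE [RHS]mxE grpalg_oneE.
rewrite /grpalg_counit mulr_suml.
transitivity (\sum_q (\sum_i \sum_j \sum_a
   gs_comul l i j * (gs_antip i a * gs_mul a j q)) * x 0 q); last first.
  by apply: eq_bigr => q _; rewrite gs_antipl; ring.
under [RHS]eq_bigr do rewrite mulr_suml.
rewrite [RHS]exchange_big /=.
under [RHS]eq_bigr do under eq_bigr do rewrite mulr_suml.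
under [RHS]eq_bigr do rewrite exchange_big /=.
under [RHS]eq_bigr do under eq_bigr do under eq_bigr do rewrite mulr_suml.
under [RHS]eq_bigr do under eq_bigr do rewrite exchange_big /=.
under eq_bigr do rewrite summxE.
under eq_bigr do under eq_bigr do rewrite grpalg_scaleE grpalg_mul_deltar mulr_sumr.
under eq_bigr do rewrite exchange_big /=.
rewrite exchange_big /=; apply: eq_bigr => i _.
rewrite exchange_big /=; apply: eq_bigr => j _; apply: eq_bigr => a _.
rewrite grpalg_antip_delta /grpalg_comul mulr_suml; apply: eq_bigr => q _.
ring.
Qed.

Lemma grpalg_antip_lawr x :
  \sum_a \sum_b grpalg_comul x a b *: (e a * grpalg_antip (e b))
    = (grpalg_counit x)%:A.
Proof.
apply/rowP => l; rewrite summxE [RHS]mxE grpalg_oneE.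
rewrite /grpalg_counit mulr_suml.
transitivity (\sum_q (\sum_i \sum_j \sum_a
   gs_comul l i j * (gs_antip j a * gs_mul i a q)) * x 0 q); last first.
  by apply: eq_bigr => q _; rewrite gs_antipr; ring.
under [RHS]eq_bigr do rewrite mulr_suml.
rewrite [RHS]exchange_big /=.
under [RHS]eq_bigr do under eq_bigr do rewrite mulr_suml.
under [RHS]eq_bigr do rewrite exchange_big /=.
under [RHS]eq_bigr do under eq_bigr do under eq_bigr do rewrite mulr_suml.
under [RHS]eq_bigr do under eq_bigr do rewrite exchange_big /=.
apply: eq_bigr => i _; rewrite summxE.
under [LHS]eq_bigr do rewrite grpalg_scaleE grpalg_mul_deltal mulr_sumr.
rewrite exchange_big /=; apply: eq_bigr => j _; apply: eq_bigr => a _.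
rewrite grpalg_antip_delta /grpalg_comul mulr_suml; apply: eq_bigr => q _.
by ring.
Qed.

Lemma grpalg_comulM p q a b :
  grpalg_comul (e p * e q) a b =
  \sum_i \sum_j \sum_u \sum_v
    (grpalg_comul (e p) i j * grpalg_comul (e q) u v) *
    ((e i * e u) 0 a * (e j * e v) 0 b).
Proof.
rewrite [LHS]/grpalg_comul; under eq_bigr do rewrite grpalg_mul_delta.
rewrite gs_comulM; apply: eq_bigr => i _.
rewrite exchange_big /=; do 3![apply: eq_bigr => ? _].
by rewrite !grpalg_comul_delta !grpalg_mul_delta mulrC.
Qed.

(* F is recovered from its convolution product with the identity map *)
Lemma grpalg_conv_inv (F H : kG -> kG) :
    (forall x, F x = \sum_i x 0 i *: F (e i)) ->
    (forall l, \sum_a \sum_b grpalg_comul (e l) a b *: (F (e a) * e b) = H (e l)) ->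
  forall x, F x =
    \sum_a \sum_b grpalg_comul x a b *: (H (e a) * grpalg_antip (e b)).
Proof.
move=> linF defH x.
transitivity (\sum_c \sum_d \sum_b (\sum_a grpalg_comul x a b * gs_mul c d a)
    *: (F (e c) * e d * grpalg_antip (e b))); last first.
  under eq_bigr do under eq_bigr do under eq_bigr do rewrite scaler_suml.
  under eq_bigr do under eq_bigr do rewrite exchange_big /=.
  under eq_bigr do rewrite exchange_big /=.
  rewrite exchange_big /=; apply: eq_bigr => a _.
  under [RHS]eq_bigr do rewrite -defH mulr_suml scaler_sumr.
  rewrite [RHS]exchange_big /=.
  under [RHS]eq_bigr do under eq_bigr do rewrite mulr_suml scaler_sumr.
  under [RHS]eq_bigr do rewrite exchange_big /=.
  do 3![apply: eq_bigr => ? _].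
  by rewrite grpalg_comul_delta -scalerAl scalerA.
under eq_bigr do under eq_bigr do under eq_bigr do rewrite grpalg_comulA.
rewrite [LHS]linF.
rewrite -(grpalg_comul_counitr F); apply: eq_bigr => c _.
transitivity (\sum_u grpalg_comul x c u *:
   (F (e c) * \sum_d \sum_b gs_mul d b u *: (e d * grpalg_antip (e b)))).
  apply: eq_bigr => u _; have := grpalg_antip_lawr (e u).
  under eq_bigr do under eq_bigr do rewrite grpalg_comul_delta.
  by move=> ->; rewrite -scalerAr mulr1 scalerA.
under [LHS]eq_bigr do rewrite mulr_sumr scaler_sumr.
rewrite exchange_big /=; apply: eq_bigr => d _.
under [LHS]eq_bigr do rewrite mulr_sumr scaler_sumr.
rewrite exchange_big /=; apply: eq_bigr => b _.
rewrite scaler_suml; apply: eq_bigr => u _.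
by rewrite -scalerAr scalerA mulrA.
Qed.

Lemma grpalg_antipE x : grpalg_antip x = \sum_i x 0 i *: grpalg_antip (e i).
Proof.
by rewrite {1}[x]grpalg_rowE linear_sum; apply: eq_bigr => i _; rewrite linearZ.
Qed.

Lemma grpalg_comulC x a b : grpalg_comul x a b = grpalg_comul x b a.
Proof. by apply: eq_bigr => l _; rewrite gs_mulC. Qed.

Lemma grpalg_comul_counitl (V : lmodType k) (F : kG -> V) x :
  \sum_a \sum_b (grpalg_comul x a b * grpalg_counit (e a)) *: F (e b)
    = \sum_b x 0 b *: F (e b).
Proof.
rewrite exchange_big -grpalg_comul_counitr; apply: eq_bigr => b _.
by apply: eq_bigr => a _; rewrite grpalg_comulC.
Qed.

Fact grpalg_counit1 : grpalg_counit (1 : kG) = 1.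
Proof.
rewrite -[RHS](gs_counit1 G); apply: eq_bigr => i _.
by rewrite grpalg_oneE mulrC.
Qed.

Fact grpalg_counitM x y :
  grpalg_counit (x * y) = grpalg_counit x * grpalg_counit y.
Proof.
rewrite /grpalg_counit mulr_suml.
under [LHS]eq_bigr do rewrite grpalg_mulE mulr_suml.
rewrite exchange_big /=; apply: eq_bigr => i _; rewrite mulr_sumr.
under [LHS]eq_bigr do rewrite mulr_suml.
rewrite exchange_big /=; apply: eq_bigr => j _.
rewrite mulrACA -gs_comul1 mulr_sumr.
by apply: eq_bigr => a _; rewrite -mulrA mulrC -mulrA mulrCA mulrC -!mulrA; ring.
Qed.

HB.instance Definition _ :=
  GRing.isMonoidMorphism.Build kG k^o (@grpalg_counit k G)
    (conj grpalg_counit1 grpalg_counitM).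

Fact grpalg_antip1 : grpalg_antip (1 : kG) = 1.
Proof.
have c1 a b : grpalg_comul (1 : kG) a b = (1 : kG) 0 a * (1 : kG) 0 b.
  rewrite !grpalg_oneE -gs_counitM /grpalg_comul.
  by apply: eq_bigr => l _; rewrite grpalg_oneE.
transitivity (grpalg_antip (1 : kG) * 1); first by rewrite mulr1.
rewrite -[RHS]scale1r -grpalg_counit1 -grpalg_antip_lawl.
rewrite {1}grpalg_antipE {2}[1]grpalg_rowE mulr_suml; apply: eq_bigr => a _.
rewrite mulr_sumr; apply: eq_bigr => b _.
by rewrite c1 -scalerAl -scalerAr scalerA.
Qed.

Lemma grpalg_antip_conv p l :
  \sum_b \sum_d gs_mul b d l *:
     ((\sum_a \sum_c gs_mul a c p *: (grpalg_antip (e a * e b) * e c)) * e d)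
  = (grpalg_counit (e p) * grpalg_counit (e l))%:A.
Proof.
rewrite -grpalg_counitM -grpalg_antip_lawl.
transitivity (\sum_a \sum_c \sum_b \sum_d (gs_mul a c p * gs_mul b d l) *:
   (grpalg_antip (e a * e b) * (e c * e d))).
  under [LHS]eq_bigr do under eq_bigr do rewrite mulr_suml scaler_sumr.
  under [LHS]eq_bigr do rewrite exchange_big /=.
  rewrite exchange_big /=; apply: eq_bigr => a _.
  under [LHS]eq_bigr do under eq_bigr do rewrite mulr_suml scaler_sumr.
  under [LHS]eq_bigr do rewrite exchange_big /=.
  rewrite exchange_big /=; apply: eq_bigr => c _.
  apply: eq_bigr => b _; apply: eq_bigr => d _.
  by rewrite -scalerAl scalerA mulrA [_ * gs_mul b d l]mulrC.
under [RHS]eq_bigr do under eq_bigr do rewrite grpalg_comulM scaler_suml.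
under [RHS]eq_bigr do rewrite exchange_big /=.
rewrite [RHS]exchange_big /=; apply: eq_bigr => a _.
under [RHS]eq_bigr do under eq_bigr do rewrite scaler_suml.
under [RHS]eq_bigr do rewrite exchange_big /=.
rewrite [RHS]exchange_big /=; apply: eq_bigr => c _.
under [RHS]eq_bigr do under eq_bigr do rewrite scaler_suml.
under [RHS]eq_bigr do rewrite exchange_big /=.
rewrite [RHS]exchange_big /=; apply: eq_bigr => b _.
under [RHS]eq_bigr do under eq_bigr do rewrite scaler_suml.
under [RHS]eq_bigr do rewrite exchange_big /=.
rewrite [RHS]exchange_big /=; apply: eq_bigr => d _.
rewrite !grpalg_comul_delta (grpalg_antipE (e a * e b))
  {1}[e c * e d]grpalg_rowE.
rewrite mulr_suml scaler_sumr; apply: eq_bigr => u _.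
rewrite mulr_sumr scaler_sumr; apply: eq_bigr => v _.
by rewrite -scalerAl -scalerAr !scalerA mulrA.
Qed.

Fact grpalg_antipM x y :
  grpalg_antip (x * y) = grpalg_antip y * grpalg_antip x.
Proof.
have conv_delta p z :
    \sum_a \sum_c gs_mul a c p *: (grpalg_antip (e a * z) * e c)
      = grpalg_counit (e p) *: grpalg_antip z.
  pose F z := \sum_a \sum_c gs_mul a c p *: (grpalg_antip (e a * z) * e c).
  pose H z : kG := (grpalg_counit (e p) * grpalg_counit z)%:A.
  rewrite -/(F z) (@grpalg_conv_inv F H); first 1 last.
  - move=> w; rewrite /F; under [RHS]eq_bigr do rewrite scaler_sumr.
    rewrite [RHS]exchange_big /=; apply: eq_bigr => a _.
    under [RHS]eq_bigr do rewrite scaler_sumr.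
    rewrite [RHS]exchange_big /=; apply: eq_bigr => c _.
    rewrite {1}[w]grpalg_rowE mulr_sumr linear_sum mulr_suml scaler_sumr.
    apply: eq_bigr => i _; rewrite -scalerAr linearZ -scalerAl !scalerA.
    by rewrite [LHS]/= mulrC.
  - move=> l; under [LHS]eq_bigr do under eq_bigr do rewrite grpalg_comul_delta.
    exact: grpalg_antip_conv.
  rewrite [in RHS]grpalg_antipE -grpalg_comul_counitl scaler_sumr.
  apply: eq_bigr => b _; rewrite scaler_sumr; apply: eq_bigr => d _.
  by rewrite /H -scalerAl mul1r !scalerA; congr (_ *: _); ring.
rewrite (@grpalg_conv_inv (fun x => grpalg_antip (x * y))
                          (fun x => grpalg_counit x *: grpalg_antip y)).
- rewrite [in RHS](grpalg_antipE x) -grpalg_comul_counitl mulr_sumr.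
  apply: eq_bigr => a _; rewrite mulr_sumr; apply: eq_bigr => c _.
  by rewrite -scalerAl -scalerAr scalerA.
- move=> w; rewrite {1}[w]grpalg_rowE mulr_suml linear_sum.
  by apply: eq_bigr => i _; rewrite -scalerAl linearZ.
move=> l; under [LHS]eq_bigr do under eq_bigr do rewrite grpalg_comul_delta.
exact: conv_delta.
Qed.

End Antipode.

(* A kG-module of dimension m is an algebra morphism kG -> 'M_m; matrices act *)
(* on column vectors, so these are left modules.                              *)
Section Modules.

Variables (k : fieldType) (G : finGroupScheme k) (m : nat).
Local Notation kG := (grpalg G).

Section Dual.

Variable M : {lrmorphism kG -> 'M[k]_m}.

Definition grpalg_dual (x : kG) : 'M[k]_m := (M (grpalg_antip x))^T.

Fact grpalg_dual_is_linear : linear grpalg_dual.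
Proof. by move=> a x y; rewrite /grpalg_dual !linearP. Qed.

Fact grpalg_dual_is_monoid_morphism : monoid_morphism grpalg_dual.
Proof.
split=> [|x y]; rewrite /grpalg_dual; first by rewrite grpalg_antip1 rmorph1 trmx1.
by rewrite grpalg_antipM rmorphM trmx_mul.
Qed.

HB.instance Definition _ :=
  GRing.isLinear.Build k kG 'M[k]_m *:%R grpalg_dual grpalg_dual_is_linear.
HB.instance Definition _ :=
  GRing.isMonoidMorphism.Build kG 'M[k]_m grpalg_dual
    grpalg_dual_is_monoid_morphism.

End Dual.

Section Extension.

Variables (K : fieldType) (iota : {rmorphism k -> K}).
Variable M : {lrmorphism kG -> 'M[k]_m}.
Local Notation KG := (grpalg (base_change iota G)).

Definition module_ext (x : KG) : 'M[K]_m :=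
  \sum_(i < gs_dim G) x 0 i *: map_mx iota (M (delta_mx 0 i : kG)).

Fact module_ext_is_linear : linear module_ext.
Proof.
move=> a x y; rewrite /module_ext scaler_sumr -big_split.
by apply: eq_bigr => i _ /=; rewrite !mxE scalerDl scalerA.
Qed.

Fact module_extE (x : kG) :
  \sum_(i < gs_dim G) iota (x 0 i) *: map_mx iota (M (delta_mx 0 i : kG)) =
  map_mx iota (M x).
Proof.
rewrite {2}[x]grpalg_rowE linear_sum map_mx_sum /=.
by apply: eq_bigr => i _; rewrite linearZ map_mxZ.
Qed.

Fact module_ext_is_monoid_morphism : monoid_morphism module_ext.
Proof.
split=> [|x y].
  have -> : (1 : 'M[K]_m) = map_mx iota (M 1) by rewrite rmorph1 [RHS]map_mx1.
  rewrite -module_extE.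
  by apply: eq_bigr => i _; rewrite !grpalg_oneE.
transitivity (\sum_i \sum_j (x 0 i * y 0 j) *:
    map_mx iota (M ((delta_mx 0 i : kG) * (delta_mx 0 j : kG)))); last first.
  rewrite /module_ext mulr_suml; apply: eq_bigr => i _.
  rewrite mulr_sumr; apply: eq_bigr => j _.
  rewrite rmorphM map_mxM -[RHS]/(_ *m _).
  by rewrite -scalemxAl -scalemxAr scalerA.
under [RHS]eq_bigr do under eq_bigr do rewrite -module_extE scaler_sumr.
under [RHS]eq_bigr do rewrite exchange_big.
rewrite exchange_big /module_ext; apply: eq_bigr => l _.
rewrite grpalg_mulE scaler_suml; apply: eq_bigr => i _.
rewrite scaler_suml; apply: eq_bigr => j _.
by rewrite grpalg_mul_delta scalerA mulrC.
Qed.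

HB.instance Definition _ :=
  GRing.isLinear.Build K KG 'M[K]_m *:%R module_ext module_ext_is_linear.
HB.instance Definition _ :=
  GRing.isMonoidMorphism.Build KG 'M[K]_m module_ext
    module_ext_is_monoid_morphism.

End Extension.

End Modules.

Arguments module_ext {k G m K} iota M x.

(* (M_K)^# = (M^#)_K                                                          *)
Fact grpalg_dual_ext (k K : fieldType) (iota : {rmorphism k -> K})
    (G : finGroupScheme k) (m : nat) (M : {lrmorphism grpalg G -> 'M[k]_m}) :
  grpalg_dual (module_ext iota M) =1 module_ext iota (grpalg_dual M).
Proof.
move=> x; rewrite [RHS]/module_ext.
transitivity (\sum_j x 0 j *: (map_mx iota 
    (M (grpalg_antip (delta_mx 0 j : grpalg G))))^T);
  last by apply: eq_bigr => j _; rewrite map_trmx.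
under eq_bigr do rewrite -module_extE linear_sum scaler_sumr.
rewrite exchange_big /grpalg_dual /module_ext linear_sum.
apply: eq_bigr => i _; rewrite linearZ /= [grpalg_antip x _ _]mxE scaler_suml.
apply: eq_bigr => j _; rewrite linearZ /= scalerA grpalg_antip_delta.
by rewrite [x 0 j * _]mulrC.
Qed.

Definition rep_iso (A : Type) (F : fieldType) (m : nat) (N N' : A -> 'M[F]_m) :
    Prop :=
  exists2 P : 'M[F]_m, P \in unitmx & forall a, P *m N a = N' a *m P.

Notation trunc_poly F p := {poly %/ ('X^p : {poly F})}.

(* In the Hopf structure on F[t]/t^p for which t is primitive, the antipode   *)
(* is the algebra endomorphism t |-> - t.                                     *)
Section TruncatedPolynomials.

Variables (F : fieldType) (p : nat).
Local Notation A := (trunc_poly F p).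

Definition trunc_antip (r : A) : A := in_qpoly 'X^p ((r : {poly F}) \Po - 'X).

Fact trunc_antip_is_linear : linear trunc_antip.
Proof.
by move=> a r s; rewrite /trunc_antip poly_of_qpolyD poly_of_qpolyZ !linearP.
Qed.

Fact trunc_antip_is_monoid_morphism : monoid_morphism trunc_antip.
Proof.
split=> [|r s]; first by rewrite /trunc_antip comp_polyC in_qpoly1.
rewrite /trunc_antip poly_of_qpolyM -in_qpolyM -comp_polyM.
set h := mk_monic _; set u := (r : {poly F}) * s.
have hM : h \is monic := monic_mk_monic _.
rewrite [u in RHS](Pdiv.RingMonic.rdivp_eq hM) comp_polyD comp_polyM.
rewrite in_qpolyD in_qpolyM; suff -> : in_qpoly 'X^p (h \Po - 'X) = 0 :> A.
  by rewrite mulr0 add0r.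
apply: val_inj => /=; rewrite -/h {1}/h mk_monic_Xn comp_Xn_poly exprNn.
rewrite -signr_odd -(mk_monic_Xn F) -/h.
by rewrite Pdiv.RingMonic.rmodp_mull.
Qed.

HB.instance Definition _ :=
  GRing.isLinear.Build F A A *:%R trunc_antip trunc_antip_is_linear.
HB.instance Definition _ :=
  GRing.isMonoidMorphism.Build A A trunc_antip trunc_antip_is_monoid_morphism.

Section Dual.

Variables (m : nat) (N : {lrmorphism A -> 'M[F]_m}).

Definition trunc_dual (r : A) : 'M[F]_m := (N (trunc_antip r))^T.

Fact trunc_dual_is_linear : linear trunc_dual.
Proof. by move=> a r s; rewrite /trunc_dual !linearP. Qed.

Fact trunc_dual_is_monoid_morphism : monoid_morphism trunc_dual.
Proof.
split=> [|r s]; rewrite /trunc_dual; first by rewrite !rmorph1 trmx1.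
by rewrite mulrC !rmorphM trmx_mul.
Qed.

HB.instance Definition _ :=
  GRing.isLinear.Build F A 'M[F]_m *:%R trunc_dual trunc_dual_is_linear.
HB.instance Definition _ :=
  GRing.isMonoidMorphism.Build A 'M[F]_m trunc_dual
    trunc_dual_is_monoid_morphism.

End Dual.

End TruncatedPolynomials.

(* A partition s of m with parts of size at most p, in decreasing order,      *)
(* stands for the Jordan type with as many blocks [i] as s has parts i.       *)
Definition jordan_partition (p m : nat) (s : seq nat) : Prop :=
  [/\ sorted geq s, all (fun i => 0 < i <= p)%N s & sumn s = m].

(* multiplication by t on F[t]/t^i, in the basis 1, t, ..., t^(i-1)           *)
Definition jordan_block (F : fieldType) (i : nat) : 'M[F]_i :=
  \matrix_(u < i, v < i) ((u : nat) == v.+1)%:R.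

Definition jordan_mx (F : fieldType) (s : seq nat) :
    'M[F]_(\sum_(i < size s) nth 0%N s i) :=
  \mxdiag_(i < size s) jordan_block F (nth 0%N s i).

(* N is isomorphic to the direct sum of the F[t]/t^i, i running over the parts*)
(* of s: an isomorphism is an F-linear bijection (between F-spaces given in   *)
(* bases of propositionally equal sizes) that commutes with the actions of t. *)
Definition has_jordan_type (F : fieldType) (p m : nat)
    (N : {lrmorphism trunc_poly F p -> 'M[F]_m}) (s : seq nat) : Prop :=
  jordan_partition p m s /\
  exists2 P : 'M[F]_(m, \sum_(i < size s) nth 0%N s i),
    row_free P && row_full P & N 'qX *m P = P *m jordan_mx F s.

(* The dominance order through ranks of powers of nilpotent matrices of the   *)
(* given types; as these ranks do not depend on the field, types of modules   *)
(* over different extensions of F are compared over F.                        *)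
Definition jordan_ge (F : fieldType) (p : nat) (a b : seq nat) : Prop :=
  forall j, (0 < j < p)%N ->
    (\rank (jordan_mx F b ^+ j) <= \rank (jordan_mx F a ^+ j))%N.

Definition jordan_gt (F : fieldType) (p : nat) (a b : seq nat) : Prop :=
  jordan_ge F p a b /\
  exists2 j, (0 < j < p)%N &
    (\rank (jordan_mx F b ^+ j) < \rank (jordan_mx F a ^+ j))%N.

(* Flatness of B as a left R-module through f, for R commutative. By the      *)
(* universal property of X (x)_R B, the tensor \sum_(u <- s) u.1 (x) u.2      *)
(* vanishes iff every balanced biadditive map sends it to 0.                  *)
Section Flatness.

Variables (R : comNzRingType) (B : nzRingType) (f : R -> B).

Definition balanced (X : lmodType R) (Z : zmodType) (b : X -> B -> Z) : Prop :=
  [/\ forall x x' y, b (x + x') y = b x y + b x' y,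
      forall x y y', b x (y + y') = b x y + b x y'
    & forall r x y, b (r *: x) y = b x (f r * y)].

Definition tensor_eq0 (X : lmodType R) (s : seq (X * B)) : Prop :=
  forall (Z : zmodType) (b : X -> B -> Z),
    balanced b -> \sum_(u <- s) b u.1 u.2 = 0.

Definition left_flat : Prop :=
  forall (X Y : lmodType R) (g : {linear X -> Y}), injective g ->
  forall s : seq (X * B),
    tensor_eq0 [seq (g u.1, u.2) | u <- s] -> tensor_eq0 s.

End Flatness.

(* commutativity of the group scheme, i.e. cocommutativity of its coordinate  *)
(* algebra                                                                    *)
Definition abelian_gs (F : fieldType) (C : finGroupScheme F) : Prop :=
  forall l i j, @gs_comul F C l i j = gs_comul l j i.

(* every nonzero representation has a nonzero fixed vector                    *)
Definition unipotent_gs (F : fieldType) (C : finGroupScheme F) : Prop :=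
  forall (m : nat) (N : {lrmorphism grpalg C -> 'M[F]_m}), (0 < m)%N ->
  exists2 v : 'cV[F]_m, v != 0 &
    forall x, N x *m v = grpalg_counit x *: v.

(* A closed embedding of group schemes C -> G, given by its comorphism: the   *)
(* surjective Hopf algebra map F[G] -> F[C], e_i |-> \sum_j phi i j e_j.      *)
Record closed_embedding (F : fieldType) (C G : finGroupScheme F)
    (phi : 'M[F]_(gs_dim G, gs_dim C)) : Prop := ClosedEmbedding {
  _ : row_full phi;
  _ : forall i j l, \sum_a gs_mul i j a * phi a l
        = \sum_u \sum_v phi i u * phi j v * gs_mul u v l;
  _ : forall l, \sum_a gs_one a * phi a l = gs_one l;
  _ : forall i u v, \sum_l phi i l * gs_comul l u v
        = \sum_a \sum_b gs_comul i a b * (phi a u * phi b v);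
  _ : forall i, \sum_l phi i l * gs_counit l = gs_counit i
}.

(* the inclusion FC -> FG of group algebras, transpose of the comorphism phi  *)
Definition grpalg_incl (F : fieldType) (C G : finGroupScheme F)
    (phi : 'M[F]_(gs_dim G, gs_dim C)) (y : grpalg C) : grpalg G :=
  y *m phi^T.

Record pi_point (p : nat) (k : fieldType) (G : finGroupScheme k) := PiPoint {
  pi_field : fieldType;
  pi_ext : {rmorphism k -> pi_field};
  pi_map : {lrmorphism trunc_poly pi_field p -> grpalg (base_change pi_ext G)};
  pi_flat : left_flat pi_map;
  pi_factor :
    exists (C : finGroupScheme pi_field)
           (phi : 'M_(gs_dim (base_change pi_ext G), gs_dim C)),
      [/\ closed_embedding phi, unipotent_gs C, abelian_gs C
        & forall r, exists y : grpalg C, pi_map r = grpalg_incl phi y]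
}.

(* alpha_K^*(N) for a KG-module N *)
Definition pi_restrict (p : nat) (k : fieldType) (G : finGroupScheme k)
    (alpha : pi_point p G) (m : nat)
    (N : {lrmorphism grpalg (base_change (pi_ext alpha) G)
            -> 'M[pi_field alpha]_m}) :
    {lrmorphism trunc_poly (pi_field alpha) p -> 'M[pi_field alpha]_m} :=
  N \o pi_map alpha.

Arguments pi_restrict {p k G} alpha {m} N.

Definition maximal_jordan_type (p : nat) (k : fieldType) (G : finGroupScheme k)
    (m : nat) (M : {lrmorphism grpalg G -> 'M[k]_m}) (alpha : pi_point p G) :
    Prop :=
  forall a, has_jordan_type (pi_restrict alpha (module_ext (pi_ext alpha) M)) a ->
  ~ exists (beta : pi_point p G) (b : seq nat),
      has_jordan_type (pi_restrict beta (module_ext (pi_ext beta) M)) b /\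
      jordan_gt k p b a.

(* Main.v *)
From HB Require Import structures.
Require Import Defs.
From mathcomp Require Import all_boot all_order all_algebra ring mxtens.

Set Implicit Arguments.
Unset Strict Implicit.
Unset Printing Implicit Defensive.

Import GRing.Theory.
Local Open Scope ring_scope.

(** Let t act on M through a pi-point with image u in KG, S being the antipode.
    On the dual of M it acts by the transpose of the action of S u, and in the
    dual of the restricted module by the transpose of that of - u. Nilpotent
    matrices are similar as soon as the ranks of their powers agree
    ([mx_similar_of_ranks]), so the claim is that S u and u have powers of equal
    ranks on M when u has maximal Jordan type.

    The element u lies in the group algebra A of an abelian unipotent group
    scheme, a commutative algebra whose augmentation ideal is nil. As the
    coproduct of u is p-nilpotent, comparing it with u (x) 1 + 1 (x) u gives
      S u = - u + x_1 y_1 + ... + x_r y_r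
    where the x_i are p-nilpotent and the y_i are nilpotent, at the price of
    adjoining p-th roots to K ([antip_induction]). Clearly - u has the same ranks
    as u; it remains to add the products x y one at a time ([pencil_rank]).

    The pencil u + s x over K(s) is again a pi-point, and its ranks are at least
    those of u; if u is maximal they are the same. A matrix over K[s] whose
    generic rank is attained at s = 0 does not lose rank when s is replaced by a
    nilpotent matrix commuting with its coefficients ([rank_nilpotent_subst]).
    Hence u + x y has ranks at least those of u, and the same ranks by maximality.

    Flatness is itself a statement on ranks: t |-> u is flat if and only if u has
    the largest possible ranks on the regular representation ([flat_rank],
    [rank_flat]). The argument above, applied to that representation, shows that
    S composed with any pi-point is a pi-point ([antip_point]). So M and its dual
    have the same Jordan types, and maximality on one is maximality on the other.
*)

(** * Powers of matrices *)

Lemma map_mx_expr (R S : nzRingType) (g : {rmorphism R -> S}) m (A : 'M[R]_m) j :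
  map_mx g (A ^+ j) = map_mx g A ^+ j.
Proof.
elim: j => [|j IHj]; first by rewrite !expr0 [LHS]map_mx1.
by rewrite !exprS [LHS]map_mxM IHj.
Qed.

Lemma rank_map_expr (R S : fieldType) (g : {rmorphism R -> S}) m (A : 'M[R]_m) j :
  \rank (map_mx g A ^+ j) = \rank (A ^+ j).
Proof. by rewrite -map_mx_expr mxrank_map. Qed.

Lemma trmx_expr (R : comPzRingType) n (A : 'M[R]_n) j : (A ^+ j)^T = A^T ^+ j.
Proof.
elim: j => [|j IHj]; first by rewrite !expr0 [LHS]trmx1.
by rewrite exprS exprSr [LHS]trmx_mul IHj.
Qed.

Lemma rank_exprN (F : fieldType) m (A : 'M[F]_m) j :
  \rank ((- A) ^+ j) = \rank (A ^+ j).
Proof.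
have -> : (- A) ^+ j = (-1) ^+ j *: A ^+ j.
  elim: j => [|j IHj]; first by rewrite !expr0 scale1r.
  by rewrite !exprS IHj -![_ * _]/(_ *m _) -scalemxAr mulNmx scalerN mulN1r scaleNr.
by rewrite (eqmx_scale _ (expf_neq0 _ _)) // oppr_eq0 oner_eq0.
Qed.


(** * Substituting a nilpotent matrix into a matrix of polynomials *)
Section KernelCount.

Variables (K : fieldType) (V : vectType K) (J : {vspace V}).
Implicit Types f g : 'End(V).

Fixpoint iter_ker f i : {vspace V} :=
  if i is i'.+1 then (J :&: f @^-1: iter_ker f i')%VS else 0%VS.

Lemma memv_iter_ker f i v : (forall w, w \in J -> f w \in J) ->
  (v \in iter_ker f i) = (v \in J) && (iter i f v == 0).
Proof.
move=> fJ; elim: i v => [|i IHi] v /=.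
  by rewrite memv0; case: eqP => [->|]; rewrite ?mem0v ?andbF.
rewrite memv_cap -memv_preim IHi -iterSr; case vJ: (v \in J) => //=.
by rewrite fJ.
Qed.

(** Every vector killed by an iterate of order less than N is in the image of [f],
    so [f] maps each iterated kernel onto the previous one, and the dimension
    grows by that of the kernel of [f] at each step. *)
Lemma dim_iter_ker f N : (0 < N)%N -> (forall w, w \in J -> f w \in J) ->
    (forall v, v \in J -> iter N f v = 0 ->
       exists2 w, w \in J & v = iter N f w) ->
  \dim (iter_ker f N) = (N * \dim (J :&: lker f)%VS)%N.
Proof.
move=> N0 fJ surj.
have itJ i w : w \in J -> iter i f w \in J by move=> wJ; elim: i => //= i; apply: fJ.
suff H i : (i <= N)%N -> \dim (iter_ker f i) = (i * \dim (J :&: lker f)%VS)%N by exact: H.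
elim: i => [|i IHi] iN; first by rewrite dimv0.
rewrite mulSn -IHi ?(ltnW iN) // -(limg_ker_dim f (iter_ker f i.+1)).
congr addn; congr (dimv _); apply/vspaceP => v.
  rewrite !memv_cap memv_ker -memv_preim -andbA; congr (_ && _).
  by case: eqP => [->|]; rewrite ?mem0v ?andbF.
rewrite memv_iter_ker //; apply/memv_imgP/andP => [[w]|[vJ /eqP fv]].
  by rewrite memv_iter_ker // => /andP[wJ /eqP]; rewrite iterSr => fw ->; rewrite fJ ?fw.
have fNv : iter N f v = 0.
  rewrite -(subnK (ltnW iN)) iterD fv; elim: (N - i)%N => //= j ->.
  exact: linear0.
have [w wJ ev] := surj v vJ fNv.
exists (iter N.-1 f w); last by rewrite ev -{1}(prednK N0).
by rewrite memv_iter_ker // itJ // iterSr -iterS prednK // -ev fv eqxx.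
Qed.

(** Both kernels have dimension one N-th of that of the kernel of the common
    N-th iterate. *)
Lemma dim_ker_eq_iter f g N : (0 < N)%N ->
    (forall w, w \in J -> f w \in J) -> (forall w, w \in J -> g w \in J) ->
    (forall v, v \in J -> iter N f v = iter N g v) ->
    (forall v, v \in J -> iter N f v = 0 ->
       exists2 w, w \in J & v = iter N f w) ->
  \dim (J :&: lker f)%VS = \dim (J :&: lker g)%VS.
Proof.
move=> N0 fJ gJ fg surj; apply/eqP; rewrite -(eqn_pmul2l N0); apply/eqP.
rewrite -!dim_iter_ker // => [|v vJ]; last first.
  by rewrite -fg // => /surj[]// w wJ ->; exists w; rewrite ?fg.
congr (dimv _); apply/vspaceP => v; rewrite !memv_iter_ker //.
by case: (boolP (v \in J)) => // /fg->.
Qed.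

End KernelCount.

Section PolyMatrices.

Variable K : fieldType.
Local Notation FF := {fraction {poly K}}.
Local Notation tofracK := (@tofrac {poly K}).

Local Notation ev0 := (horner_eval (0 : K)).

Lemma map_ev0C m n (A : 'M[K]_(m, n)) : map_mx ev0 (map_mx polyC A) = A.
Proof. by apply/matrixP => i j; rewrite !mxE /horner_eval hornerC. Qed.

(** Constant matrices that reduce F(0) to an identity matrix of size its rank
    reduce F to a square matrix with a determinant that is nonzero at 0. *)
Lemma rank_eval0 m n (F : 'M[{poly K}]_(m, n)) :
  (\rank (map_mx ev0 F) <= \rank (map_mx tofracK F))%N.
Proof.
set A := map_mx ev0 F; set r := \rank A.
pose P : 'M_(r, m) := pid_mx r *m invmx (col_ebase A).
pose Q : 'M_(n, r) := invmx (row_ebase A) *m pid_mx r.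
have PAQ : P *m A *m Q = 1%:M.
  rewrite -[X in P *m X](mulmx_ebase A) -/r /P /Q !mulmxA.
  rewrite -[pid_mx r *m _ *m _]mulmxA mulVmx ?col_ebase_unit // mulmx1.
  rewrite -[_ *m row_ebase A *m _]mulmxA mulmxV ?row_ebase_unit // mulmx1.
  rewrite !mul_pid_mx -[RHS]pid_mx_1 ?minnn.
  by rewrite (minn_idPr (rank_leq_row A)) minnn (minn_idPr (rank_leq_col A)).
pose S := map_mx polyC P *m F *m map_mx polyC Q.
have S0 : map_mx ev0 S = 1%:M by rewrite !map_mxM !map_ev0C.
have dS : \det S != 0.
  apply/eqP => dS0; have /eqP := det1 K r.
  by rewrite -S0 det_map_mx dS0 rmorph0 eq_sym oner_eq0.
have Su : map_mx tofracK S \in unitmx.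
  by rewrite unitmxE unitfE det_map_mx tofrac_eq0.
have <- : \rank (map_mx tofracK S) = r by exact: mxrank_unit.
rewrite !map_mxM (leq_trans (mxrankM_maxl _ _)) //; exact: mxrankM_maxr.
Qed.

(** Constant changes of bases turn F(0) into an idempotent e. Let h be the sum of
    e F e and 1 - e; its determinant is 1 at 0. When the generic rank of F is that
    of e, the Schur complement of e F e in F vanishes and the kernel of F is the
    image of (1 - h^-1 e F) (1 - e), a polynomial matrix up to the factor det h. *)
Lemma lift_kernel m (F : 'M[{poly K}]_m) :
    (\rank (map_mx tofracK F) <= \rank (map_mx ev0 F))%N ->
  exists2 Z : 'M[{poly K}]_m, F *m Z = 0 &
    forall v : 'cV[K]_m, map_mx ev0 F *m v = 0 ->
      exists w, v = map_mx ev0 Z *m w.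
Proof.
set A := map_mx ev0 F; set r := \rank A => rkF.
set L := col_ebase A; set U := row_ebase A.
have defA : L *m pid_mx r *m U = A by exact: mulmx_ebase.
have Lu : L \in unitmx by exact: col_ebase_unit.
have Uu : U \in unitmx by exact: row_ebase_unit.
have rm : (r <= m)%N by exact: rank_leq_row.
pose e0 : 'M[K]_m := pid_mx r; pose e : 'M[{poly K}]_m := map_mx polyC e0.
have e0K : e0 *m e0 = e0 by rewrite /e0 pid_mx_id.
have eK : e *m e = e by rewrite -map_mxM /= e0K.
pose g := map_mx polyC (invmx L) *m F *m map_mx polyC (invmx U).
have defF : F = map_mx polyC L *m g *m map_mx polyC U.
  rewrite /g !mulmxA -map_mxM mulmxV // map_mx1 mul1mx -mulmxA -map_mxM.
  by rewrite mulVmx // map_mx1 mulmx1.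
have g0 : map_mx ev0 g = e0.
  rewrite /g !map_mxM !map_ev0C -/A -defA !mulmxA mulVmx // mul1mx.
  by rewrite -mulmxA mulmxV // mulmx1.
have rkg : (\rank (map_mx tofracK g) <= r)%N.
  rewrite (leq_trans _ rkF) // /g !map_mxM.
  by rewrite (leq_trans (mxrankM_maxl _ _)) // mxrankM_maxr.
have e0e : map_mx ev0 e = e0 by exact: map_ev0C.
have rke : \rank (1%:M - map_mx tofracK e)%R = (m - r)%N.
  have -> : 1%:M - map_mx tofracK e = map_mx (tofracK \o polyC) (copid_mx r : 'M[K]_m).
    by rewrite map_mx_comp /copid_mx !map_mxB !map_mx1.
  by rewrite mxrank_map rank_copid_mx.
clearbody g e.
pose h := e *m g *m e + (1%:M - e).
have h0 : map_mx ev0 h = 1%:M.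
  by rewrite /h map_mxD map_mxB !map_mxM e0e g0 !e0K map_mx1 addrC subrK.
pose d := \det h.
have d0 : ev0 d = 1 by rewrite /d -det_map_mx h0 det1.
have dn0 : d != 0 by apply/eqP => d0'; move/eqP: d0; rewrite d0' rmorph0 eq_sym oner_eq0.
have eh : e *m h = e *m g *m e.
  by rewrite mulmxDr mulmxBr mulmx1 eK subrr addr0 !mulmxA eK.
have he : h *m e = e *m g *m e.
  by rewrite mulmxDl mulmxBl mul1mx eK subrr addr0 -!mulmxA eK.
have ah : \adj h *m e = e *m \adj h.
  apply/eqP; rewrite -subr_eq0; apply/eqP.
  have: d *: (\adj h *m e) = d *: (e *m \adj h).
    have -> : d *: (\adj h *m e) = \adj h *m (e *m h) *m \adj h.
      by rewrite -!mulmxA mul_mx_adj mul_mx_scalar scalemxAr.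
    by rewrite eh -he !mulmxA mul_adj_mx mul_scalar_mx scalemxAl.
  move/eqP; rewrite -subr_eq0 -scalerBr => /eqP dZ.
  apply/matrixP => i j; move/matrixP/(_ i j): dZ; rewrite !mxE => /eqP.
  by rewrite mulf_eq0 (negPf dn0) => /eqP.
pose Z0 := (d%:M - \adj h *m e *m g) *m (1%:M - e).
have egZ0 : e *m g *m Z0 = 0.
  have ega : e *m g *m (\adj h *m e) = d *: e.
    rewrite ah mulmxA.
    by rewrite -eh -mulmxA mul_mx_adj mul_mx_scalar.
  rewrite /Z0 mulmxA [_ *m (d%:M - _)]mulmxBr mul_mx_scalar [e *m g *m (_ *m g)]mulmxA ega.
  by rewrite -scalemxAl subrr mul0mx.
have gZ0 : g *m Z0 = 0.
  have: map_mx tofracK (g *m Z0) = 0.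
    have: (map_mx tofracK g <= map_mx tofracK (e *m g))%MS.
      rewrite map_mxM; have := mxrank_leqif_sup (submxMl (map_mx tofracK e) (map_mx tofracK g)).
      case=> _ <-; rewrite eqn_leq mxrankM_maxr (leq_trans rkg) // -map_mxM.
      have hr : \rank (map_mx tofracK h) = m.
        by apply: mxrank_unit; rewrite unitmxE unitfE det_map_mx tofrac_eq0.
      have := mxrank_add (map_mx tofracK (e *m g *m e)) (map_mx tofracK (1%:M - e)).
      rewrite -map_mxD -/h hr map_mxB map_mx1 rke => hm.
      rewrite -(leq_add2r (m - r)) subnKC // (leq_trans hm) // leq_add2r.
      by have := mxrankM_maxl (map_mx tofracK (e *m g)) (map_mx tofracK e); rewrite !map_mxM.
    case/submxP => X gX; rewrite map_mxM gX -mulmxA -map_mxM egZ0.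
    by rewrite map_mx0 mulmx0.
  move=> /matrixP gZ; apply/matrixP => i j; have := gZ i j.
  by rewrite !mxE => /eqP; rewrite tofrac_eq0 => /eqP.
exists (map_mx polyC (invmx U) *m Z0).
  rewrite defF -!mulmxA [map_mx _ U *m _]mulmxA -map_mxM mulmxV // map_mx1.
  by rewrite mul1mx gZ0 mulmx0.
move=> v Av; exists (U *m v).
have eUv : e0 *m (U *m v) = 0.
  have : invmx L *m (A *m v) = 0 by rewrite Av mulmx0.
  by rewrite -{1}defA -!mulmxA mulKmx.
rewrite map_mxM map_ev0C /Z0 map_mxM !map_mxB !map_mxM e0e g0 map_mx1.
have dM : map_mx ev0 (d%:M : 'M_m) = 1%:M by rewrite map_scalar_mx /= d0.
rewrite dM -mulmxA -[_ *m (U *m v)]mulmxA.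
rewrite [(1%:M - e0) *m _]mulmxBl eUv subr0 mul1mx mulmxBl mul1mx.
by rewrite -!mulmxA eUv !mulmx0 subr0 mulKmx.
Qed.

End PolyMatrices.

Lemma exprB_comm_pchar (R : nzRingType) p e (a b : R) :
    p \in [pchar R] -> GRing.comm a b ->
  (a - b) ^+ (p ^ e) = a ^+ (p ^ e) - b ^+ (p ^ e).
Proof.
move=> pR; elim: e a b => [|e IHe] a b ab; first by rewrite !expr1.
rewrite expnS !exprM -!(pFrobenius_autE pR) pFrobenius_autB_comm //.
by apply: IHe; rewrite !pFrobenius_autE; apply/commrX/commr_sym/commrX/commr_sym.
Qed.

Section PolyAction.

Variables (K : fieldType) (m n : nat) (T : 'M[K]_n.+1).
Implicit Types (F G : 'M[{poly K}]_m) (X : 'M[K]_(m, n.+1)).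

(** An action of matrices of polynomials: coefficients multiply on the left, and
    the indeterminate acts by right multiplication by [T]. *)
Definition pact F X : 'M[K]_(m, n.+1) :=
  \matrix_a \sum_b (row b X *m horner_mx T (F a b)).

Lemma row_pact F X a : row a (pact F X) = \sum_b (row b X *m horner_mx T (F a b)).
Proof. exact: rowK. Qed.

Lemma pact_mul F G X : pact (F *m G) X = pact F (pact G X).
Proof.
apply/row_matrixP => a; rewrite !row_pact.
under [RHS]eq_bigr do rewrite row_pact mulmx_suml.
rewrite exchange_big; apply: eq_bigr => c _.
under [RHS]eq_bigr do rewrite -mulmxA.
rewrite -mulmx_sumr mxE rmorph_sum; congr (_ *m _); apply: eq_bigr => b _.
by rewrite mulrC rmorphM.
Qed.

Lemma pactD F G X : pact (F + G) X = pact F X + pact G X.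
Proof.
apply/row_matrixP => a; rewrite linearD /= !row_pact -big_split.
by apply: eq_bigr => b _; rewrite mxE rmorphD mulmxDr.
Qed.

Lemma pactN F X : pact (- F) X = - pact F X.
Proof.
apply/row_matrixP => a; rewrite linearN /= !row_pact -sumrN.
by apply: eq_bigr => b _; rewrite mxE rmorphN mulmxN.
Qed.

Lemma pact_polyC (A : 'M[K]_m) X : pact (map_mx polyC A) X = A *m X.
Proof.
apply/row_matrixP => a; rewrite row_pact row_mul mulmx_sum_row.
by apply: eq_bigr => b _; rewrite !mxE horner_mx_C mul_mx_scalar.
Qed.

Lemma pact_scalar q X : pact q%:M X = X *m horner_mx T q.
Proof.
apply/row_matrixP => a; rewrite row_pact row_mul (bigD1 a) //= big1 => [|b ba].
  by rewrite addr0 mxE eqxx.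
by rewrite mxE eq_sym (negPf ba) mulr0n rmorph0 mulmx0.
Qed.

Lemma pact0 X : pact 0 X = 0.
Proof.
apply/row_matrixP => a; rewrite row_pact row0 big1 // => b _.
by rewrite mxE rmorph0 mulmx0.
Qed.

Lemma pact_exp F X i : pact (F ^+ i) X = iter i (pact F) X.
Proof.
elim: i X => [|i IHi] X; first by rewrite expr0 pact_scalar rmorph1 mulmx1.
by rewrite exprS -[_ * _]/(_ *m _) pact_mul IHi.
Qed.

Lemma pact_is_linear F : linear (pact F).
Proof.
move=> c X Y; apply/row_matrixP => a; rewrite linearP /= !row_pact.
rewrite scaler_sumr -big_split; apply: eq_bigr => b _.
by rewrite linearP /= mulmxDl scalemxAl.
Qed.

HB.instance Definition _ F :=
  GRing.isLinear.Build K 'M[K]_(m, n.+1) 'M[K]_(m, n.+1) *:%R (pact F)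
    (pact_is_linear F).

End PolyAction.

Lemma kernel_basis (K : fieldType) r m (A : 'M[K]_(r, m)) :
  exists B : 'M[K]_(m, m - \rank A),
  [/\ A *m B = 0, forall q (W : 'M[K]_(_, q)), B *m W = 0 -> W = 0 &
      forall q (V : 'M[K]_(m, q)), A *m V = 0 -> exists W, V = B *m W].
Proof.
have rk : \rank (kermx A^T) = (m - \rank A)%N by rewrite mxrank_ker mxrank_tr.
rewrite -rk; exists (row_base (kermx A^T))^T; split=> [|q W|q V AV].
- apply: trmx_inj; rewrite trmx_mul trmxK trmx0; apply/sub_kermxP.
  by rewrite eq_row_base.
- move/(congr1 trmx); rewrite trmx_mul trmxK trmx0 => /eqP.
  rewrite mulmx_free_eq0 ?row_base_free // => /eqP/(congr1 trmx).
  by rewrite trmxK trmx0.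
have: (V^T <= row_base (kermx A^T))%MS.
  by rewrite eq_row_base; apply/sub_kermxP; rewrite -trmx_mul AV trmx0.
by case/submxP=> W VW; exists W^T; rewrite -trmx_mul -VW trmxK.
Qed.

Section NilpotentSubstitution.

Variable K : fieldType.
Local Notation tofracK := (@tofrac {poly K}).
Local Notation ev0 := (horner_eval (0 : K)).
Local Notation PC := (map_mx polyC).

Section Shift.

Variables (m n : nat).
Implicit Types X : 'M[K]_(m, n.+1).
Local Notation T := (jordan_block K n.+1).

Lemma mul_shiftX X l a i :
  (X *m T ^+ l) a i = if (i + l < n.+1)%N then X a (inord (i + l)) else 0.
Proof.
elim: l i => [|l IHl] i.
  by rewrite mulmx1 addn0 ltn_ord; congr (X _ _); apply: val_inj; rewrite /= inordK.
rewrite exprSr [_ * _]/(_ *m _) mulmxA mxE.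
case: ltnP => il.
  have i1 : (i.+1 < n.+1)%N by rewrite (leq_ltn_trans _ il) // addnS ltnS leq_addr.
  rewrite (bigD1 (Ordinal i1)) //= big1 => [|b nb]; last first.
    by rewrite [T _ _]mxE; case: eqP => [e|]; rewrite ?mulr0 //; case/eqP: nb; apply: val_inj.
  by rewrite addr0 [T _ _]mxE /= eqxx mulr1 IHl /= addSnnS il.
apply: big1 => b _; rewrite [T _ _]mxE IHl; case: eqP => [->|]; rewrite ?mulr0 //.
by rewrite addSnnS ltnNge il mul0r.
Qed.

Lemma pact_shift0 (F : 'M[{poly K}]_m) X : X *m T = 0 ->
  pact T F X = map_mx ev0 F *m X.
Proof.
move=> XT; apply/row_matrixP => a; rewrite row_pact row_mul mulmx_sum_row.
apply: eq_bigr => b _; rewrite !mxE /horner_eval.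
elim/poly_ind: (F a b) => [|q c _]; first by rewrite rmorph0 mulmx0 horner0 scale0r.
rewrite !rmorphD !rmorphM /= horner_mx_X horner_mx_C mulmxDr mul_mx_scalar.
rewrite hornerMXaddC mulr0 add0r (_ : _ *m (_ * _) = 0) ?add0r //.
have -> : horner_mx T q * T = T *m horner_mx T q.
  by symmetry; apply: comm_mx_horner.
by rewrite mulmxA -row_mul XT row0 mul0mx.
Qed.

End Shift.

Section Kernels.

Variables (m N : nat) (F : 'M[{poly K}]_m).
Hypothesis N0 : (0 < N)%N.
Hypothesis rkF : (\rank (map_mx tofracK F) <= \rank (map_mx ev0 F))%N.

Local Notation n := (N + N).-1.
Local Notation V := 'M[K]_(m, n.+1).
Local Notation T := (jordan_block K n.+1).

(** The columns of a matrix are the coefficients of a polynomial in 1/s that the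
    shift, multiplication by s, truncates. By induction on the degree, using
    [lift_kernel] on the leading coefficient, the elements killed by [F] are the
    images of arbitrary ones under a fixed matrix Z; and it is clear that an
    arbitrary polynomial of degree less than N in 1/s is divisible by s^N. *)
Lemma lift_shift X : pact T F X = 0 -> X *m T ^+ N = 0 ->
  exists2 Y, pact T F Y = 0 & X = Y *m T ^+ N.
Proof.
have defn : n.+1 = (N + N)%N by rewrite prednK // addn_gt0 N0.
have [Z FZ liftZ] := lift_kernel rkF.
have FZX A : pact T F (pact T Z A) = 0.
  by rewrite -pact_mul FZ pact0.
have shiftE B l : B *m T ^+ l = pact T ('X^l)%:M B.
  by rewrite pact_scalar rmorphXn /= horner_mx_X.
have shiftZ A l : pact T Z A *m T ^+ l = pact T Z (A *m T ^+ l).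
  by rewrite !shiftE -!pact_mul scalar_mxC.
have shiftF A l : pact T F A = 0 -> pact T F (A *m T ^+ l) = 0.
  by move=> FA; rewrite !shiftE -!pact_mul scalar_mxC pact_mul FA linear0.
have lift l Y : (l <= n)%N -> pact T F Y = 0 -> Y *m T ^+ l = 0 ->
    exists2 A, A *m T ^+ l = 0 & Y = pact T Z A.
  elim: l Y => [|l IHl] Y ln FY YT.
    by exists 0; rewrite ?mul0mx // linear0 -YT mulmx1.
  set B := Y *m T ^+ l.
  have BT : B *m T = 0 by rewrite -mulmxA -[_ *m T]/(_ * T) -exprSr.
  have: map_mx ev0 F *m B = 0 by rewrite -pact_shift0 // shiftF.
  move=> FB; have [|w defw] := liftZ (col 0 B); first by rewrite colE mulmxA FB mul0mx.
  (* [Z A] has the same leading coefficient as [Y]. *)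
  pose A : V := \matrix_(a, i) (w a 0 *+ (i == l :> nat)).
  have AT : A *m T ^+ l *m T = 0.
    rewrite -mulmxA -[_ *m T]/(_ * T) -exprSr; apply/matrixP => a i.
    rewrite mul_shiftX [RHS]mxE; case: ltnP => // il; rewrite mxE inordK //.
    by rewrite eqn_leq leqNgt ltn_addl.
  have ZA : pact T Z A *m T ^+ l = B.
    rewrite shiftZ pact_shift0 //; apply/matrixP => a i; rewrite mxE.
    have -> : B a i = (col 0 B) a 0 *+ (i == 0).
      rewrite [col _ _ _ _]mxE; case: (altP eqP) => [->|i0]; first by rewrite mulr1n.
      have := congr1 (fun C : V => C a (inord i.-1)) BT; rewrite /=  -{1}[T]expr1 mul_shiftX.
      have i1 : (i.-1 < n.+1)%N by rewrite (leq_ltn_trans (leq_pred _)).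
      have ip : (0 < i)%N by rewrite lt0n; apply: contra i0 => /eqP ei; apply/eqP/val_inj.
      rewrite inordK // addn1 prednK // ltn_ord [RHS]mxE => Bi.
      rewrite mulr0n -[RHS]Bi; congr (B _ _).
      by apply: val_inj; rewrite /= inordK // ltn_ord.
    rewrite defw mxE -sumrMnl; apply: eq_bigr => b _.
    rewrite mul_shiftX; case: ltnP => il.
      rewrite [A _ _]mxE inordK // -{2}[l]add0n eqn_add2r.
      have -> : (i == 0) = (i == 0 :> nat)%N by [].
      by case: (_ == _)%N; rewrite ?mulr0n ?mulr1n ?mulr0.
    rewrite mulr0; case: eqP => [i0|]; rewrite ?mulr0n //.
    by move: il; rewrite i0 /= leqNgt ltnS ltnW.
  have [||A' A'T defA'] := IHl (Y - pact T Z A) (ltnW ln).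
  - by rewrite linearB /= FY FZX subrr.
  - by rewrite mulmxBl ZA subrr.
  exists (A' + A); last by rewrite linearD /= -defA' subrK.
  by rewrite exprSr -[_ * _]/(_ *m _) mulmxA mulmxDl mulmxDl A'T AT mul0mx addr0.
move=> FX XT; have [|//|//|A AT defX] := lift N X.
  by rewrite -ltnS defn -addn1 leq_add2l.
pose A2 : V := \matrix_(a, i) (if (i < N)%N then 0 else A a (inord (i - N))).
exists (pact T Z A2); rewrite ?FZX // defX shiftZ; congr pact.
have ltn2 q : (q + N < n.+1)%N = (q < N)%N by rewrite defn ltn_add2r.
apply/matrixP => a i; rewrite mul_shiftX ltn2.
case: ltnP => iN.
  rewrite [A2 _ _]mxE inordK ?ltn2 //.
  rewrite ltnNge leq_addl /= addnK.
  by congr (A _ _); apply: val_inj; rewrite /= inordK.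
have := congr1 (fun C : V => C a (inord (i - N))) AT; rewrite /= mul_shiftX.
have iN1 : (i - N < n.+1)%N by rewrite (leq_ltn_trans (leq_subr _ _)).
rewrite inordK // subnK // ltn_ord [RHS]mxE => Ai.
rewrite -[RHS]Ai; congr (A _ _).
by apply: val_inj; rewrite /= inordK.
Qed.

End Kernels.

(** Let J be the space of polynomials in 1/s killed by F = (u + s x)^j. As y is
    nilpotent, the operators s and s - y on J have the same N-th power for N a
    high power of p; it is surjective by [lift_shift], so by [dim_ker_eq_iter] the
    kernels of s and s - y have the same dimension. The former is the kernel of
    F(0) = u^j and the latter that of F(y) = (u + x y)^j, where v stands for the
    polynomial with coefficients v, y v, y^2 v, ... *)
Lemma rank_nilpotent_subst p m (u x y : 'M[K]_m) j e :
    p \in [pchar K] -> u *m y = y *m u -> x *m y = y *m x -> y ^+ e = 0 ->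
    (\rank (map_mx tofracK ((PC u + 'X *: PC x) ^+ j)) <= \rank (u ^+ j))%N ->
  (\rank (u ^+ j) <= \rank ((u + x *m y) ^+ j))%N.
Proof.
case: m u x y => [|m] u x y pK uy xy ye rkF.
  by rewrite [u ^+ j]flatmx0 [(_ + _) ^+ j]flatmx0.
have p_pr : prime p by case/andP: pK.
pose N := (p ^ e)%N.
have N0 : (0 < N)%N by rewrite expn_gt0 prime_gt0.
have yN : y ^+ N = 0.
  by rewrite /N -(subnK (ltnW (ltn_expl e (prime_gt1 p_pr)))) exprD ye mulr0.
set F := (PC u + 'X *: PC x) ^+ j in rkF.
have F0 : map_mx ev0 F = u ^+ j.
  rewrite /F rmorphXn /= map_mxD map_mxZ !map_ev0C.
  by rewrite /= /horner_eval hornerX scale0r addr0.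
rewrite -F0 in rkF *.
(* Degrees up to 2 N - 1 leave room to divide those below N by s^N. *)
pose n := (N + N).-1; pose T := jordan_block K n.+1.
pose V := 'M[K]_(m.+1, n.+1).
pose J : {vspace V} := lker (linfun (pact T F)).
have JE X : (X \in J) = (pact T F X == 0) by rewrite memv_ker lfunE.
pose f : 'End(V) := linfun (pact T 'X%:M).
pose g : 'End(V) := linfun (pact T ('X%:M - PC y)).
have stab (G : 'M[{poly K}]_m.+1) : F *m G = G *m F ->
    forall X, X \in J -> linfun (pact T G) X \in J.
  move=> FG X; rewrite !JE lfunE /= -pact_mul FG pact_mul => /eqP->.
  by rewrite linear0.
have Fx : F *m 'X%:M = 'X%:M *m F by rewrite scalar_mxC.
have Fy : F *m PC y = PC y *m F.
  apply/commr_sym/commrX; rewrite /GRing.comm -![_ * _]/(_ *m _).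
  by rewrite mulmxDr mulmxDl -scalemxAl -scalemxAr -!map_mxM uy xy.
have iterE (G : 'M[{poly K}]_m.+1) i X :
    iter i (linfun (pact T G) : 'End(V)) X = pact T (G ^+ i) X.
  by rewrite pact_exp; elim: i => //= i ->; rewrite lfunE.
have fN X : iter N f X = X *m T ^+ N.
  by rewrite iterE -rmorphXn pact_scalar rmorphXn /= horner_mx_X.
have gN : ('X%:M - PC y) ^+ N = ('X%:M : 'M[{poly K}]_m.+1) ^+ N.
  have pM : p \in [pchar 'M[{poly K}]_m.+1].
    apply: (rmorph_pchar (@scalar_mx {poly K} m.+1)).
    exact: (rmorph_pchar (@polyC K)).
  rewrite exprB_comm_pchar //; last by rewrite /GRing.comm -![_ * _]/(_ *m _) scalar_mxC.
  have -> : PC y ^+ (p ^ e) = 0 by rewrite -rmorphXn /= -/N yN map_mx0.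
  by rewrite subr0.
have eq_ker : \dim (J :&: lker f)%VS = \dim (J :&: lker g)%VS.
  apply: (@dim_ker_eq_iter _ _ _ _ _ N) => //.
  - exact: stab.
  - by apply: stab; rewrite mulmxBr Fx Fy mulmxBl.
  - by move=> X _; rewrite !iterE gN.
  move=> X; rewrite JE fN => /eqP FX XT.
  have [Y FY defX] := lift_shift N0 rkF FX XT.
  by exists Y; rewrite ?JE ?FY // fN.
have dimcV k : \dim {: 'cV[K]_k} = k by rewrite dimvf /dim /= muln1.
have [B [F0B _ Bker]] := kernel_basis (map_mx ev0 F).
have [B' [FyB' B'inj _]] := kernel_basis ((u + x *m y) ^+ j).
have le1 : (\dim (J :&: lker f)%VS <= m.+1 - \rank (map_mx ev0 F))%N.
  pose phi : 'Hom('cV[K]_(m.+1 - \rank (map_mx ev0 F)), V) :=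
    (linfun (mulmxr (delta_mx 0 0)) \o linfun (mulmx B))%VF.
  have := limg_ker_dim phi fullv; rewrite dimcV => <-.
  rewrite (leq_trans _ (leq_addl _ _)) // dimvS //.
  apply/subvP => X; rewrite memv_cap JE memv_ker lfunE /= pact_scalar horner_mx_X.
  case/andP=> /eqP FX /eqP XT; rewrite pact_shift0 // in FX.
  have [w defw] : exists w, col 0 X = B *m w.
    by apply: Bker; rewrite colE mulmxA FX mul0mx.
  apply/memv_imgP; exists w; rewrite ?memvf // comp_lfunE !lfunE /= -defw.
  apply/matrixP => a i; rewrite mxE big_ord1 !mxE eqxx /=.
  case: (altP eqP) => [->|i0]; rewrite ?mulr1 ?mulr0 //.
  have := congr1 (fun C : V => C a (inord i.-1)) XT; rewrite /= -[T]expr1 mul_shiftX.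
  have i1 : (i.-1 < n.+1)%N by rewrite (leq_ltn_trans (leq_pred _)).
  have ip : (0 < i)%N by rewrite lt0n.
  rewrite inordK // addn1 prednK // ltn_ord [RHS]mxE => <-.
  by congr (X _ _); apply: val_inj; rewrite /= inordK // ltn_ord.
have le2 : (m.+1 - \rank ((u + x *m y) ^+ j) <= \dim (J :&: lker g)%VS)%N.
  pose k := (m.+1 - \rank ((u + x *m y) ^+ j))%N.
  pose psi : 'Hom('cV[K]_k, V) := (\sum_(i < n.+1)
    (linfun (mulmxr (delta_mx 0 i)) \o linfun (mulmx (y ^+ i *m B'))))%VF.
  have psiE w a i : psi w a i = (y ^+ i *m (B' *m w)) a 0.
    rewrite sum_lfunE summxE (bigD1 i) //= big1 => [|l li]; rewrite comp_lfunE !lfunE /=.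
      by rewrite addr0 mulmxA mxE big_ord1 [delta_mx _ _ _ _]mxE !eqxx mulr1.
    by rewrite mxE big_ord1 [delta_mx _ _ _ _]mxE (eq_sym i) (negPf li) andbF mulr0.
  have psi0 : lker psi == 0%VS.
    rewrite -subv0; apply/subvP => w; rewrite memv_ker memv0 => /eqP pw.
    apply/eqP; apply: B'inj; apply/matrixP => a i; rewrite ord1.
    by have := psiE w a 0; rewrite pw mul1mx => <-; rewrite !mxE.
  rewrite -/k; have <- : \dim (limg psi) = k.
    by rewrite limg_dim_eq ?(eqP psi0) ?capv0 // dimcV.
  apply/dimvS/subvP => X /memv_imgP[w _ ->]; rewrite memv_cap JE memv_ker lfunE /=.
  have mul_psi (A : 'M[K]_m.+1) a i :
      (A *m psi w) a i = (A *m y ^+ i *m (B' *m w)) a 0.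
    by rewrite -mulmxA !mxE; apply: eq_bigr => b _; rewrite psiE.
  have psiT : psi w *m T = y *m psi w.
    apply/matrixP => a i; rewrite -[T]expr1 mul_shiftX addn1 mul_psi.
    rewrite -[y *m _]/(y * _) -exprS; case: ltnP => [i1|ni].
      by rewrite psiE inordK.
    have -> : i.+1 = (N + N)%N.
      have defn : n.+1 = (N + N)%N by rewrite prednK // addn_gt0 N0.
      by rewrite -defn; apply/eqP; rewrite eqn_leq ltn_ord.
    by rewrite exprD yN mul0r mul0mx mxE.
  set v := u + x *m y.
  have vy : v * y = y * v.
    rewrite mulrDl mulrDr; congr (_ + _); first exact: uy.
    by rewrite -![_ * _]/(_ *m _) mulmxA -xy.
  have iterF i : iter i (pact T (PC u + 'X *: PC x)) (psi w) = v ^+ i *m psi w.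
    elim: i => [|i]; first by rewrite mul1mx.
    rewrite iterS => ->; rewrite -mul_scalar_mx -scalar_mxC pactD pact_mul !pact_polyC.
    rewrite pact_scalar horner_mx_X -[_ *m psi w *m T]mulmxA psiT.
    rewrite [v ^+ i *m (y *m _)]mulmxA -[v ^+ i *m y]/(v ^+ i * y).
    have -> : v ^+ i * y = y * v ^+ i by apply/commr_sym/commrX/commr_sym.
    by rewrite exprS -[_ * _]/(_ *m _) -[v *m _ *m _]mulmxA mulmxDl -!mulmxA.
  rewrite pact_exp iterF pactD pactN pact_scalar horner_mx_X pact_polyC psiT.
  rewrite subrr eqxx andbT; apply/eqP/matrixP => a i; rewrite mul_psi.
  have -> : v ^+ j *m y ^+ i = y ^+ i *m v ^+ j.
    by apply/commrX/commr_sym/commrX/commr_sym.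
  by rewrite -mulmxA [v ^+ j *m _]mulmxA FyB' mul0mx mulmx0 !mxE.
have := leq_trans le2 _; rewrite -eq_ker => /(_ _ le1).
by rewrite leq_sub2lE // rank_leq_row.
Qed.

End NilpotentSubstitution.

(** * Jordan form of nilpotent matrices *)
Section Similarity.

Variable K : fieldType.

(** Similarity of square matrices whose sizes are only propositionally equal. *)
Definition mx_similar m n (A : 'M[K]_m) (B : 'M[K]_n) : Prop :=
  exists2 P : 'M[K]_(m, n), row_free P && row_full P & A *m P = P *m B.

Lemma mx_similar_refl m (A : 'M[K]_m) : mx_similar A A.
Proof. by exists 1%:M; rewrite ?mulmx1 ?mul1mx // /row_free /row_full mxrank1 eqxx. Qed.

Lemma mx_similar_sym m n (A : 'M[K]_m) (B : 'M[K]_n) :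
  mx_similar A B -> mx_similar B A.
Proof.
case=> P /andP[fP uP] AP; exists (pinvmx P).
  by rewrite pinvmx_free // pinvmx_full.
by rewrite -[B *m _]mul1mx -(mulVpmx uP) -!mulmxA [P *m _]mulmxA -AP mulmxKp ?mulmxA.
Qed.

Lemma mx_similar_trans m n q (A : 'M[K]_m) (B : 'M[K]_n) (C : 'M[K]_q) :
  mx_similar A B -> mx_similar B C -> mx_similar A C.
Proof.
case=> P /andP[fP uP] AP [Q /andP[fQ uQ] BQ]; exists (P *m Q).
  apply/andP; split; first by rewrite /row_free mxrankMfree.
  by rewrite /row_full mxrankMfree // (eqP uP) -(eqP fQ).
by rewrite mulmxA AP -mulmxA BQ mulmxA.
Qed.

Lemma mx_similar_size m n (A : 'M[K]_m) (B : 'M[K]_n) : mx_similar A B -> m = n.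
Proof. by case=> P /andP[/eqP rm /eqP rn] _; rewrite -rm rn. Qed.

Lemma mx_similar_cast m n (e : m = n) (A : 'M[K]_m) :
  mx_similar A (castmx (e, e) A).
Proof. by case: n / e; rewrite castmx_id; apply: mx_similar_refl. Qed.

Lemma mx_similar_rank m n (A : 'M[K]_m) (B : 'M[K]_n) j :
  mx_similar A B -> \rank (A ^+ j) = \rank (B ^+ j).
Proof.
case=> P /andP[fP uP] AP.
have APj : A ^+ j *m P = P *m B ^+ j.
  elim: j => [|j IHj]; first by rewrite mul1mx mulmx1.
  by rewrite !exprS -![_ * _]/(_ *m _) -mulmxA IHj !mulmxA AP.
rewrite -(mxrankMfree _ fP) APj -(mxrank_tr (_ *m _)) trmx_mul mxrankMfree ?mxrank_tr //.
by rewrite /row_free mxrank_tr.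
Qed.

Lemma mx_similar_block0 d m n (J : 'M[K]_d) (A : 'M[K]_m) (B : 'M[K]_n) :
  mx_similar A B -> mx_similar (block_mx J 0 0 A) (block_mx J 0 0 B).
Proof.
case=> P /andP[fP uP] AP; exists (block_mx 1%:M 0 0 P).
  apply/andP; split.
    apply/row_freeP; exists (block_mx 1%:M 0 0 (pinvmx P)).
    by rewrite mulmx_block !(mulmx0, mul0mx, addr0, add0r, mulmx1) mulmxVp // -scalar_mx_block.
  apply/row_fullP; exists (block_mx 1%:M 0 0 (pinvmx P)).
  by rewrite mulmx_block !(mulmx0, mul0mx, addr0, add0r, mulmx1) mulVpmx // -scalar_mx_block.
by rewrite !mulmx_block !(mulmx0, mul0mx, addr0, add0r, mulmx1, mul1mx) AP.
Qed.

Lemma expr_block0 d m (J : 'M[K]_d) (A : 'M[K]_m) j :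
  block_mx J 0 0 A ^+ j = block_mx (J ^+ j) 0 0 (A ^+ j).
Proof.
elim: j => [|j IHj]; first by rewrite !expr0 -scalar_mx_block.
rewrite !exprS IHj -[LHS]/(_ *m _) mulmx_block.
by rewrite !(mulmx0, mul0mx, addr0, add0r).
Qed.

Lemma rank_block0 d m (J : 'M[K]_d) (A : 'M[K]_m) :
  \rank (block_mx J 0 0 A) = (\rank J + \rank A)%N.
Proof. exact: rank_diag_block_mx. Qed.

(** A vector v with A^d v <> 0 generates a block of size d + 1. If a linear form
    phi does not vanish at A^d v then the common kernel of the forms phi A^i is an
    A-stable complement of this block. *)
Lemma split_nilpotent m (A : 'M[K]_m) d : A ^+ d.+1 = 0 -> A ^+ d != 0 ->
  exists m' (A' : 'M[K]_m'),
    mx_similar A (block_mx (jordan_block K d.+1) 0 0 A').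
Proof.
move=> Ad1 Ad.
have [[a b] /= Aab] : exists ab : 'I_m * 'I_m, (A ^+ d) ab.1 ab.2 != 0.
  apply/existsP; apply: contraR Ad => /existsPn A0; apply/eqP/matrixP => a b.
  by rewrite [RHS]mxE; apply/eqP; have := A0 (a, b); rewrite negbK.
pose v : 'cV[K]_m := delta_mx b 0; pose phi : 'rV[K]_m := delta_mx 0 a.
have phi_v (B : 'M[K]_m) : (phi *m B *m v) 0 0 = B a b.
  by rewrite -rowE -colE !mxE.
pose C : 'M[K]_(m, d.+1) := \matrix_(i, j) (A ^+ j *m v) i 0.
pose R : 'M[K]_(d.+1, m) := \matrix_(i, j) (phi *m A ^+ (d - i)) 0 j.
have AC : A *m C = C *m jordan_block K d.+1.
  apply/matrixP => i j; rewrite -[jordan_block _ _]expr1 mul_shiftX addn1.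
  have -> : (A *m C) i j = (A ^+ j.+1 *m v) i 0.
    by rewrite exprS -[A * _]/(A *m _) -mulmxA !mxE; apply: eq_bigr => l _; rewrite mxE.
  case: ltnP => [j1|]; first by rewrite [RHS]mxE inordK.
  have := ltn_ord j; rewrite ltnS => jd; rewrite ltnS => dj.
  by have -> : (j : nat) = d by [apply/eqP; rewrite eqn_leq jd]; rewrite Ad1 mul0mx mxE.
have RA : R *m A = (\matrix_(i, j) ((i : nat) == j.+1)%:R : 'M_d.+1) *m R.
  apply/matrixP => i j.
  have -> : (R *m A) i j = (phi *m A ^+ (d - i).+1) 0 j.
    by rewrite exprSr -[_ * A]/(_ *m A) mulmxA !mxE; apply: eq_bigr => l _; rewrite mxE.
  rewrite [RHS]mxE; case: (posnP i) => [i0|ip].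
    rewrite i0 subn0 Ad1 mulmx0 mxE big1 // => l _.
    by rewrite mxE i0 mul0r.
  have i1 : (i.-1 < d.+1)%N by rewrite prednK // ltnW.
  rewrite (bigD1 (Ordinal i1)) //= big1 => [|l li]; last first.
    rewrite mxE; case: eqP => [e|]; rewrite ?mul0r //.
    by case/eqP: li; apply: val_inj; rewrite /= e.
  have ed : (d - i.-1 = (d - i).+1)%N.
    have id : (i <= d)%N by rewrite -ltnS.
    by rewrite -(subSn id) -[in RHS](prednK ip) subSS.
  by rewrite addr0 mxE [R _ _]mxE /= prednK // eqxx mul1r ed.
have RC : R *m C \in unitmx.
  have RCE i j : (R *m C) i j = (A ^+ (d - i + j)) a b.
    rewrite -phi_v exprD -[_ * _]/(_ *m _) mulmxA -mulmxA mxE [RHS]mxE.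
    by apply: eq_bigr => l _; rewrite !mxE.
  rewrite unitmxE det_trig; last first.
    apply/is_trig_mxP => i j ij; rewrite RCE.
    have -> : (d - i + j = d.+1 + (j - i.+1))%N.
      have id := ltn_ord i; have jd := ltn_ord j.
      by rewrite -(subnKC ij) addKn addnA; congr addn; rewrite addnS subnK.
    by rewrite exprD Ad1 mul0r mxE.
  rewrite unitfE; apply/prodf_neq0 => i _.
  by rewrite RCE subnK // -ltnS.
have [B [RB Binj Blift]] := kernel_basis R.
have [|A' AB] := Blift _ (A *m B).
  by rewrite mulmxA RA -mulmxA RB mulmx0.
have rkR : \rank R = d.+1.
  apply/eqP; rewrite eqn_leq rank_leq_row.
  by rewrite -{1}(mxrank_unit RC) mxrankM_maxl.
exists (m - \rank R)%N, A', (row_mx C B); last first.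
  rewrite mul_mx_row AC AB mul_row_block !(mulmx0, mul0mx, addr0, add0r).
  by [].
have rkP : \rank (row_mx C B) = (d.+1 + (m - \rank R))%N.
  apply/eqP; rewrite -mxrank_tr -[_ == _]/(row_free _) -kermx_eq0.
  apply/rowV0P => w /sub_kermxP wP.
  have: row_mx C B *m w^T = 0 by apply: trmx_inj; rewrite trmx_mul trmxK wP trmx0.
  rewrite -[w^T]vsubmxK mul_row_col => CB.
  have u0 : usubmx w^T = 0.
    have /(congr1 (mulmx (invmx (R *m C)))) := congr1 (mulmx R) CB.
    by rewrite mulmxDr [R *m (B *m _)]mulmxA RB mul0mx addr0 mulmxA mulKmx // !mulmx0.
  have d0 : dsubmx w^T = 0 by apply: Binj; rewrite u0 mulmx0 add0r in CB.
  by rewrite -[w]trmxK -[w^T]vsubmxK u0 d0 col_mx0 trmx0.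
rewrite /row_free /row_full rkP eqxx andbT {1}rkR subnKC //.
by rewrite -rkR rank_leq_col.
Qed.

Lemma min_nilpotency m (A : 'M[K]_m.+1) n : A ^+ n = 0 ->
  exists d, [/\ (d < n)%N, A ^+ d != 0 & A ^+ d.+1 = 0].
Proof.
elim: n => [/eqP|n IHn An]; first by rewrite expr0 oner_eq0.
have [/IHn[d [dn ? ?]]|Ad] := eqVneq (A ^+ n) 0.
  by exists d; split=> //; apply: ltnW.
by exists n.
Qed.

Lemma jordan_mx_cons d s :
  mx_similar (block_mx (jordan_block K d) 0 0 (jordan_mx K s)) (jordan_mx K (d :: s)).
Proof.
rewrite [X in mx_similar _ X](_ : _ = \mxdiag_i jordan_block K (nth 0%N (d :: s) i)) //.
rewrite mxdiag_recl; exact: mx_similar_cast.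
Qed.

Lemma sum_nth_sumn s : \sum_(i < size s) nth 0%N s i = sumn s.
Proof. by rewrite sumnE (big_nth 0%N) big_mkord. Qed.

Lemma jordan_form_exists m (A : 'M[K]_m) n : A ^+ n = 0 ->
  exists s, [/\ sorted geq s, all (fun i => 0 < i <= n)%N s &
               mx_similar A (jordan_mx K s)].
Proof.
elim/ltn_ind: m A n => -[|m] IHm A n An.
  exists [::]; split=> //; exists 0; last by rewrite mulmx0 mul0mx.
  by rewrite /row_free /row_full mxrank0 big_ord0.
have [d [dn Ad Ad1]] := min_nilpotency An.
have [m' [A' sA]] := split_nilpotent Ad1 Ad.
have m'm : (m' < m.+1)%N.
  by rewrite (mx_similar_size sA) addSn ltnS leq_addl.
have A'd : A' ^+ d.+1 = 0.
  have := mx_similar_rank d.+1 sA.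
  rewrite Ad1 mxrank0 expr_block0 rank_block0 => /esym/eqP.
  by rewrite addn_eq0 !mxrank_eq0 => /andP[_ /eqP].
have [s [ss sn sA']] := IHm m' m'm A' d.+1 A'd.
exists (d.+1 :: s); split.
- by rewrite /= path_min_sorted //; apply: sub_all sn => i /andP[].
- by rewrite /= dn; apply: sub_all sn => i /andP[-> /leq_trans->].
apply: (mx_similar_trans sA); apply: mx_similar_trans (jordan_mx_cons _ _).
exact: mx_similar_block0.
Qed.

(** Both matrices have the same nilpotency index, so the same block can be split
    off, and the ranks of the complements agree again. *)
Lemma mx_similar_of_ranks m1 m2 (A : 'M[K]_m1) (B : 'M[K]_m2) n :
    A ^+ n = 0 -> B ^+ n = 0 ->
    (forall j, \rank (A ^+ j) = \rank (B ^+ j)) ->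
  mx_similar A B.
Proof.
elim/ltn_ind: m1 m2 A B n => -[|m1] IHm [|m2] A B n An Bn rkAB;
  have := rkAB 0%N; rewrite !expr0 !mxrank1 // => m12.
  by rewrite (flatmx0 A) (flatmx0 B); apply: mx_similar_refl.
have [d [dn Ad Ad1]] := min_nilpotency An.
have Bd : B ^+ d != 0 by rewrite -mxrank_eq0 -rkAB mxrank_eq0.
have Bd1 : B ^+ d.+1 = 0 by apply/eqP; rewrite -mxrank_eq0 -rkAB Ad1 mxrank0.
have [m1' [A' sA]] := split_nilpotent Ad1 Ad.
have [m2' [B' sB]] := split_nilpotent Bd1 Bd.
apply: (mx_similar_trans sA); apply: mx_similar_trans (mx_similar_sym sB).
have rk j : \rank (A' ^+ j) = \rank (B' ^+ j).
  have := rkAB j; rewrite (mx_similar_rank j sA) (mx_similar_rank j sB).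
  by rewrite !expr_block0 !rank_block0 => /addnI.
have nilp q (C : 'M[K]_q) :
    \rank (block_mx (jordan_block K d.+1) 0 0 C ^+ d.+1) = 0%N -> C ^+ d.+1 = 0.
  rewrite expr_block0 rank_block0 => /eqP.
  by rewrite addn_eq0 !mxrank_eq0 => /andP[_ /eqP].
have m1m : (m1' < m1.+1)%N.
  by rewrite (mx_similar_size sA) addSn ltnS leq_addl.
apply/mx_similar_block0/(IHm m1' m1m m2' A' B' d.+1) => //.
- by apply: nilp; rewrite -(mx_similar_rank _ sA) Ad1 mxrank0.
- by apply: nilp; rewrite -(mx_similar_rank _ sB) Bd1 mxrank0.
Qed.

End Similarity.

Lemma rank_jordan_mx_map (k K : fieldType) (iota : {rmorphism k -> K}) s j :
  \rank (jordan_mx K s ^+ j) = \rank (jordan_mx k s ^+ j).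
Proof.
elim: s => [|d s IHs].
  have rk0 (F : fieldType) (A : 'M[F]_(\sum_(i < 0) nth 0%N [::] i)) : \rank A = 0%N.
    by apply/eqP; rewrite -leqn0 (leq_trans (rank_leq_row A)) // big_ord0.
  by rewrite !rk0.
rewrite -!(mx_similar_rank j (jordan_mx_cons _ d s)) !expr_block0 !rank_block0 IHs.
have -> : jordan_block K d = map_mx iota (jordan_block k d).
  by apply/matrixP => a b; rewrite !mxE rmorph_nat.
by rewrite rank_map_expr.
Qed.

Section JordanType.

Variables (F : fieldType) (p m : nat).
Variable N : {lrmorphism trunc_poly F p -> 'M[F]_m}.

Lemma has_jordan_type_rank s j : has_jordan_type N s ->
  \rank (N 'qX ^+ j) = \rank (jordan_mx F s ^+ j).
Proof. by case=> _ [P fP NP]; apply: mx_similar_rank; exists P. Qed.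

Lemma has_jordan_type_exists : N 'qX ^+ p = 0 -> exists s, has_jordan_type N s.
Proof.
case/jordan_form_exists=> s [ss sp sN]; exists s; split=> //.
by split=> //; rewrite -sum_nth_sumn -(mx_similar_size sN).
Qed.

End JordanType.

(** * Algebra morphisms from truncated polynomials *)
Section TruncPoly.

Variables (F : fieldType) (p : nat).
Local Notation A := (trunc_poly F p).

Lemma in_qpolyK : cancel (fun a : A => a : {poly F}) (in_qpoly 'X^p).
Proof. by move=> a; apply/val_inj/in_qpoly_small/size_mk_monic. Qed.

Lemma trunc_gen_nilp : (0 < p)%N -> ('qX : A) ^+ p = 0.
Proof.
move=> p0; rewrite -rmorphXn; apply: val_inj => /=.
have e : mk_monic 'X^p = 'X^p :> {poly F} by rewrite mk_monic_Xn prednK.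
by rewrite -{1}e Pdiv.RingMonic.rmodpp ?monic_mk_monic.
Qed.

Lemma rep_iso_gen m (N N' : {lrmorphism A -> 'M[F]_m}) :
  mx_similar (N 'qX) (N' 'qX) -> rep_iso N N'.
Proof.
case/mx_similar_sym=> P /andP[fP _] NP; exists P.
  by rewrite -row_free_unit.
move=> a; rewrite -[a]in_qpolyK.
elim/poly_ind: (a : {poly F}) => [|f c IHf]; first by rewrite !rmorph0 mulmx0 mul0mx.
rewrite !rmorphD !rmorphM /= mulmxDr mulmxDl; congr (_ + _).
  by rewrite -![_ * _]/(_ *m _) mulmxA IHf -!mulmxA NP.
rewrite -[c%:P]mulr1 mul_polyC !linearZ /= !rmorph1.
by rewrite -scalemxAl mul1mx mulmx1.
Qed.

Section Eval.

Variables (B : algType F) (u : B).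

(** The hypotheses are arguments so that the function can carry the structure of
    a morphism of algebras. *)
Definition trunc_eval of (0 < p)%N & u ^+ p = 0 :=
  fun r : A => horner_alg u (r : {poly F}).

Hypotheses (p0 : (0 < p)%N) (up : u ^+ p = 0).

Lemma horner_alg_mod f : horner_alg u (in_qpoly 'X^p f) = horner_alg u f.
Proof.
have e : mk_monic 'X^p = 'X^p :> {poly F} by rewrite mk_monic_Xn prednK.
rewrite [in RHS](Pdiv.RingMonic.rdivp_eq (monic_mk_monic 'X^p) f).
have hX : horner_alg u (mk_monic 'X^p) = 0 by rewrite e rmorphXn /= horner_algX.
by rewrite rmorphD rmorphM /= hX mulr0 add0r.
Qed.

Fact trunc_eval_is_linear : linear (trunc_eval p0 up).
Proof.
by move=> c r s; rewrite /trunc_eval poly_of_qpolyD poly_of_qpolyZ linearP /= mulr_algl.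
Qed.

Fact trunc_eval_is_monoid_morphism : monoid_morphism (trunc_eval p0 up).
Proof.
split=> [|r s]; rewrite /trunc_eval; first by rewrite rmorph1.
by rewrite -rmorphM -[RHS]horner_alg_mod.
Qed.

HB.instance Definition _ :=
  GRing.isLinear.Build F A B *:%R (trunc_eval p0 up) trunc_eval_is_linear.
HB.instance Definition _ :=
  GRing.isMonoidMorphism.Build A B (trunc_eval p0 up)
    trunc_eval_is_monoid_morphism.

Lemma trunc_eval_gen : trunc_eval p0 up 'qX = u.
Proof. by rewrite /trunc_eval horner_alg_mod horner_algX. Qed.

End Eval.

Lemma trunc_antip_gen : (1 < p)%N -> trunc_antip ('qX : A) = - 'qX.
Proof.
move=> p1; rewrite /trunc_antip qpolyXE ?size_polyXn ?monicXn ?ltnS //.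
by rewrite comp_polyX rmorphN.
Qed.

End TruncPoly.

(** * Flatness over truncated polynomials *)
Section Regular.

Variables (F : fieldType) (H : finGroupScheme F).
Local Notation n := (gs_dim H).
Local Notation B := (grpalg H).
Implicit Types x y b : B.

Definition regular_rep (x : B) : 'M[F]_n :=
  \matrix_(l, j) \sum_i gs_comul l i j * x 0 i.

Lemma regular_repE x b : (regular_rep x *m b^T : 'cV_n) = (x * b)^T.
Proof.
apply/matrixP => l q; rewrite ord1 !mxE exchange_big /=.
apply: eq_bigr => j _; rewrite !mxE mulr_suml; apply: eq_bigr => i _.
by rewrite mulrA.
Qed.

Lemma regular_rep_inj (C D : 'M[F]_n) :
  (forall b : B, C *m b^T = D *m b^T) -> C = D.
Proof.
move=> CD; apply/matrixP => l j; have := CD (delta_mx 0 j).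
by rewrite trmx_delta -!colE => /matrixP/(_ l 0); rewrite !mxE.
Qed.

Fact regular_rep_is_linear : linear regular_rep.
Proof.
move=> c x y; apply/matrixP => l j; rewrite !mxE mulr_sumr -big_split.
by apply: eq_bigr => i _; rewrite !mxE mulrDr mulrCA.
Qed.

Fact regular_rep_is_monoid_morphism : monoid_morphism regular_rep.
Proof.
split=> [|x y]; apply: regular_rep_inj => b.
  by rewrite regular_repE mul1r mul1mx.
by rewrite regular_repE -mulrA -!regular_repE mulmxA.
Qed.

HB.instance Definition _ :=
  GRing.isLinear.Build F B 'M[F]_n *:%R regular_rep regular_rep_is_linear.
HB.instance Definition _ :=
  GRing.isMonoidMorphism.Build B 'M[F]_n regular_rep
    regular_rep_is_monoid_morphism.

Lemma mul_regular_rep x b : x * b = b *m (regular_rep x)^T.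
Proof. by apply: trmx_inj; rewrite -regular_repE trmx_mul trmxK. Qed.

End Regular.

Lemma regular_rep_ext (k K : fieldType) (iota : {rmorphism k -> K})
    (G : finGroupScheme k) (x : grpalg (base_change iota G)) :
  module_ext iota (@regular_rep k G) x = regular_rep x.
Proof.
apply/matrixP => l j; rewrite /module_ext summxE mxE; apply: eq_bigr => i _.
rewrite !mxE /= (bigD1 i) //= big1 => [|a ai]; last first.
  by rewrite !mxE (negPf ai) andbF mulr0.
by rewrite !mxE !eqxx mulr1 addr0 mulrC.
Qed.

Section Residue.

Variables (F : fieldType) (p : nat).
Local Notation R := (trunc_poly F p).
Hypothesis p0 : (0 < p)%N.

Let exp0 : (0 : F^o) ^+ p = 0.
Proof. by rewrite expr0n gtn_eqF. Qed.

Definition residue : R -> F^o := trunc_eval p0 exp0.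
HB.instance Definition _ := GRing.LRMorphism.on residue.

Lemma residueX : residue 'qX = 0. Proof. exact: trunc_eval_gen. Qed.

Lemma residueC c : residue c%:A = c.
Proof. by rewrite /residue linearZ /= rmorph1 [LHS]mulr1. Qed.

(** An alias of [F] for the action of truncated polynomials through [residue],
    which depends on the positivity of [p]. *)
Definition residue_mod of (0 < p)%N : Type := F.
HB.instance Definition _ := GRing.Zmodule.on (residue_mod p0).

Definition residue_scale (r : R) (x : residue_mod p0) : residue_mod p0 := residue r * x.

Fact residue_scaleA r s x : residue_scale r (residue_scale s x) = residue_scale (r * s) x.
Proof. by rewrite /residue_scale rmorphM mulrA. Qed.
Fact residue_scale1 : left_id 1 residue_scale.
Proof. by move=> x; rewrite /residue_scale rmorph1 mul1r. Qed.
Fact residue_scaleDr : right_distributive residue_scale +%R.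
Proof. by move=> r x y; rewrite /residue_scale mulrDr. Qed.
Fact residue_scaleDl x : {morph residue_scale^~ x : r s / r + s}.
Proof. by move=> r s; rewrite /residue_scale rmorphD mulrDl. Qed.
HB.instance Definition _ := GRing.Zmodule_isLmodule.Build R (residue_mod p0)
  residue_scaleA residue_scale1 residue_scaleDr residue_scaleDl.

Lemma trunc_ind (P : R -> Prop) :
  P 0 -> (forall r c, P r -> P (r * 'qX + c%:A)) -> forall r, P r.
Proof.
move=> P0 PS r; rewrite -[r]in_qpolyK.
elim/poly_ind: (r : {poly F}) => [|f c IHf]; first by rewrite rmorph0.
rewrite rmorphD rmorphM /= -[c%:P]mulr1 mul_polyC in_qpolyZ in_qpoly1.
exact: PS.
Qed.

Lemma residue_socle r : r * 'qX ^+ p.-1 = residue r *: 'qX ^+ p.-1 :> R.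
Proof.
elim/trunc_ind: r => [|r c _]; first by rewrite rmorph0 mul0r scale0r.
rewrite rmorphD rmorphM /= residueX mulr0 add0r residueC mulrDl.
by rewrite -mulrA -exprS prednK // trunc_gen_nilp // mulr0 add0r mulr_algl.
Qed.

Lemma socle_neq0 : ('qX : R) ^+ p.-1 != 0.
Proof.
have eX : in_qpoly 'X^p 'X^(p.-1) = 'X^(p.-1) :> {poly F}.
  by apply: in_qpoly_small; rewrite mk_monic_Xn !size_polyXn prednK.
rewrite -rmorphXn; apply/eqP => /(congr1 (fun a : R => a : {poly F})).
by rewrite [LHS]eX => X0; have /eqP := monic_neq0 (monicXn F p.-1).
Qed.

Definition socle_map (x : residue_mod p0) : R^o := (x : F) *: ('qX ^+ p.-1 : R).

Fact socle_map_is_linear : linear socle_map.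
Proof.
move=> r x y; rewrite /socle_map [LHS]scalerDl; congr (_ + _).
by rewrite -[RHS]/(r * _) -scalerAr residue_socle scalerA mulrC.
Qed.
HB.instance Definition _ := GRing.isLinear.Build R (residue_mod p0) R^o *:%R
  socle_map socle_map_is_linear.

Lemma socle_map_inj : injective socle_map.
Proof.
move=> x y exy; have /eqP : ((x : F) - (y : F)) *: ('qX ^+ p.-1 : R) = 0.
  by rewrite scalerBl; apply/eqP; rewrite subr_eq0; apply/eqP.
by rewrite scaler_eq0 (negPf socle_neq0) orbF subr_eq0 => /eqP.
Qed.

End Residue.

Section Flat.

Variables (F : fieldType) (p : nat) (H : finGroupScheme F).
Local Notation R := (trunc_poly F p).
Local Notation B := (grpalg H).
Local Notation n := (gs_dim H).
Variable f : {lrmorphism R -> B}.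
Hypothesis p0 : (0 < p)%N.

Local Notation U := (regular_rep (f 'qX))^T.

Let mulU b : f 'qX * b = b *m U.
Proof. exact: mul_regular_rep. Qed.

Let mulUX j b : f 'qX ^+ j * b = b *m U ^+ j.
Proof. by rewrite mul_regular_rep rmorphXn /= trmx_expr. Qed.

(** Tensoring the inclusion of the residue field as the socle of R with B gives
    the multiplication by t^(p-1) from B/tB to B. If it is injective then the
    kernel of t^(p-1) on B is tB. *)
Lemma flat_rank : left_flat f ->
  (n <= \rank (regular_rep (f 'qX)) + \rank (regular_rep (f 'qX ^+ p.-1)))%N.
Proof.
move=> flat.
suff H0 (b : B) : f 'qX ^+ p.-1 * b = 0 -> (b <= U)%MS.
  have: (kermx (U ^+ p.-1) <= U)%MS.
    apply/row_subP => i; apply: H0; rewrite mulUX; apply/sub_kermxP.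
    exact: row_sub.
  move/mxrankS; rewrite mxrank_ker mxrank_tr leq_subLR addnC.
  by rewrite -trmx_expr mxrank_tr -rmorphXn.
move=> fb; rewrite submxE; apply/eqP.
have t0 : tensor_eq0 f
    [seq (socle_map u.1, u.2) | u <- [:: ((1 : F) : residue_mod F p0, b)]].
  move=> Z beta [_ bD bZ]; rewrite big_seq1 /=.
  have -> : socle_map (1 : residue_mod F p0) = ('qX ^+ p.-1 : R) *: (1 : R^o).
    by rewrite /socle_map scale1r [RHS]mulr1.
  rewrite bZ rmorphXn fb; apply: (addrI (beta 1 0)).
  by rewrite -bD !addr0.
have := flat _ _ _ (@socle_map_inj F p p0) _ t0.
(* This balanced map detects whether 1 (x) b vanishes, that is, whether b is in
   tB. *)
pose beta (x : residue_mod F p0) (b : B) := (x : F) *: (b *m cokermx U).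
move=> /(_ _ beta); rewrite big_seq1 /beta /= scale1r; apply.
split=> [x x' y|x y y'|r x y].
- by rewrite scalerDl.
- by rewrite mulmxDl scalerDr.
rewrite {1}/GRing.scale /= /residue_scale.
have -> : (f r * y) *m cokermx U = residue p0 r *: (y *m cokermx U).
  elim/trunc_ind: r => [|r c _].
    by rewrite !rmorph0 mul0r mul0mx scale0r.
  rewrite rmorphD rmorphM /= linearZ rmorph1 rmorphD rmorphM /= residueX.
  rewrite mulr0 add0r residueC mulrDl mulmxDl.
  have -> : f r * f 'qX = f 'qX * f r by rewrite -!rmorphM mulrC.
  rewrite -mulrA mulU -mulmxA mulmx_coker mulmx0 add0r mulr_algl.
  by rewrite -scalemxAl.
by rewrite scalerA mulrC.
Qed.

(** The rank condition says that the socle of B, the kernel of t, is the image of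
    t^(p-1). Linear forms on B dual to a basis t^(p-1) w_l of the socle give maps
    r_l : B -> R of R-modules, and the endomorphism T of B that sends b to the sum
    of the r_l(b) w_l is the identity on the socle, hence bijective. So B is free
    with basis the T^-1(w_l), and flat. *)
Lemma rank_flat :
  (n <= \rank (regular_rep (f 'qX)) + \rank (regular_rep (f 'qX ^+ p.-1)))%N ->
  left_flat f.
Proof.
rewrite rmorphXn /= -(mxrank_tr (regular_rep _)) -(mxrank_tr (_ ^+ _)) trmx_expr => rkU.
have Up : U ^+ p = 0.
  by rewrite -trmx_expr -rmorphXn -rmorphXn trunc_gen_nilp // !rmorph0 trmx0.
set S := U ^+ p.-1 in rkU.
have US : U *m S = 0 by rewrite -[_ *m _]exprS prednK.
have SU : S *m U = 0 by rewrite -[_ *m _]exprSr prednK.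
have socle (b : 'rV[F]_n) : b *m U = 0 -> (b <= S)%MS.
  move=> bU; have sSK : (S <= kermx U)%MS by apply/sub_kermxP.
  have [le_rk eq_rk] := mxrank_leqif_sup sSK.
  have sKS : (kermx U <= S)%MS.
    by rewrite -eq_rk eqn_leq le_rk mxrank_ker leq_subLR.
  by apply: submx_trans sKS; apply/sub_kermxP.
pose c := \rank S; pose E := row_base S.
have [W defE] : exists W : 'M_(c, n), E = W *m S.
  by apply/submxP; rewrite eq_row_base.
pose L := pinvmx E.
have EL : E *m L = 1%:M by rewrite mulmxVp // row_base_free.
(* The rows of [W] are the w_l, and the columns of [L] are the linear forms. *)
pose T := \sum_(j < p.-1.+1) U ^+ (p.-1 - j) *m L *m W *m U ^+ j.
have Up1 : U ^+ p.-1.+1 = 0 by rewrite prednK.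
have TU : T *m U = U *m T.
  rewrite /T mulmx_suml mulmx_sumr big_ord_recr big_ord_recl /=.
  rewrite -[X in _ + X = _]mulmxA -[U ^+ p.-1 *m U]exprSr Up1 mulmx0 addr0.
  have -> : U *m (U ^+ (p.-1 - 0) *m L *m W *m U ^+ 0) = 0.
    by rewrite !mulmxA -[U *m U ^+ _]exprS subn0 Up1 !mul0mx.
  rewrite add0r; apply: eq_bigr => j _; rewrite -mulmxA -[_ *m U]exprSr !mulmxA.
  by rewrite -[U *m U ^+ _]exprS subnSK.
have Tinj (v : 'rV[F]_n) : v *m U = 0 -> v *m T = v.
  move=> vU; have : (v <= E)%MS by rewrite eq_row_base socle.
  case/submxP=> a defv; rewrite /T mulmx_sumr.
  rewrite (bigD1 ord_max) //= big1 => [|j jp].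
    rewrite subnn expr0 addr0 [_ *m L]mul1mx defv -/S.
    by rewrite -[L *m W *m S]mulmxA -defE -mulmxA [E *m (L *m E)]mulmxA EL mul1mx.
  have : (0 < p.-1 - j)%N.
    by rewrite subn_gt0 ltn_neqAle -ltnS ltn_ord andbT.
  by case: (_ - _)%N => // i _; rewrite !mulmxA exprS !mulmxA vU !mul0mx.
have Tu : T \in unitmx.
  rewrite -row_free_unit -kermx_eq0; apply/rowV0P => v /sub_kermxP vT.
  suff: forall i (w : 'rV_n), w *m T = 0 -> w *m U ^+ i = 0 -> w = 0.
    by move/(_ p v vT); apply; rewrite Up mulmx0.
  elim=> [|i IHi] {v vT} v vT; first by rewrite mulmx1.
  rewrite exprS [_ *m _]mulmxA => /IHi vU; rewrite -[v]Tinj //.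
  by apply: vU; rewrite -mulmxA -TU mulmxA vT mul0mx.
pose r l (b : B) : R := \sum_(j < p.-1.+1) (b *m (U ^+ (p.-1 - j) *m L)) 0 l *: 'qX ^+ j.
pose bas l : B := row l W *m invmx T.
have rD l b b' : r l (b + b') = r l b + r l b'.
  by rewrite -big_split; apply: eq_bigr => j _; rewrite mulmxDl mxE scalerDl.
have rX l b : r l (f 'qX * b) = 'qX * r l b.
  rewrite mulU /r mulr_sumr big_ord_recl big_ord_recr /= !expr0 subn0.
  rewrite -[_ *m U *m _]mulmxA [U *m _]mulmxA -[U *m U ^+ _]exprS Up1.
  rewrite mul0mx mulmx0 mxE scale0r add0r -scalerAr -exprS prednK //.
  rewrite trunc_gen_nilp // scaler0 addr0; apply: eq_bigr => j _.
  rewrite -scalerAr -exprS; congr (_ *: _).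
  by rewrite -[_ *m U *m _]mulmxA [U *m _]mulmxA -[U *m U ^+ _]exprS subnSK.
have rZ l s b : r l (f s * b) = s * r l b.
  elim/trunc_ind: s b => [|s d IHs] b.
    rewrite rmorph0 !mul0r; apply: (addrI (r l 0)).
    by rewrite -rD !addr0.
  have -> : f (s * 'qX + d%:A) = f s * f 'qX + d%:A.
    by rewrite rmorphD rmorphM /= linearZ rmorph1.
  rewrite !mulrDl -!mulrA rD IHs rX; congr (_ + _).
  rewrite !mulr_algl scaler_sumr; apply: eq_bigr => j _.
  by rewrite -scalemxAl mxE scalerA.
have rB b : b = \sum_l f (r l b) * bas l.
  have TVU j : invmx T *m U ^+ j = U ^+ j *m invmx T.
    have TUj : T *m U ^+ j = U ^+ j *m T.
      by have /commrX := TU : GRing.comm (T : 'M_n) U; apply.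
    by rewrite -{1}[U ^+ j](mulmxK Tu) -TUj !mulmxA mulVmx // mul1mx.
  transitivity (\sum_l \sum_(j < p.-1.+1)
      (b *m (U ^+ (p.-1 - j) *m L)) 0 l *: (row l W *m U ^+ j *m invmx T)).
    rewrite exchange_big /= -{1}[b](mulmxK Tu) /T mulmx_sumr mulmx_suml.
    apply: eq_bigr => j _; set w := b *m (U ^+ _ *m L).
    transitivity (w *m W *m U ^+ j *m invmx T); first by rewrite /w !mulmxA.
    rewrite [w *m W]mulmx_sum_row !mulmx_suml.
    by apply: eq_bigr => l _; rewrite -!scalemxAl.
  apply: eq_bigr => l _; rewrite linear_sum mulr_suml; apply: eq_bigr => j _.
  by rewrite linearZ rmorphXn -scalerAl mulUX /bas -!mulmxA TVU.
move=> X Y g ginj s gs0.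
have x0 l : \sum_(u <- s) r l u.2 *: u.1 = 0.
  apply: ginj; rewrite linear0 linear_sum.
  have := gs0 _ (fun y b => r l b *: y); rewrite big_map /=.
  move=> beta0; rewrite -[RHS]beta0; first by apply: eq_bigr => u _; rewrite linearZ.
  split=> [y y' b|y b b'|a y b]; rewrite ?scalerDr // ?rD ?scalerDl //.
  by rewrite rZ scalerA mulrC.
move=> Z beta [bDl bDr bZ].
have beta0 b : beta 0 b = 0 by apply: (addrI (beta 0 b)); rewrite -bDl !addr0.
have beta_r0 x : beta x 0 = 0 by apply: (addrI (beta x 0)); rewrite -bDr !addr0.
transitivity (\sum_l \sum_(u <- s) beta (r l u.2 *: u.1) (bas l)).
  rewrite exchange_big; apply: eq_bigr => u _ /=; rewrite {1}(rB u.2).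
  rewrite (big_morph (beta u.1) (bDr u.1) (beta_r0 u.1)).
  by apply: eq_bigr => l _; rewrite bZ.
rewrite big1 // => l _.
rewrite -(big_morph (beta^~ (bas l)) (fun x y => bDl x y (bas l)) (beta0 (bas l))).
by rewrite x0 beta0.
Qed.

End Flat.

(** * Unipotent abelian group schemes *)
(** Apply A repeatedly to a common kernel vector of the other matrices and stop
    just before it vanishes. *)
Lemma common_kernel (F : fieldType) m (s : seq 'M[F]_m.+1) :
    {in s &, forall A B, A * B = B * A} -> {in s, forall A, exists e, A ^+ e = 0} ->
  exists2 v : 'cV[F]_m.+1, v != 0 & {in s, forall A, A *m v = 0}.
Proof.
elim: s => [|A s IHs] sC sN.
  exists (delta_mx 0 0) => //; apply/eqP => /matrixP/(_ 0 0)/eqP.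
  by rewrite !mxE !eqxx oner_eq0.
have [|B sB|v v0 sv] := IHs.
- by move=> B C sB sC'; apply: sC; rewrite inE ?sB ?sC' orbT.
- by apply: sN; rewrite inE sB orbT.
have [e Ae] := sN A (mem_head _ _).
have : A ^+ e *m v = 0 by rewrite Ae mul0mx.
elim: e {Ae} => [|e IHe]; first by rewrite mul1mx => v00; rewrite v00 eqxx in v0.
move=> Ae1; have [/IHe//|Aev] := eqVneq (A ^+ e *m v) 0.
exists (A ^+ e *m v) => // B; rewrite inE => /predU1P[->|sB].
  by rewrite mulmxA -[A *m _]exprS.
rewrite mulmxA; have -> : B *m A ^+ e = A ^+ e *m B.
  by apply: commrX; apply: sC; rewrite inE ?eqxx ?sB ?orbT.
by rewrite -mulmxA sv // mulmx0.
Qed.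

Lemma nilpD (R : pzRingType) (x y : R) a b : GRing.comm x y ->
  x ^+ a = 0 -> y ^+ b = 0 -> (x + y) ^+ (a + b) = 0.
Proof.
move=> xy xa yb; rewrite exprDn_comm // big1 // => i _.
have [ib|bi] := leqP b i.
  by rewrite -(subnK ib) (exprD y) yb !mulr0 mul0rn.
have ai : (a <= a + b - i)%N by rewrite -addnBA ?leq_addr // ltnW.
by rewrite -(subnK ai) exprD xa mulr0 mul0r mul0rn.
Qed.

Lemma nilp_sum (R : nzRingType) I (s : seq I) (P : I -> R) :
    (forall i j, GRing.comm (P i) (P j)) -> (forall i, exists e, P i ^+ e = 0) ->
  exists e, (\sum_(i <- s) P i) ^+ e = 0.
Proof.
move=> PC PN; elim: s => [|i s [e se]]; first by exists 1%N; rewrite big_nil expr1.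
have [d id] := PN i; exists (d + e)%N; rewrite big_cons nilpD //.
by apply: commr_sum => j _; apply: PC.
Qed.

Lemma stable_power (F : fieldType) n (Y : 'M[F]_n) :
  exists e, \rank (Y ^+ e) = \rank (Y ^+ e.+1).
Proof.
have step i : (exists e, \rank (Y ^+ e) = \rank (Y ^+ e.+1)) \/
    (\rank (Y ^+ i) + i <= n)%N.
  elim: i => [|i [?|IHi]]; [by right; rewrite addn0 rank_leq_row | by left |].
  have := mxrankM_maxr Y (Y ^+ i); rewrite -[Y *m _]exprS leq_eqVlt.
  case/predU1P=> [e|lt]; first by left; exists i.
  by right; rewrite addnS (leq_trans _ IHi) // ltn_add2r.
by case: (step n.+1) => //; rewrite addnS ltnNge leq_addl.
Qed.

Section AbelianUnipotent.

Variables (F : fieldType) (C : finGroupScheme F).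
Local Notation n := (gs_dim C).
Local Notation FC := (grpalg C).
Implicit Types x y : FC.

Lemma abelian_mulC : abelian_gs C -> forall x y, x * y = y * x.
Proof.
move=> aC x y; apply/rowP => l; rewrite !grpalg_mulE exchange_big /=.
apply: eq_bigr => i _; apply: eq_bigr => j _.
by rewrite aC [x 0 _ * _]mulrC.
Qed.

Section Subrep.

Variables (r : nat) (E : 'M[F]_(r, n)).
Hypotheses (fE : row_free E).
Hypothesis (stE : forall x, (E *m (regular_rep x)^T <= E)%MS).

(** Matrices act on columns, whence the transposition. *)
Definition sub_regular
    of row_free E & (forall x, (E *m (regular_rep x)^T <= E)%MS) :=
  fun x => (E *m (regular_rep x)^T *m pinvmx E)^T.

Local Notation N := (sub_regular fE stE).

Lemma sub_regularE x : (N x)^T *m E = E *m (regular_rep x)^T.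
Proof. by rewrite trmxK mulmxKpV. Qed.

Fact sub_regular_is_linear : linear N.
Proof.
by move=> a x y; rewrite /sub_regular !linearP /= mulmxDl -scalemxAl linearP.
Qed.

Fact sub_regular_is_monoid_morphism : monoid_morphism N.
Proof.
split=> [|x y]; first by rewrite /sub_regular rmorph1 trmx1 mulmx1 mulmxVp // [LHS]trmx1.
apply: trmx_inj; apply: (row_free_inj fE).
rewrite [LHS]sub_regularE rmorphM -![_ * _]/(_ *m _) !trmx_mul.
by rewrite mulmxA -sub_regularE -!mulmxA sub_regularE.
Qed.

HB.instance Definition _ :=
  GRing.isLinear.Build F FC 'M[F]_r *:%R N sub_regular_is_linear.
HB.instance Definition _ :=
  GRing.isMonoidMorphism.Build FC 'M[F]_r N sub_regular_is_monoid_morphism.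

End Subrep.

(** On the image of a high power of y, a submodule of the regular representation
    because FC is commutative, y acts injectively. A nonzero fixed vector in it
    would be killed by y, so this image is zero. *)
Lemma unipotent_nilp : abelian_gs C -> unipotent_gs C ->
  forall y, grpalg_counit y = 0 -> exists e, y ^+ e = 0.
Proof.
move=> aC uC y y0; pose Y := (regular_rep y)^T.
have [e rkY] := stable_power Y; exists e.
have Ye1 (a : 'rV_n) : a *m Y ^+ e *m Y = 0 -> a *m Y ^+ e = 0.
  rewrite -mulmxA -[_ *m Y]exprSr => /sub_kermxP aY; apply/sub_kermxP.
  apply: submx_trans aY _; have sk : (kermx (Y ^+ e) <= kermx (Y ^+ e.+1))%MS.
    by apply/sub_kermxP; rewrite exprSr mulmxA mulmx_ker mul0mx.
  by have [_ <-] := mxrank_leqif_sup sk; rewrite !mxrank_ker rkY.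
suff Y0 : Y ^+ e = 0.
  have : y ^+ e * 1 = 0 by rewrite mul_regular_rep rmorphXn trmx_expr -/Y Y0 mulmx0.
  by rewrite mulr1.
pose E := row_base (Y ^+ e); have fE : row_free E by exact: row_base_free.
have stE x : (E *m (regular_rep x)^T <= E)%MS.
  have -> : (E *m (regular_rep x)^T <= E)%MS = (E *m (regular_rep x)^T <= Y ^+ e)%MS.
    by rewrite eq_row_base.
  have /submxP[a ->] : (E <= Y ^+ e)%MS by rewrite eq_row_base.
  rewrite -mulmxA; have -> : Y ^+ e *m (regular_rep x)^T = (regular_rep x)^T *m Y ^+ e.
    rewrite -trmx_expr -!trmx_mul -rmorphXn -![_ *m _]/(_ * _) -!rmorphM.
    by rewrite (abelian_mulC aC).
  by rewrite mulmxA submxMl.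
apply/eqP; rewrite -mxrank_eq0 -leqn0 leqNgt; apply/negP => r0.
have [v v0 vy] := uC _ (sub_regular fE stE) r0.
case/eqP: v0; have := congr1 trmx (vy y); rewrite y0 scale0r trmx0 trmx_mul => vN.
apply: trmx_inj; rewrite trmx0; apply: (row_free_inj fE); rewrite mul0mx.
have /submxP[a vE] : (v^T *m E <= Y ^+ e)%MS.
  by rewrite (submx_trans (submxMl _ _)) // eq_row_base.
rewrite vE; apply: Ye1; rewrite -vE -mulmxA -sub_regularE mulmxA vN.
by rewrite mul0mx.
Qed.

Lemma grpalg_counit_delta i : grpalg_counit (delta_mx 0 i : FC) = gs_one i.
Proof.
rewrite /grpalg_counit (bigD1 i) //= mxE !eqxx mul1r big1 ?addr0 // => j ji.
by rewrite mxE (negPf ji) andbF mul0r.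
Qed.

Lemma grpalg_counitB x c : grpalg_counit (x - c%:A) = grpalg_counit x - c.
Proof.
rewrite -[c in RHS]mulr1 -(grpalg_counit1 C) /grpalg_counit mulr_sumr -sumrB.
by apply: eq_bigr => i _; rewrite !mxE mulrBl mulrA.
Qed.

Lemma counit_expand x :
  x = \sum_i x 0 i *: ((delta_mx 0 i : FC) - (gs_one i)%:A) + (grpalg_counit x)%:A.
Proof.
rewrite /grpalg_counit scaler_suml -big_split /= {1}[x]grpalg_rowE.
by apply: eq_bigr => i _; rewrite scalerBr scalerA subrK.
Qed.

(** The augmentation ideal is spanned by commuting nilpotent elements. *)
Lemma nilp_unipotent : abelian_gs C ->
    (forall y, grpalg_counit y = 0 -> exists e, y ^+ e = 0) ->
  unipotent_gs C.
Proof.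
move=> aC nC [//|m] N _.
pose a i : FC := (delta_mx 0 i : FC) - (gs_one i)%:A.
have a0 i : grpalg_counit (a i) = 0.
  by rewrite grpalg_counitB grpalg_counit_delta subrr.
have [A B /mapP[i _ ->] /mapP[j _ ->]|A /mapP[i _ ->]|v v0 vN] :=
  @common_kernel F m [seq N (a i) | i : 'I_n].
- by rewrite -!rmorphM (abelian_mulC aC).
- by have [e ae] := nC _ (a0 i); exists e; rewrite -rmorphXn ae rmorph0.
exists v => // x; rewrite {1}[x]counit_expand linearD linear_sum mulmxDl mulmx_suml.
rewrite big1 ?add0r => [|i _]; last first.
  have Nv : N (a i) *m v = 0 by apply: vN; apply/mapP; exists i; rewrite ?mem_enum.
  by rewrite linearZ -scalemxAl Nv scaler0.
by rewrite linearZ rmorph1 -scalemxAl mul1mx.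
Qed.

End AbelianUnipotent.

(** * Antipodes and closed embeddings *)
Section Convolution.

Variables (F : fieldType) (C : finGroupScheme F).
Local Notation n := (gs_dim C).
Local Notation e i := (delta_mx 0 i : grpalg C).

(** The convolution inverse of f is unique: A = A * (f * D) = (A * f) * D = D. The
    functions are given on the basis of the group algebra, for which the structure
    constants of the coproduct are [gs_mul]. *)
Lemma conv_inv_unique (Q : algType F) (A f D : 'I_n -> Q) :
    (forall l, \sum_a \sum_b gs_mul a b l *: (A a * f b) = (gs_one l)%:A) ->
    (forall l, \sum_a \sum_b gs_mul a b l *: (f a * D b) = (gs_one l)%:A) ->
  A =1 D.
Proof.
move=> Af fD l.
transitivity (\sum_a \sum_u \sum_v
    (\sum_b gs_mul u v b * gs_mul a b l) *: (A a * f u * D v)).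
  transitivity (\sum_a \sum_b gs_mul a b l *: (A a * (gs_one b)%:A)).
    transitivity (\sum_a (a == l)%:R *: A a).
      rewrite (bigD1 l) //= eqxx scale1r big1 ?addr0 // => a /negPf->.
      by rewrite scale0r.
    apply: eq_bigr => a _; rewrite -gs_mul1 scaler_suml.
    by apply: eq_bigr => b _; rewrite mulr_algr scalerA mulrC (gs_mulC a).
  apply: eq_bigr => a _.
  under [RHS]eq_bigr do under eq_bigr do rewrite scaler_suml.
  under [RHS]eq_bigr do rewrite exchange_big /=.
  rewrite [RHS]exchange_big /=; apply: eq_bigr => b _.
  rewrite -fD mulr_sumr scaler_sumr; apply: eq_bigr => u _.
  rewrite mulr_sumr scaler_sumr; apply: eq_bigr => v _.
  by rewrite -scalerAr scalerA mulrA mulrC.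
transitivity (\sum_a \sum_u \sum_v
    (\sum_b gs_mul a u b * gs_mul b v l) *: (A a * f u * D v)).
  by do 3![apply: eq_bigr => ? _]; rewrite gs_mulA.
transitivity (\sum_v \sum_b gs_mul b v l *: ((gs_one b)%:A * D v)); last first.
  transitivity (\sum_v (v == l)%:R *: D v).
    apply: eq_bigr => v _; rewrite -gs_mul1 scaler_suml.
    by apply: eq_bigr => b _; rewrite mulr_algl scalerA mulrC.
  rewrite (bigD1 l) //= eqxx scale1r big1 ?addr0 // => a /negPf->.
  by rewrite scale0r.
under eq_bigr do under eq_bigr do under eq_bigr do rewrite scaler_suml.
under eq_bigr do rewrite exchange_big /=.
rewrite exchange_big /=; apply: eq_bigr => v _.
under eq_bigr do rewrite exchange_big /=.
rewrite exchange_big /=; apply: eq_bigr => b _.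
rewrite -Af mulr_suml scaler_sumr; apply: eq_bigr => a _.
rewrite mulr_suml scaler_sumr; apply: eq_bigr => u _.
by rewrite -scalerAl scalerA mulrC.
Qed.

Lemma antip_convl l :
  \sum_a \sum_b gs_mul a b l *: (grpalg_antip (e a) * e b) = (gs_one l)%:A.
Proof.
rewrite -grpalg_counit_delta -grpalg_antip_lawl.
by do 2![apply: eq_bigr => ? _]; rewrite grpalg_comul_delta.
Qed.

Lemma antip_convr l :
  \sum_a \sum_b gs_mul a b l *: (e a * grpalg_antip (e b)) = (gs_one l)%:A.
Proof.
rewrite -grpalg_counit_delta -grpalg_antip_lawr.
by do 2![apply: eq_bigr => ? _]; rewrite grpalg_comul_delta.
Qed.

(** Both the identity and the square of the antipode are convolution inverses of
    the antipode, the latter because the coproduct is cocommutative. *)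
Lemma grpalg_antipK : involutive (@grpalg_antip F C).
Proof.
move=> z; rewrite {2}[z]grpalg_rowE {1}[z]grpalg_rowE !linear_sum.
apply: eq_bigr => i _; rewrite !linearZ; congr (_ *: _); move: i.
apply: (@conv_inv_unique _ _ (fun b => grpalg_antip (e b))) => l; last exact: antip_convl.
transitivity (grpalg_antip (\sum_a \sum_b gs_mul a b l *: (e a * grpalg_antip (e b)))).
  rewrite exchange_big linear_sum; apply: eq_bigr => a _; rewrite linear_sum.
  by apply: eq_bigr => b _; rewrite linearZ /= grpalg_antipM gs_mulC.
by rewrite antip_convr linearZ /= grpalg_antip1.
Qed.

Lemma grpalg_antipX x i : grpalg_antip (x ^+ i : grpalg C) = grpalg_antip x ^+ i.
Proof.
elim: i => [|i IHi]; first by rewrite grpalg_antip1.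
by rewrite exprS grpalg_antipM IHi -exprSr.
Qed.

End Convolution.

Section Inclusion.

Variables (F : fieldType) (C G : finGroupScheme F) (phi : 'M[F]_(gs_dim G, gs_dim C)).
Hypothesis emb : closed_embedding phi.
Local Notation f := (grpalg_incl phi).
Implicit Types x y z : grpalg C.

Fact grpalg_incl_is_linear : linear f.
Proof. by move=> a x y; rewrite /grpalg_incl mulmxDl -scalemxAl. Qed.

Fact grpalg_incl_is_monoid_morphism : monoid_morphism f.
Proof.
case: emb => _ _ _ phiD phie; split=> [|x y]; apply/rowP => i.
  rewrite grpalg_oneE -phie mxE; apply: eq_bigr => l _.
  by rewrite grpalg_oneE mxE mulrC.
rewrite grpalg_mulE mxE.
transitivity (\sum_u \sum_v (\sum_l phi i l * gs_comul l u v) * (x 0 u * y 0 v)).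
  under eq_bigr do rewrite grpalg_mulE mulr_suml.
  rewrite exchange_big /=; apply: eq_bigr => u _.
  under eq_bigr do rewrite mulr_suml.
  rewrite exchange_big /=; apply: eq_bigr => v _; rewrite mulr_suml.
  by apply: eq_bigr => l _; rewrite mxE mulrC !mulrA.
under eq_bigr do under eq_bigr do rewrite phiD mulr_suml.
under eq_bigr do rewrite exchange_big /=.
rewrite exchange_big /=; apply: eq_bigr => a _.
under eq_bigr do under eq_bigr do rewrite mulr_suml.
under eq_bigr do rewrite exchange_big /=.
rewrite exchange_big /=; apply: eq_bigr => b _.
rewrite !mxE mulr_suml mulr_sumr; apply: eq_bigr => u _.
rewrite !mulr_sumr; apply: eq_bigr => v _; rewrite !mxE.
by ring.
Qed.

Lemma grpalg_incl_inj : injective f.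
Proof.
case: emb => fphi _ _ _ _ x y; apply: row_free_inj.
by rewrite /row_free mxrank_tr.
Qed.

Lemma grpalg_incl_delta u a : f (delta_mx 0 u) 0 a = phi a u.
Proof.
rewrite mxE (bigD1 u) //= big1 => [|v vu]; last by rewrite mxE (negPf vu) andbF mul0r.
by rewrite !mxE !eqxx mul1r addr0.
Qed.

HB.instance Definition _ :=
  GRing.isLinear.Build F (grpalg C) (grpalg G) *:%R f grpalg_incl_is_linear.

(** The inclusion preserves the coproduct. *)
Lemma incl_conv (A B : {linear grpalg G -> grpalg G}) l :
  \sum_a \sum_b gs_mul a b l *: (A (f (delta_mx 0 a)) * B (f (delta_mx 0 b))) =
  \sum_i \sum_j grpalg_comul (f (delta_mx 0 l)) i j *:
    (A (delta_mx 0 i) * B (delta_mx 0 j)).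
Proof.
have fE u : f (delta_mx 0 u) = \sum_i phi i u *: (delta_mx 0 i : grpalg G).
  by rewrite {1}[f _]grpalg_rowE; apply: eq_bigr => i _; rewrite grpalg_incl_delta.
have comulE i j : grpalg_comul (f (delta_mx 0 l)) i j =
    \sum_u \sum_v phi i u * phi j v * gs_mul u v l.
  case: emb => _ phiM _ _ _; rewrite -phiM; apply: eq_bigr => a _.
  by rewrite grpalg_incl_delta.
under [RHS]eq_bigr do under eq_bigr do rewrite comulE scaler_suml.
under [RHS]eq_bigr do rewrite exchange_big /=.
rewrite [RHS]exchange_big /=; apply: eq_bigr => a _.
under [RHS]eq_bigr do under eq_bigr do rewrite scaler_suml.
under [RHS]eq_bigr do rewrite exchange_big /=.
rewrite [RHS]exchange_big /=; apply: eq_bigr => b _.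
rewrite !fE !linear_sum mulr_suml scaler_sumr; apply: eq_bigr => i _.
rewrite mulr_sumr scaler_sumr; apply: eq_bigr => j _.
rewrite !linearZ -scalerAl -scalerAr !scalerA; congr (_ *: _); ring.
Qed.

Lemma grpalg_incl_counit l : \sum_i f (delta_mx 0 l) 0 i * gs_one i = gs_one l.
Proof.
case: emb => _ _ phi1 _ _; rewrite -phi1; apply: eq_bigr => i _.
by rewrite grpalg_incl_delta mulrC.
Qed.

(** A bialgebra map between Hopf algebras commutes with the antipodes, both
    composites being convolution inverses of it. *)
Lemma grpalg_incl_antip z : grpalg_antip (f z) = f (grpalg_antip z).
Proof.
have [f1 fM] := grpalg_incl_is_monoid_morphism.
rewrite [z]grpalg_rowE !linear_sum; apply: eq_bigr => i _.
rewrite !linearZ; congr (_ *: _); move: i => /=.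
apply: (@conv_inv_unique _ _ _ _ (fun b => f (delta_mx 0 b))) => l.
  rewrite (incl_conv (@grpalg_antip F G) idfun) grpalg_antip_lawl.
  by rewrite /grpalg_counit grpalg_incl_counit.
transitivity (f (\sum_a \sum_b gs_mul a b l *:
    ((delta_mx 0 a : grpalg C) * grpalg_antip (delta_mx 0 b : grpalg C)))).
  rewrite linear_sum; apply: eq_bigr => a _; rewrite linear_sum.
  by apply: eq_bigr => b _; rewrite linearZ /= fM.
by rewrite antip_convr linearZ /= f1.
Qed.

Lemma grpalg_inclX y i : f (y ^+ i) = f y ^+ i.
Proof.
have [f1 fM] := grpalg_incl_is_monoid_morphism.
by elim: i => [|i IHi]; rewrite ?f1 // !exprS fM IHi.
Qed.

Lemma grpalg_incl0 : f 0 = 0. Proof. exact: linear0. Qed.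

End Inclusion.

(** * Base change of group algebras *)
Section BaseChangeMap.

Variables (K L : fieldType) (j : {rmorphism K -> L}) (H : finGroupScheme K).
Local Notation HL := (base_change j H).
Implicit Types x y : grpalg H.

Definition grpalg_ext x : grpalg HL := map_mx j x.

Lemma grpalg_extE x l : grpalg_ext x 0 l = j (x 0 l).
Proof. by rewrite mxE. Qed.

Fact grpalg_ext_is_zmod_morphism : zmod_morphism grpalg_ext.
Proof. by move=> x y; rewrite /grpalg_ext map_mxB. Qed.

Fact grpalg_ext_is_monoid_morphism : monoid_morphism grpalg_ext.
Proof.
split=> [|x y]; apply/rowP => l; rewrite grpalg_extE.
  by rewrite !grpalg_oneE.
rewrite !grpalg_mulE rmorph_sum; apply: eq_bigr => i _.
rewrite rmorph_sum; apply: eq_bigr => q _.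
by rewrite !rmorphM !grpalg_extE.
Qed.

HB.instance Definition _ := GRing.isZmodMorphism.Build (grpalg H) (grpalg HL)
  grpalg_ext grpalg_ext_is_zmod_morphism.
HB.instance Definition _ := GRing.isMonoidMorphism.Build (grpalg H) (grpalg HL)
  grpalg_ext grpalg_ext_is_monoid_morphism.

Lemma grpalg_extZ c x : grpalg_ext (c *: x) = j c *: grpalg_ext x.
Proof. exact: map_mxZ. Qed.

Lemma grpalg_ext_delta i :
  grpalg_ext (delta_mx 0 i : grpalg H) = (delta_mx 0 i : grpalg HL).
Proof. exact: map_delta_mx. Qed.

Lemma grpalg_ext_antip x : grpalg_antip (grpalg_ext x) = grpalg_ext (grpalg_antip x).
Proof.
apply/rowP => l; rewrite grpalg_extE !mxE rmorph_sum; apply: eq_bigr => i _.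
by rewrite rmorphM grpalg_extE.
Qed.

Lemma abelian_gs_ext : abelian_gs H -> abelian_gs HL.
Proof. by move=> aH l a b; rewrite /= aH. Qed.

Lemma unipotent_gs_ext : abelian_gs H -> unipotent_gs H -> unipotent_gs HL.
Proof.
move=> aH uH; apply: nilp_unipotent; first exact: abelian_gs_ext.
move=> y y0; rewrite [y]counit_expand y0 scale0r addr0.
apply: nilp_sum => [a b|i].
  by apply: (abelian_mulC (abelian_gs_ext aH)).
have [e ae] : exists e,
    ((delta_mx 0 i : grpalg H) - @gs_one K H i *: (1 : grpalg H)) ^+ e = 0.
  by apply: (unipotent_nilp aH uH); rewrite grpalg_counitB grpalg_counit_delta subrr.
exists e; rewrite exprZn.
have -> : (delta_mx 0 i : grpalg HL) - @gs_one L HL i *: (1 : grpalg HL) =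
    grpalg_ext ((delta_mx 0 i : grpalg H) - @gs_one K H i *: (1 : grpalg H)).
  by rewrite rmorphB /= grpalg_extZ rmorph1 grpalg_ext_delta.
by rewrite -rmorphXn ae rmorph0 scaler0.
Qed.

End BaseChangeMap.

Section CompositeBaseChange.

Variables (k K L : fieldType) (iota : {rmorphism k -> K}) (j : {rmorphism K -> L}).
Variable G : finGroupScheme k.
Local Notation GK := (base_change iota G).
Local Notation GL := (base_change (j \o iota) G).

(** A variant of [grpalg_ext]: the composite base change of [G] is convertible to
    the iterated one but has its own structures. *)
Definition grpalg_ext2 (x : grpalg GK) : grpalg GL := map_mx j x.

Fact grpalg_ext2_is_zmod_morphism : zmod_morphism grpalg_ext2.
Proof. by move=> x y; rewrite /grpalg_ext2 map_mxB. Qed.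

Fact grpalg_ext2_is_monoid_morphism : monoid_morphism grpalg_ext2.
Proof.
by have [e1 eM] := grpalg_ext_is_monoid_morphism j GK; split=> [|x y]; [exact: e1|exact: eM].
Qed.

HB.instance Definition _ := GRing.isZmodMorphism.Build (grpalg GK) (grpalg GL)
  grpalg_ext2 grpalg_ext2_is_zmod_morphism.
HB.instance Definition _ := GRing.isMonoidMorphism.Build (grpalg GK) (grpalg GL)
  grpalg_ext2 grpalg_ext2_is_monoid_morphism.

Lemma module_ext2 m (M : {lrmorphism grpalg G -> 'M[k]_m}) x :
  module_ext (j \o iota) M (grpalg_ext2 x) = map_mx j (module_ext iota M x).
Proof.
rewrite /module_ext map_mx_sum; apply: eq_bigr => i _.
by rewrite map_mxZ -map_mx_comp mxE.
Qed.

Lemma closed_embedding_ext (C : finGroupScheme K) (phi : 'M_(gs_dim GK, gs_dim C)) :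
  closed_embedding phi ->
  @closed_embedding L (base_change j C) GL (map_mx j phi).
Proof.
case=> fphi phiM phi1 phiD phie; split; first by rewrite row_full_map.
- move=> a b l; transitivity (j (\sum_q @gs_mul K GK a b q * phi q l)).
    by rewrite rmorph_sum; apply: eq_bigr => q _; rewrite rmorphM mxE.
  rewrite phiM; do 2![rewrite rmorph_sum; apply: eq_bigr => ? _].
  by rewrite !rmorphM !mxE.
- move=> l; rewrite -[RHS]/(j (@gs_one K C l)) -phi1 rmorph_sum.
  by apply: eq_bigr => q _; rewrite rmorphM mxE.
- move=> a u v; transitivity (j (\sum_l phi a l * @gs_comul K C l u v)).
    by rewrite rmorph_sum; apply: eq_bigr => q _; rewrite rmorphM mxE.
  rewrite phiD; do 2![rewrite rmorph_sum; apply: eq_bigr => ? _].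
  by rewrite !rmorphM !mxE.
- move=> a; rewrite -[RHS]/(j (@gs_counit K GK a)) -phie rmorph_sum.
  by apply: eq_bigr => q _; rewrite rmorphM mxE.
Qed.

Lemma grpalg_incl_ext (C : finGroupScheme K) (phi : 'M_(gs_dim GK, gs_dim C)) y :
  grpalg_ext2 (grpalg_incl phi y) =
  @grpalg_incl L (base_change j C) GL (map_mx j phi) (grpalg_ext j y).
Proof. by rewrite /grpalg_ext2 /grpalg_incl map_mxM map_trmx. Qed.

End CompositeBaseChange.

(** * The antipode on p-nilpotent elements *)
Lemma pchar_expr_sum (R : nzRingType) p I (s : seq I) (P : I -> R) :
    p \in [pchar R] -> (forall i j, GRing.comm (P i) (P j)) ->
  (\sum_(i <- s) P i) ^+ p = \sum_(i <- s) P i ^+ p.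
Proof.
move=> pR PC; elim: s => [|i s IHs].
  by rewrite !big_nil expr0n gtn_eqF // prime_gt0 //; case/andP: pR.
rewrite !big_cons -!(pFrobenius_autE pR) pFrobenius_autD_comm; last first.
  by apply: commr_sum => j _; apply: PC.
by rewrite [X in _ + X]pFrobenius_autE IHs.
Qed.

Lemma pchar_expr_sum_mx (F : fieldType) m p I (s : seq I) (P : I -> 'M[F]_m) :
    p \in [pchar F] -> (forall i j, P i *m P j = P j *m P i) ->
  (\sum_(i <- s) P i) ^+ p = \sum_(i <- s) P i ^+ p.
Proof.
case: m P => [|m] P pF PC; first by rewrite [LHS]flatmx0 [RHS]flatmx0.
by apply: pchar_expr_sum => //; rewrite pchar_lalg.
Qed.

Section TensorSquare.

Variables (F : fieldType) (C : finGroupScheme F).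
Local Notation n := (gs_dim C).
Local Notation FC := (grpalg C).
Local Notation e i := (delta_mx 0 i : FC).
Local Notation rho := (@regular_rep F C).
Implicit Types x y z : FC.

(** Multiplication by the element of FC (x) FC with coordinates [Th]. *)
Definition tens_op (Th : 'M[F]_n) : 'M[F]_(n * n) :=
  \sum_a \sum_b Th a b *: (rho (e a) *t rho (e b)).

Lemma tens_op_inj Th : tens_op Th = 0 -> Th = 0.
Proof.
move=> Th0; apply/matrixP => c d; rewrite mxE.
have: (tens_op Th *m ((1 : FC)^T *t (1 : FC)^T))
    (mxtens_index (c, d)) (mxtens_index (0, 0)) = 0.
  by rewrite Th0 mul0mx mxE.
rewrite /tens_op mulmx_suml summxE (bigD1 c) //= [X in _ + X]big1 ?addr0 => [|a ac]; last first.
  rewrite mulmx_suml summxE big1 // => b _.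
  rewrite -scalemxAl tensmx_mul mxE tensmxE !regular_repE !mulr1 !mxE /=.
  by rewrite eq_sym (negPf ac) mul0r mulr0.
rewrite mulmx_suml summxE (bigD1 d) //= big1 ?addr0 => [|b bd]; last first.
  rewrite -scalemxAl tensmx_mul mxE tensmxE !regular_repE !mulr1 !mxE /=.
  by rewrite (eq_sym d) (negPf bd) !mulr0.
by rewrite -scalemxAl tensmx_mul mxE tensmxE !regular_repE !mulr1 !mxE /= !eqxx !mulr1.
Qed.

Lemma tens_op_sum I (r : seq I) (Th : I -> 'M[F]_n) :
  tens_op (\sum_(i <- r) Th i) = \sum_(i <- r) tens_op (Th i).
Proof.
rewrite /tens_op [RHS]exchange_big; apply: eq_bigr => a _ /=.
rewrite [RHS]exchange_big; apply: eq_bigr => b _ /=.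
by rewrite summxE scaler_suml.
Qed.

Lemma tensmx_suml m q r s I (t : seq I) (A : I -> 'M[F]_(m, q)) (D : 'M[F]_(r, s)) :
  (\sum_(i <- t) A i) *t D = \sum_(i <- t) (A i *t D).
Proof.
apply/matrixP => i j; rewrite mxE !summxE mulr_suml.
by apply: eq_bigr => a _; rewrite mxE.
Qed.

Lemma tensmx_sumr m q r s I (t : seq I) (A : I -> 'M[F]_(m, q)) (D : 'M[F]_(r, s)) :
  D *t (\sum_(i <- t) A i) = \sum_(i <- t) (D *t A i).
Proof.
apply/matrixP => i j; rewrite mxE !summxE mulr_sumr.
by apply: eq_bigr => a _; rewrite mxE.
Qed.

Lemma tensmxZ m q r s a b (A : 'M[F]_(m, q)) (D : 'M[F]_(r, s)) :
  (a *: A) *t (b *: D) = (a * b) *: (A *t D).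
Proof. by apply/matrixP => i j; rewrite !mxE mulrACA. Qed.

Lemma regular_rep_expand x : rho x = \sum_i x 0 i *: rho (e i).
Proof.
by rewrite {1}[x]grpalg_rowE linear_sum; apply: eq_bigr => i _; rewrite linearZ.
Qed.

Lemma tens_rho x y :
  rho x *t rho y = \sum_a \sum_b (x 0 a * y 0 b) *: (rho (e a) *t rho (e b)).
Proof.
rewrite (regular_rep_expand x) tensmx_suml; apply: eq_bigr => a _.
rewrite (regular_rep_expand y) tensmx_sumr; apply: eq_bigr => b _.
exact: tensmxZ.
Qed.

Definition comul_mx x : 'M[F]_n := \matrix_(a, b) grpalg_comul x a b.

Lemma tens_opE x : tens_op (comul_mx x) =
  \sum_a \sum_b grpalg_comul x a b *: (rho (e a) *t rho (e b)).
Proof. by do 2![apply: eq_bigr => ? _]; rewrite mxE. Qed.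

Lemma comul_mx_expand x : comul_mx x = \sum_i x 0 i *: comul_mx (e i).
Proof.
apply/matrixP => a b; rewrite mxE summxE {1}[x]grpalg_rowE grpalg_comul_sum.
by apply: eq_bigr => i _; rewrite grpalg_comulZ !mxE.
Qed.

Lemma tens_opZ c Th : tens_op (c *: Th) = c *: tens_op Th.
Proof.
rewrite /tens_op scaler_sumr; apply: eq_bigr => a _; rewrite scaler_sumr.
by apply: eq_bigr => b _; rewrite mxE scalerA.
Qed.

(** The coproduct is a morphism of algebras. *)
Lemma tens_op_comulM x y :
  tens_op (comul_mx (x * y)) = tens_op (comul_mx x) *m tens_op (comul_mx y).
Proof.
have basis i j : tens_op (comul_mx (e i * e j)) =
    tens_op (comul_mx (e i)) *m tens_op (comul_mx (e j)).
  rewrite !tens_opE mulmx_suml.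
  under [RHS]eq_bigr do rewrite mulmx_suml.
  transitivity (\sum_a \sum_b \sum_c \sum_d
     (grpalg_comul (e i) a b * grpalg_comul (e j) c d) *:
     (rho (e a * e c) *t rho (e b * e d))); last first.
    apply: eq_bigr => a _; apply: eq_bigr => b _.
    rewrite -scalemxAl mulmx_sumr scaler_sumr; apply: eq_bigr => c _.
    rewrite mulmx_sumr scaler_sumr; apply: eq_bigr => d _.
    by rewrite -scalemxAr tensmx_mul scalerA !rmorphM.
  under eq_bigr do under eq_bigr do rewrite grpalg_comulM.
  under [RHS]eq_bigr do under eq_bigr do under eq_bigr do under eq_bigr do
    rewrite tens_rho scaler_sumr.
  under [LHS]eq_bigr do under eq_bigr do rewrite scaler_suml.
  under [LHS]eq_bigr do rewrite exchange_big /=.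
  rewrite [LHS]exchange_big /=; apply: eq_bigr => a _.
  under [LHS]eq_bigr do under eq_bigr do rewrite scaler_suml.
  under [LHS]eq_bigr do rewrite exchange_big /=.
  rewrite [LHS]exchange_big /=; apply: eq_bigr => b _.
  under [LHS]eq_bigr do under eq_bigr do rewrite scaler_suml.
  under [LHS]eq_bigr do rewrite exchange_big /=.
  rewrite [LHS]exchange_big /=; apply: eq_bigr => c _.
  under [LHS]eq_bigr do under eq_bigr do rewrite scaler_suml.
  under [LHS]eq_bigr do rewrite exchange_big /=.
  rewrite [LHS]exchange_big /=; apply: eq_bigr => d _.
  apply: eq_bigr => s _; rewrite scaler_sumr; apply: eq_bigr => t _.
  by rewrite scalerA.
have -> : x * y = \sum_i \sum_j (x 0 i * y 0 j) *: (e i * e j).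
  rewrite {1}[x]grpalg_rowE {1}[y]grpalg_rowE mulr_suml; apply: eq_bigr => i _.
  rewrite mulr_sumr; apply: eq_bigr => j _.
  by rewrite -scalerAl -scalerAr scalerA.
have comul_sum I (r : seq I) (P : I -> FC) :
    comul_mx (\sum_(i <- r) P i) = \sum_(i <- r) comul_mx (P i).
  apply/matrixP => a b; rewrite mxE grpalg_comul_sum summxE.
  by apply: eq_bigr => i _; rewrite mxE.
have comulZ c w : comul_mx (c *: w) = c *: comul_mx w.
  by apply/matrixP => a b; rewrite !mxE grpalg_comulZ.
rewrite comul_sum tens_op_sum (comul_mx_expand x) tens_op_sum mulmx_suml.
apply: eq_bigr => i _; rewrite comul_sum tens_op_sum (comul_mx_expand y) tens_op_sum.
rewrite mulmx_sumr; apply: eq_bigr => j _.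
by rewrite comulZ !tens_opZ basis -scalemxAl -scalemxAr scalerA.
Qed.

Variable p : nat.
Hypotheses (pF : p \in [pchar F]) (aC : abelian_gs C).

(** The p-th power map of FC, made linear by twisting its source with the
    Frobenius endomorphism of F. *)
Definition pth_power_mx : 'M[F]_n := \matrix_(i, l) (e i ^+ p) 0 l.

(** The p-th power of the coproduct of z is zero, and the p-th power map is
    additive on the commutative algebra FC (x) FC. *)
Lemma comul_nilp z : z ^+ p = 0 ->
  pth_power_mx^T *m map_mx (pFrobenius_aut pF) (comul_mx z) *m pth_power_mx = 0.
Proof.
move=> zp; apply: tens_op_inj.
have p0 : (0 < p)%N by apply: prime_gt0; case/andP: pF.
have tzp : tens_op (comul_mx z) ^+ p = 0.
  have tzi i : tens_op (comul_mx z) ^+ i.+1 = tens_op (comul_mx (z ^+ i.+1)).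
    elim: i => [|i IHi]; first by rewrite !expr1.
    by rewrite exprS IHi -[LHS]tens_op_comulM -exprS.
  rewrite -(prednK p0) tzi prednK // zp.
  have -> : comul_mx 0 = 0 by rewrite comul_mx_expand big1 // => i _; rewrite mxE scale0r.
  by have := tens_opZ 0 0; rewrite !scale0r.
have rhoC a b : rho (e a) *m rho (e b) = rho (e b) *m rho (e a).
  by rewrite -![_ *m _]/(_ * _) -!rmorphM (abelian_mulC aC).
have tX (A B : 'M[F]_n) i : (A *t B) ^+ i.+1 = A ^+ i.+1 *t B ^+ i.+1.
  elim: i => [|i IHi]; first by rewrite !expr1.
  by rewrite exprS IHi [LHS]tensmx_mul (exprS A i.+1) (exprS B i.+1).
have ZX c (A : 'M[F]_(n * n)) i : (c *: A) ^+ i = c ^+ i *: A ^+ i.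
  elim: i => [|i IHi]; first by rewrite !expr0 scale1r.
  by rewrite !exprS IHi -![_ * _]/(_ *m _) -scalemxAl -scalemxAr scalerA.
pose X a b := grpalg_comul z a b *: (rho (e a) *t rho (e b)).
have XC a b c d : X a b *m X c d = X c d *m X a b.
  rewrite /X -!scalemxAl -!scalemxAr !tensmx_mul !scalerA mulrC.
  by rewrite (rhoC a) (rhoC b).
have XX a b : X a b ^+ p = \sum_c \sum_d (grpalg_comul z a b ^+ p *
    (pth_power_mx a c * pth_power_mx b d)) *: (rho (e c) *t rho (e d)).
  rewrite /X ZX -{2}(prednK p0) tX prednK // -!rmorphXn /= tens_rho scaler_sumr.
  apply: eq_bigr => c _; rewrite scaler_sumr; apply: eq_bigr => d _.
  by rewrite scalerA !mxE.
transitivity (\sum_a \sum_b X a b ^+ p).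
  under [RHS]eq_bigr do under eq_bigr do rewrite XX.
  under [RHS]eq_bigr do rewrite exchange_big /=.
  rewrite [RHS]exchange_big /=; apply: eq_bigr => c _.
  under [RHS]eq_bigr do rewrite exchange_big /=.
  rewrite [RHS]exchange_big /=; apply: eq_bigr => d _.
  under [RHS]eq_bigr do rewrite -scaler_suml.
  rewrite -scaler_suml; congr (_ *: _).
  rewrite mxE exchange_big; apply: eq_bigr => b _ /=.
  rewrite mxE mulr_suml; apply: eq_bigr => a _.
  rewrite [_^T _ _]mxE [map_mx _ _ _ _]mxE [comul_mx _ _ _]mxE.
  by rewrite [pFrobenius_aut _ _]pFrobenius_autE; ring.
rewrite -[RHS]tzp tens_opE -[RHS]/((\sum_a \sum_b X a b) ^+ p).
rewrite pchar_expr_sum_mx // => [|a c]; last first.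
  rewrite mulmx_suml mulmx_sumr; apply: eq_bigr => b _.
  by rewrite mulmx_sumr mulmx_suml; apply: eq_bigr => d _; apply: XC.
by apply: eq_bigr => a _; rewrite pchar_expr_sum_mx // => b d; apply: XC.
Qed.

End TensorSquare.

Lemma grpalg_counitX (F : fieldType) (H : finGroupScheme F) (x : grpalg H) i :
  grpalg_counit (x ^+ i) = grpalg_counit x ^+ i.
Proof.
elim: i => [|i IHi]; first by rewrite expr0 grpalg_counit1.
by rewrite !exprS grpalg_counitM IHi.
Qed.

Section FrobeniusTwist.

Variables (K : fieldType) (p : nat) (pK : p \in [pchar K]).
Variable C : finGroupScheme K.
Hypotheses (aC : abelian_gs C) (uC : unipotent_gs C).
Local Notation n := (gs_dim C).
Local Notation frob := (pFrobenius_aut pK).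
Local Notation CL := (base_change frob C).
Local Notation LC := (grpalg CL).
Local Notation e i := (delta_mx 0 i : LC).
Local Notation PM := (pth_power_mx C p).

Let aCL : abelian_gs CL.
Proof. exact: abelian_gs_ext. Qed.

Let mulLC (x y : LC) : x * y = y * x.
Proof. exact: abelian_mulC. Qed.

Lemma pth_powerE (x : LC) : x ^+ p = map_mx frob (x *m PM).
Proof.
have pLC : p \in [pchar LC] by rewrite pchar_lalg.
rewrite {1}[x]grpalg_rowE pchar_expr_sum //; last by move=> i j; apply: mulLC.
rewrite mulmx_sum_row map_mx_sum; apply: eq_bigr => i _.
rewrite exprZn map_mxZ; congr (_ *: _).
rewrite -(@grpalg_ext_delta _ _ frob C) -rmorphXn /=; congr map_mx.
by apply/rowP => l; rewrite !mxE.
Qed.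

Lemma pth_power_eq0 (x : LC) : x *m PM = 0 -> x ^+ p = 0.
Proof. by rewrite pth_powerE => ->; rewrite map_mx0. Qed.

(** The element S z + z is, up to sign, the image under a (x) b |-> S(a) b of the
    component of the coproduct of z in the tensor square of the augmentation ideal.
    Let N be the ideal of p-nilpotent elements of LC. By [comul_nilp] the coproduct
    of z is in N (x) LC + LC (x) N, and so S z + z is a sum of products of a
    p-nilpotent element and an element of the augmentation ideal.

    The field L is K, an extension of itself through the Frobenius endomorphism:
    p-th roots are needed for the kernel of the p-th power map on LC (x) LC to be
    N (x) LC + LC (x) N. *)
Lemma antip_induction (z : grpalg C) (Q : LC -> Prop) :
    z ^+ p = 0 -> Q (- grpalg_ext frob z) ->
    (forall v x y, Q v -> x ^+ p = 0 -> (exists d, y ^+ d = 0) -> Q (v + x * y)) ->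
  Q (grpalg_antip (grpalg_ext frob z)).
Proof.
move=> zp Q0 Qstep; set zL := grpalg_ext frob z.
have p0 : (0 < p)%N by apply: prime_gt0; case/andP: pK.
have nil x : grpalg_counit x = 0 -> exists d, (x : LC) ^+ d = 0.
  by apply: (unipotent_nilp aCL); apply: unipotent_gs_ext.
have nil_counit (x : LC) : x ^+ p = 0 -> grpalg_counit x = 0.
  move=> xp; have : grpalg_counit x ^+ p = 0.
    by rewrite -grpalg_counitX xp /grpalg_counit big1 // => i _; rewrite mxE mul0r.
  by move/eqP; rewrite expf_eq0 p0 => /eqP.
have zLp : zL ^+ p = 0 by rewrite /zL -rmorphXn zp rmorph0.
have zL0 := nil_counit _ zLp.
pose Th : 'M[K]_n := \matrix_(a, b) grpalg_comul zL a b.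
have ThE : Th = map_mx frob (comul_mx z).
  apply/matrixP => a b; rewrite !mxE rmorph_sum; apply: eq_bigr => l _.
  by rewrite rmorphM grpalg_extE.
have FThF : PM^T *m Th *m PM = 0 by rewrite ThE comul_nilp.
(* the projection onto the augmentation ideal *)
pose bar (x : LC) : LC := x - grpalg_counit x *: 1.
have bar0 x : grpalg_counit (bar x) = 0 by rewrite grpalg_counitB subrr.
(* [1 - Pi] projects onto the kernel of [PM], that is, onto N. *)
pose Pi := PM *m pinvmx PM.
have PiTh : Pi^T *m Th *m Pi = 0.
  rewrite /Pi trmx_mul -!mulmxA [PM^T *m _]mulmxA [_ *m (PM *m _)]mulmxA.
  by rewrite FThF mul0mx mulmx0.
pose nn a : LC := row a (1%:M - Pi).
pose q a : LC := row a Pi.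
have nnp a : nn a ^+ p = 0.
  by apply: pth_power_eq0; rewrite -row_mul mulmxBl mul1mx mulmxKpV // subrr row0.
have edec a : e a = nn a + q a.
  by rewrite /nn /q -linearD /= subrK rowE mulmx1.
pose beta (x y : LC) : LC := grpalg_antip (bar x) * bar y.
have barD x y : bar (x + y) = bar x + bar y.
  have cD : grpalg_counit (x + y) = grpalg_counit x + grpalg_counit y.
    by rewrite /grpalg_counit -big_split; apply: eq_bigr => i _; rewrite mxE mulrDl.
  by rewrite /bar [X in _ - X *: _]cD scalerDl opprD addrACA.
have betaDl x y w : beta (x + y) w = beta x w + beta y w.
  by rewrite /beta barD linearD mulrDl.
have betaDr x y w : beta w (x + y) = beta w x + beta w y.
  by rewrite /beta barD mulrDr.
have bar_expand x : bar x = \sum_c x 0 c *: bar (e c).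
  rewrite /bar {1}[x]grpalg_rowE; under [RHS]eq_bigr do rewrite scalerBr scalerA.
  rewrite sumrB -scaler_suml; congr (_ - _ *: _).
  by apply: eq_bigr => c _; rewrite grpalg_counit_delta.
have beta_expand x y : beta x y = \sum_c \sum_d (x 0 c * y 0 d) *: beta (e c) (e d).
  rewrite /beta (bar_expand x) linear_sum mulr_suml; apply: eq_bigr => c _.
  rewrite (bar_expand y) mulr_sumr; apply: eq_bigr => d _.
  by rewrite linearZ -scalerAl -scalerAr scalerA.
(* Only the terms S(z) and z survive in the expansion, by the antipode and counit
   axioms. *)
have sum_beta : \sum_a \sum_b Th a b *: beta (e a) (e b) = - (grpalg_antip zL + zL).
  have betaE a b : Th a b *: beta (e a) (e b) =
      grpalg_comul zL a b *: (grpalg_antip (e a) * e b)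
      - (grpalg_comul zL a b * grpalg_counit (e b)) *: grpalg_antip (e a)
      - ((grpalg_comul zL a b * grpalg_counit (e a)) *: e b
        - (grpalg_comul zL a b * grpalg_counit (e b)) *: (grpalg_counit (e a) *: 1)).
    rewrite mxE /beta /bar linearB linearZ /= grpalg_antip1.
    rewrite mulrBl mulrBr -!scalerAl !mul1r -!scalerAr mulr1 !scalerBr !scalerA.
    by rewrite mulrAC.
  under eq_bigr do under eq_bigr do rewrite betaE.
  under eq_bigr do rewrite !sumrB.
  rewrite !sumrB grpalg_antip_lawl zL0 scale0r.
  rewrite (grpalg_comul_counitr (fun x : LC => grpalg_antip x)) -grpalg_antipE.
  rewrite (grpalg_comul_counitl (fun x : LC => x)) -grpalg_rowE.
  rewrite (grpalg_comul_counitr (fun x : LC => grpalg_counit x *: 1)).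
  have -> : \sum_a zL 0 a *: (grpalg_counit (e a) *: 1) = (grpalg_counit zL *: 1 : LC).
    rewrite /grpalg_counit scaler_suml; apply: eq_bigr => a _.
    by rewrite -grpalg_counit_delta scalerA.
  by rewrite zL0 scale0r subr0 sub0r opprD.
have sum_q : \sum_a \sum_b Th a b *: beta (q a) (q b) = 0.
  transitivity (\sum_c \sum_d (Pi^T *m Th *m Pi) c d *: beta (e c) (e d)); last first.
    by rewrite big1 // => c _; rewrite big1 // => d _; rewrite PiTh mxE scale0r.
  under eq_bigr do under eq_bigr do rewrite beta_expand scaler_sumr.
  under eq_bigr do rewrite exchange_big /=.
  rewrite exchange_big /=; apply: eq_bigr => c _.
  under eq_bigr do under eq_bigr do rewrite scaler_sumr.
  under eq_bigr do rewrite exchange_big /=.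
  rewrite exchange_big /=; apply: eq_bigr => d _.
  under eq_bigr do under eq_bigr do rewrite scalerA.
  under eq_bigr do rewrite -scaler_suml.
  rewrite -scaler_suml; congr (_ *: _).
  rewrite [RHS]mxE exchange_big; apply: eq_bigr => b _ /=.
  rewrite [(_ *m Th) _ _]mxE mulr_suml; apply: eq_bigr => a _.
  by rewrite [_^T _ _]mxE [q a _ _]mxE [q b _ _]mxE; ring.
have barnn a : bar (nn a) = nn a.
  by rewrite /bar (nil_counit _ (nnp a)) scale0r subr0.
have -> : grpalg_antip zL = - zL +
   (\sum_a \sum_b (Th a b *: - grpalg_antip (nn a)) * bar (e b) +
    \sum_a \sum_b nn b * (Th a b *: - grpalg_antip (bar (q a)))).
  apply: (addIr zL); rewrite addrAC addNr add0r -[LHS]opprK -sum_beta.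
  have betaE a b : Th a b *: beta (e a) (e b) = Th a b *: beta (q a) (q b)
      - ((Th a b *: - grpalg_antip (nn a)) * bar (e b)
         + nn b * (Th a b *: - grpalg_antip (bar (q a)))).
    have -> : (Th a b *: - grpalg_antip (nn a)) * bar (e b) =
        - (Th a b *: beta (nn a) (e b)).
      by rewrite scalerN mulNr -scalerAl /beta barnn.
    have -> : nn b * (Th a b *: - grpalg_antip (bar (q a))) =
        - (Th a b *: beta (q a) (nn b)).
      by rewrite scalerN mulrN -scalerAr /beta barnn mulLC.
    rewrite -opprD opprK -!scalerDr; congr (_ *: _).
    by rewrite {1}(edec a) betaDl {2}(edec b) betaDr addrA addrC.
  under eq_bigr do under eq_bigr do rewrite betaE.
  under eq_bigr do rewrite sumrB big_split /=.
  by rewrite sumrB big_split /= sum_q sub0r opprK.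
have Qsum (I : finType) (P P' : I -> LC) v : Q v -> (forall i, P i ^+ p = 0) ->
    (forall i, exists d, P' i ^+ d = 0) -> Q (v + \sum_i P i * P' i).
  move=> Qv Pp P'd; elim: (index_enum I) => [|i s IHs]; first by rewrite big_nil addr0.
  by rewrite big_cons addrA addrAC; apply: Qstep.
rewrite addrA !pair_bigA /=; apply: (Qsum _ (fun u => nn u.2)) => [|u|u].
- apply: (Qsum _ (fun u => Th u.1 u.2 *: - grpalg_antip (nn u.1))) => [//|u|u].
    by rewrite exprZn exprNn -grpalg_antipX nnp linear0 mulr0 scaler0.
  exact/nil/bar0.
- exact: nnp.
have [d qd] := nil _ (bar0 (q u.1)); exists d.
by rewrite exprZn exprNn -grpalg_antipX qd linear0 mulr0 scaler0.
Qed.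

End FrobeniusTwist.

(** * Jordan types at pi-points *)
Section PiPoints.

Variables (p : nat) (k : fieldType).
Hypothesis hp : p \in [pchar k].
Variable G : finGroupScheme k.

Let p_gt0 : (0 < p)%N.
Proof. by apply: prime_gt0; case/andP: hp. Qed.

Let pchar_ext (K : fieldType) (iota : {rmorphism k -> K}) : p \in [pchar K].
Proof. by rewrite (fmorph_pchar iota). Qed.

Local Notation reg := (@regular_rep k G).

Definition elt_rank (K : fieldType) (iota : {rmorphism k -> K}) m
    (M : {lrmorphism grpalg G -> 'M[k]_m}) (v : grpalg (base_change iota G))
    (j : nat) : nat :=
  \rank (module_ext iota M v ^+ j).

Definition pi_rank (alpha : pi_point p G) m
    (M : {lrmorphism grpalg G -> 'M[k]_m}) (j : nat) : nat :=
  elt_rank M (pi_map alpha 'qX) j.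

Lemma pi_restrict_nilp (alpha : pi_point p G) m
    (N : {lrmorphism grpalg (base_change (pi_ext alpha) G)
            -> 'M[pi_field alpha]_m}) :
  pi_restrict alpha N 'qX ^+ p = 0.
Proof. by rewrite -rmorphXn trunc_gen_nilp // rmorph0. Qed.

(** Jordan types exist and the ranks that compare them do not depend on the
    field. *)
Lemma maximal_rankP m (M : {lrmorphism grpalg G -> 'M[k]_m}) alpha :
  maximal_jordan_type M alpha <->
  forall beta : pi_point p G,
    (forall j, (0 < j < p)%N -> (pi_rank alpha M j <= pi_rank beta M j)%N) ->
    (forall j, (0 < j < p)%N -> (pi_rank beta M j <= pi_rank alpha M j)%N).
Proof.
have rkE beta b j :
    has_jordan_type (pi_restrict beta (module_ext (pi_ext beta) M)) b ->
    \rank (jordan_mx k b ^+ j) = pi_rank beta M j.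
  move/(has_jordan_type_rank j).
  by rewrite (rank_jordan_mx_map (pi_ext beta)) => <-.
have typed beta :=
  has_jordan_type_exists (pi_restrict_nilp (module_ext (pi_ext beta) M)).
split=> [max beta le_ab j jp | max a ta [beta [b [tb [ge_ba [j jp]]]]]].
  have [[a ta] [b tb]] := (typed alpha, typed beta).
  rewrite leqNgt; apply/negP => lt_ab; apply: (max a ta); exists beta, b.
  split=> //; split=> [i ip|].
    by rewrite (rkE _ _ _ ta) (rkE _ _ _ tb) le_ab.
  by exists j => //; rewrite (rkE _ _ _ ta) (rkE _ _ _ tb).
rewrite ltnNge (rkE _ _ _ ta) (rkE _ _ _ tb) max // => i ip.
by rewrite -(rkE _ _ _ ta) -(rkE _ _ _ tb) ge_ba.
Qed.

(** For p-nilpotent [v] this is the flatness of t |-> v, by [flat_rank] and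
    [rank_flat]. *)
Definition flat_elt (K : fieldType) (iota : {rmorphism k -> K})
    (v : grpalg (base_change iota G)) : Prop :=
  (gs_dim G <= elt_rank reg v 1 + elt_rank reg v p.-1)%N.

Lemma elt_rank_reg (K : fieldType) (iota : {rmorphism k -> K})
    (v : grpalg (base_change iota G)) j :
  elt_rank reg v j = \rank (regular_rep v ^+ j).
Proof. by rewrite /elt_rank regular_rep_ext. Qed.

Lemma point_of_elt (K : fieldType) (iota : {rmorphism k -> K})
    (C : finGroupScheme K)
    (phi : 'M_(gs_dim (base_change iota G), gs_dim C)) (z : grpalg C) :
    closed_embedding phi -> unipotent_gs C -> abelian_gs C -> z ^+ p = 0 ->
    flat_elt (grpalg_incl phi z) ->
  exists beta : pi_point p G, forall m (M : {lrmorphism grpalg G -> 'M[k]_m}) j,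
    pi_rank beta M j = elt_rank M (grpalg_incl phi z) j.
Proof.
move=> emb uC aC zp flat_z.
have [f1 fM] := grpalg_incl_is_monoid_morphism emb.
have up : grpalg_incl phi z ^+ p = 0.
  by rewrite -(grpalg_inclX emb) zp grpalg_incl0.
pose f : {lrmorphism trunc_poly K p -> grpalg (base_change iota G)} :=
  trunc_eval p_gt0 up.
have flat_f : left_flat f.
  apply: rank_flat => //; rewrite [f 'qX]trunc_eval_gen rmorphXn.
  by move: flat_z; rewrite /flat_elt !elt_rank_reg expr1.
have factor : exists (D : finGroupScheme K)
      (psi : 'M_(gs_dim (base_change iota G), gs_dim D)),
    [/\ closed_embedding psi, unipotent_gs D, abelian_gs D
      & forall r, exists y : grpalg D, f r = grpalg_incl psi y].
  exists C, phi; split=> // r; elim/trunc_ind: r => [|r c [y IHr]].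
    by exists 0; rewrite rmorph0 grpalg_incl0.
  exists (c *: 1 + y * z); rewrite grpalg_incl_is_linear fM f1 -IHr addrC.
  by rewrite rmorphD rmorphM /= trunc_eval_gen linearZ /= rmorph1.
exists (PiPoint flat_f factor) => m M j.
by rewrite /pi_rank /= [trunc_eval _ _ _]trunc_eval_gen.
Qed.

Lemma elt_of_point (alpha : pi_point p G) :
  exists (C : finGroupScheme (pi_field alpha))
      (phi : 'M_(gs_dim (base_change (pi_ext alpha) G), gs_dim C))
      (z : grpalg C),
  [/\ closed_embedding phi, unipotent_gs C, abelian_gs C,
      z ^+ p = 0 /\ pi_map alpha 'qX = grpalg_incl phi z
    & flat_elt (grpalg_incl phi z)].
Proof.
have [C [phi [emb uC aC fac]]] := pi_factor alpha.
have [z defz] := fac 'qX; exists C, phi, z; split=> //.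
  split=> //; apply: (grpalg_incl_inj emb); rewrite (grpalg_inclX emb) -defz.
  by rewrite -rmorphXn trunc_gen_nilp // rmorph0 grpalg_incl0.
have := flat_rank p_gt0 (@pi_flat _ _ _ alpha).
by rewrite -defz /flat_elt !elt_rank_reg expr1 rmorphXn.
Qed.

Section Pencil.

Variables (K : fieldType) (iota : {rmorphism k -> K}) (C : finGroupScheme K).
Variable phi : 'M[K]_(gs_dim (base_change iota G), gs_dim C).
Hypotheses (emb : closed_embedding phi).
Hypotheses (uC : unipotent_gs C) (aC : abelian_gs C).
Variables u x y : grpalg C.
Hypotheses (up : u ^+ p = 0) (xp : x ^+ p = 0) (yn : exists e, y ^+ e = 0).
Local Notation f := (grpalg_incl phi).
Hypothesis flat_u : flat_elt (f u).

Local Notation FF := {fraction {poly K}}.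
Local Notation toF := (@tofrac {poly K} \o polyC : {rmorphism K -> FF}).
Local Notation PC := (map_mx polyC).

Let pencil m (M : {lrmorphism grpalg G -> 'M[k]_m}) : 'M[{poly K}]_m :=
  PC (module_ext iota M (f u)) + 'X *: PC (module_ext iota M (f x)).

(** The generic element u + s x of the pencil. *)
Let w : grpalg (base_change toF C) :=
  grpalg_ext toF u + tofrac 'X *: grpalg_ext toF x.

Let phiF : 'M[FF]_(gs_dim (base_change (toF \o iota) G),
                   gs_dim (base_change toF C)) :=
  map_mx toF phi.

Let embF : closed_embedding phiF.
Proof. exact: closed_embedding_ext. Qed.

Let generic_rank m (M : {lrmorphism grpalg G -> 'M[k]_m}) j : nat :=
  elt_rank M (grpalg_incl phiF w) j.

Let generic_rankE m (M : {lrmorphism grpalg G -> 'M[k]_m}) j :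
  generic_rank M j = \rank (map_mx (@tofrac {poly K}) (pencil M ^+ j)).
Proof.
rewrite /generic_rank /elt_rank /w addrC grpalg_incl_is_linear /phiF.
rewrite -!grpalg_incl_ext linearP /= !module_ext2 map_mx_expr.
by rewrite /pencil map_mxD map_mxZ addrC -!map_mx_comp.
Qed.

Let rank_le_generic m (M : {lrmorphism grpalg G -> 'M[k]_m}) j :
  (elt_rank M (f u) j <= generic_rank M j)%N.
Proof.
rewrite generic_rankE /elt_rank.
suff -> : module_ext iota M (f u) ^+ j =
    map_mx (horner_eval (0 : K)) (pencil M ^+ j) by exact: rank_eval0.
rewrite map_mx_expr /pencil map_mxD map_mxZ !map_ev0C.
by rewrite /= /horner_eval hornerX scale0r addr0.
Qed.

Let wp : w ^+ p = 0.
Proof.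
have pF : p \in [pchar grpalg (base_change toF C)].
  by rewrite pchar_lalg (pchar_ext (toF \o iota)).
rewrite -(pFrobenius_autE pF) pFrobenius_autD_comm; last first.
  by apply: abelian_mulC; apply: abelian_gs_ext.
by rewrite !pFrobenius_autE exprZn -!rmorphXn up xp !rmorph0 scaler0 addr0.
Qed.

Let generic_flat : flat_elt (grpalg_incl phiF w).
Proof. by apply: leq_trans flat_u _; rewrite leq_add // rank_le_generic. Qed.

Let generic_point : exists beta : pi_point p G,
  forall m (M : {lrmorphism grpalg G -> 'M[k]_m}) j,
    pi_rank beta M j = generic_rank M j.
Proof.
apply: (point_of_elt embF _ _ wp generic_flat); first exact: unipotent_gs_ext.
exact: abelian_gs_ext.
Qed.

Lemma pencil_le m (M : {lrmorphism grpalg G -> 'M[k]_m}) j :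
    (generic_rank M j <= elt_rank M (f u) j)%N ->
  (elt_rank M (f u) j <= elt_rank M (f (u + x * y)%R) j)%N.
Proof.
rewrite generic_rankE /elt_rank; have [e ye] := yn.
have [f1 fM] := grpalg_incl_is_monoid_morphism emb.
have -> : module_ext iota M (f (u + x * y)) = module_ext iota M (f u) +
    module_ext iota M (f x) *m module_ext iota M (f y).
  by rewrite -[_ *m _]rmorphM -fM linearD linearD.
have MC (a b : grpalg C) : module_ext iota M (f a) *m module_ext iota M (f b) =
    module_ext iota M (f b) *m module_ext iota M (f a).
  by rewrite -![_ *m _]/(_ * _) -!rmorphM -!fM (abelian_mulC aC).
apply: (rank_nilpotent_subst (e := e) (pchar_ext iota)) => //.
by rewrite -rmorphXn -(grpalg_inclX emb) ye grpalg_incl0 rmorph0.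
Qed.

(** The left-hand side of the inequality in [flat_elt] bounds the right-hand side
    at every p-nilpotent element. So the flat element u has the generic ranks of
    the pencil on the regular representation, and [pencil_le] applies to it. *)
Lemma flat_pencil : flat_elt (f (u + x * y)).
Proof.
have gen : (generic_rank reg 1 + generic_rank reg p.-1 <= gs_dim G)%N.
  rewrite /generic_rank !elt_rank_reg expr1 addnC; apply: mulmx0_rank_max.
  rewrite -[_ *m _]exprSr prednK // -rmorphXn -[in LHS](grpalg_inclX embF).
  by rewrite wp grpalg_incl0 rmorph0.
have ge1 := rank_le_generic reg 1; have gep := rank_le_generic reg p.-1.
have le1 : (generic_rank reg 1 <= elt_rank reg (f u) 1)%N.
  rewrite -(leq_add2r (generic_rank reg p.-1)) (leq_trans gen) //.
  by rewrite (leq_trans flat_u) // leq_add2l.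
have lep : (generic_rank reg p.-1 <= elt_rank reg (f u) p.-1)%N.
  rewrite -(leq_add2l (generic_rank reg 1)) (leq_trans gen) //.
  by rewrite (leq_trans flat_u) // leq_add2r.
exact: leq_trans flat_u (leq_add (pencil_le le1) (pencil_le lep)).
Qed.

Lemma pencil_nilp : (u + x * y) ^+ p = 0.
Proof.
have pC : p \in [pchar grpalg C] by rewrite pchar_lalg pchar_ext.
have mulC := abelian_mulC aC.
rewrite -(pFrobenius_autE pC) pFrobenius_autD_comm; last exact: mulC.
rewrite !pFrobenius_autE exprMn_comm; last exact: mulC.
by rewrite up xp mul0r addr0.
Qed.

(** The generic element of the pencil has ranks at least those of u, so the same
    ranks by maximality, and [pencil_le] bounds the ranks of u + x y below. They
    are bounded above by maximality again, u + x y being a pi-point. *)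
Lemma pencil_rank m (M : {lrmorphism grpalg G -> 'M[k]_m}) :
    (forall beta : pi_point p G,
      (forall j, (0 < j < p)%N -> (elt_rank M (f u) j <= pi_rank beta M j)%N) ->
      forall j, (0 < j < p)%N -> (pi_rank beta M j <= elt_rank M (f u) j)%N) ->
  forall j, (0 < j < p)%N ->
    elt_rank M (f (u + x * y)) j = elt_rank M (f u) j.
Proof.
move=> max; have le j : (0 < j < p)%N ->
    (elt_rank M (f u) j <= elt_rank M (f (u + x * y)%R) j)%N.
  move=> jp; apply: pencil_le; have [beta rk_beta] := generic_point.
  by rewrite -rk_beta max // => i _; rewrite rk_beta rank_le_generic.
move=> j jp; apply/eqP; rewrite eqn_leq le // andbT.
have [beta rk_beta] := point_of_elt emb uC aC pencil_nilp flat_pencil.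
by rewrite -rk_beta max // => i ip; rewrite rk_beta le.
Qed.

End Pencil.

Lemma elt_rank_dual m (M : {lrmorphism grpalg G -> 'M[k]_m}) (K : fieldType)
    (iota : {rmorphism k -> K}) (v : grpalg (base_change iota G)) j :
  elt_rank (grpalg_dual M) v j = elt_rank M (grpalg_antip v) j.
Proof.
by rewrite /elt_rank -grpalg_dual_ext /grpalg_dual -trmx_expr mxrank_tr.
Qed.

(** The pi-point is the composite of alpha with the antipode. Over the Frobenius
    extension of K, the antipode of z is obtained from - z by adding products to
    which [flat_pencil] and [pencil_rank] apply; ranks are not changed by the
    extension. *)
Lemma antip_point (alpha : pi_point p G) :
  exists2 beta : pi_point p G,
    forall m (M : {lrmorphism grpalg G -> 'M[k]_m}) j,
      pi_rank beta M j = pi_rank alpha (grpalg_dual M) j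
  & forall m (M : {lrmorphism grpalg G -> 'M[k]_m}),
      maximal_jordan_type M alpha ->
      forall j, (0 < j < p)%N -> pi_rank beta M j = pi_rank alpha M j.
Proof.
have [C [phi [z [emb uC aC [zp defz] flat_z]]]] := elt_of_point alpha.
set K := pi_field alpha in C phi z emb uC aC zp defz flat_z *.
set iota := pi_ext alpha in phi emb defz flat_z *.
pose frob : {rmorphism K -> K} := pFrobenius_aut (pchar_ext iota).
pose CL := base_change frob C; pose zL := grpalg_ext frob z.
pose phiL : 'M_(gs_dim (base_change (frob \o iota) G), gs_dim CL) :=
  map_mx frob phi.
pose fL := grpalg_incl phiL.
have embL : closed_embedding phiL by exact: closed_embedding_ext.
have uCL : unipotent_gs CL by exact: unipotent_gs_ext.
have aCL : abelian_gs CL by exact: abelian_gs_ext.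
have rk_ext m (M : {lrmorphism grpalg G -> 'M[k]_m}) (y : grpalg C) j :
    elt_rank M (fL (grpalg_ext frob y)) j = elt_rank M (grpalg_incl phi y) j.
  by rewrite /elt_rank /fL /phiL -grpalg_incl_ext module_ext2 rank_map_expr.
have flat_ext y :
    flat_elt (fL (grpalg_ext frob y)) = flat_elt (grpalg_incl phi y).
  by rewrite /flat_elt !rk_ext.
have rkN m (M : {lrmorphism grpalg G -> 'M[k]_m}) y j :
    elt_rank M (fL (- y)) j = elt_rank M (fL y) j.
  by rewrite /elt_rank /fL linearN linearN rank_exprN.
pose Q (v : grpalg CL) := v ^+ p = 0 /\ flat_elt (fL v).
have QzL : Q (- zL).
  split; last by rewrite /flat_elt !rkN !rk_ext.
  by rewrite /zL -rmorphN -rmorphXn exprNn zp mulr0 rmorph0.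
have Qstep v x y : Q v -> x ^+ p = 0 -> (exists d, y ^+ d = 0) -> Q (v + x * y).
  by move=> [vp fv] xp yn; split; [apply: pencil_nilp | apply: flat_pencil].
have [_ flat_Sz] : Q (grpalg_antip zL) by exact: (antip_induction aC uC zp).
have Szp : grpalg_antip z ^+ p = 0 by rewrite -grpalg_antipX zp linear0.
have flat_Sz' : flat_elt (grpalg_incl phi (grpalg_antip z)).
  by rewrite -flat_ext -grpalg_ext_antip.
have [beta rk_beta] := point_of_elt emb uC aC Szp flat_Sz'.
exists beta => m M.
  by move=> j; rewrite rk_beta /pi_rank elt_rank_dual defz grpalg_incl_antip.
move=> max j jp.
pose QM v := Q v /\ forall i, (0 < i < p)%N ->
  elt_rank M (fL v) i = pi_rank alpha M i.
have [_ QMS] : QM (grpalg_antip zL).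
  apply: (antip_induction aC uC zp).
    by split=> // i ip; rewrite rkN rk_ext /pi_rank defz.
  move=> v x y [Qv rkv] xp yn; split; first exact: Qstep.
  move=> i ip; rewrite -rkv //; have [vp fv] := Qv.
  apply: pencil_rank => // gamma le_gamma l lp.
  rewrite rkv //; apply: (maximal_rankP M alpha).1 => // q qp.
  by rewrite -rkv // le_gamma.
by rewrite rk_beta -QMS // -rk_ext grpalg_ext_antip.
Qed.

(** Composition with the antipode exchanges Jordan types on M and on its dual, and
    preserves the Jordan type of a maximal pi-point. *)
Lemma maximal_dual m (M : {lrmorphism grpalg G -> 'M[k]_m})
    (alpha : pi_point p G) :
  maximal_jordan_type M alpha -> maximal_jordan_type (grpalg_dual M) alpha.
Proof.
move=> max; apply/maximal_rankP => beta le_ab j jp.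
have [alpha' rkSa /(_ _ _ max) rka] := antip_point alpha.
have [beta' rkSb _] := antip_point beta.
rewrite -rkSa rka // -rkSb; apply: (maximal_rankP M alpha).1 => // i ip.
by rewrite rkSb -rka // rkSa le_ab.
Qed.

Lemma pi_rank_bidual m (M : {lrmorphism grpalg G -> 'M[k]_m})
    (alpha : pi_point p G) j :
  pi_rank alpha (grpalg_dual (grpalg_dual M)) j = pi_rank alpha M j.
Proof. by rewrite /pi_rank !elt_rank_dual grpalg_antipK. Qed.

End PiPoints.

Lemma rep_iso_of_ranks (F : fieldType) (p m : nat)
    (N N' : {lrmorphism trunc_poly F p -> 'M[F]_m}) : (0 < p)%N ->
    (forall j, (0 < j < p)%N -> \rank (N 'qX ^+ j) = \rank (N' 'qX ^+ j)) ->
  rep_iso N N'.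
Proof.
move=> p_gt0 rk; apply: rep_iso_gen.
apply: (@mx_similar_of_ranks _ _ _ _ _ p) => [||j].
- by rewrite -rmorphXn trunc_gen_nilp // rmorph0.
- by rewrite -rmorphXn trunc_gen_nilp // rmorph0.
case: (posnP j) => [->|j0]; first by rewrite !expr0.
case: (ltnP j p) => [jp|pj]; first by rewrite rk ?j0.
rewrite -(subnK pj) !exprD -![_ 'qX ^+ p]rmorphXn trunc_gen_nilp //.
by rewrite !rmorph0 !mulr0.
Qed.

Theorem proposition6p2 (p : nat) (k : fieldType) (hp : p \in [pchar k])
    (G : finGroupScheme k) (m : nat) (M : {lrmorphism grpalg G -> 'M[k]_m}) :
  (forall alpha : pi_point p G, maximal_jordan_type M alpha ->
     let M_K := module_ext (pi_ext alpha) M in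
     rep_iso (pi_restrict alpha (grpalg_dual M_K)) (pi_restrict alpha M_K) /\
     rep_iso (pi_restrict alpha M_K) (trunc_dual (pi_restrict alpha M_K))) /\
  (forall alpha : pi_point p G,
     maximal_jordan_type M alpha <-> maximal_jordan_type (grpalg_dual M) alpha).
Proof.
have p_pr : prime p by case/andP: hp.
have p_gt0 : (0 < p)%N by exact: prime_gt0.
split=> [alpha max M_K|alpha].
  split; apply: rep_iso_of_ranks => // j jp.
    have [beta rkS /(_ _ _ max) rk] := antip_point hp alpha.
    transitivity (pi_rank alpha M j) => //.
    by rewrite -rk // rkS /pi_rank elt_rank_dual -trmx_expr mxrank_tr.
  set N := pi_restrict alpha M_K.
  have dualX : trunc_dual N 'qX = - (N 'qX)^T.
    by rewrite /trunc_dual trunc_antip_gen ?prime_gt1 // !linearN.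
  rewrite -[X in _ = \rank (X ^+ _)]/(trunc_dual N 'qX) dualX.
  by rewrite rank_exprN -trmx_expr mxrank_tr.
split; first exact: maximal_dual.
move/(maximal_dual hp)/(maximal_rankP hp) => max.
apply/(maximal_rankP hp) => beta le_ab j jp.
rewrite -(pi_rank_bidual M alpha) -(pi_rank_bidual M beta).
by apply: max => // i ip; rewrite !pi_rank_bidual le_ab.
Qed.
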